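(* Let $\Omega$ be an invariant symplectic form on $M=\Gamma\backslash X$ (with $X$, $\Gamma$ as described in the context), and suppose that $\Omega$ is non-zero on the fibres of a $T^2$-fibration $\pi\colon M\to\mathbb{T}^2$ (one of the fibrations described in the context). Then there exists an invariant almost-Kähler structure $(g,J,\Omega)$ on $M$ for which $\pi$ is $J$-holomorphic. For such a structure, if $\sigma=e^F\,\Omega^2$ is a volume form with $F\in C^\infty(\mathbb{T}^2)$ (regarded as a function on $M$ via $\pi$) satisfying $\int_M\sigma=\int_M\Omega^2$, then the associated Calabi–Yau problem has a solution: there is a $2$-form $\tilde\Omega=\Omega+d\alpha$, with $\alpha$ a smooth $1$-form on $M$, which is a positive-definite $(1,1)$-form relative to $J$ and satisfies $\tilde\Omega^2=\sigma$.
   Context: Groups (all with global coordinates $(x,y,z,t)$). $\mathit{Nil}^3$ is the Heisenberg group of real matrices $\begin{pmatrix}1&x&z\\0&1&y\\0&0&1\end{pmatrix}$, and $t$ is the coordinate on the factor $\mathbb{R}$ of $\mathit{Nil}^3\times\mathbb{R}$. $\mathit{Nil}^4$ is the group of real matrices $\begin{pmatrix}1&t&\frac12t^2&x\\0&1&t&y\\0&0&1&z\\0&0&0&1\end{pmatrix}$. $\mathit{Sol}^3\times\mathbb{R}$ is $\mathbb{R}^4$ with product $(x_0,y_0,z_0,t_0)(x,y,z,t)=(x_0+e^{t_0}x,\,y_0+e^{-t_0}y,\,z_0+z,\,t_0+t)$. The discrete groups $\Gamma$ and fibrations. $\Gamma$ is a discrete group acting freely on $X$ with compact quotient $M=\Gamma\backslash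 X$, the total space of an orientable $T^2$-bundle over a $2$-torus, in one of the following families (a generator is identified with the image of $(x,y,z,t)$ under it; parameters are such that these properties hold and the indicated map induces a $T^2$-bundle over a $2$-torus $\mathbb{T}^2$ with flat coordinates the indicated pair): (1a) $X=\mathit{Nil}^3\times\mathbb{R}$, generators (left translations) $(x+1,y,z+y,t)$, $(x,y+1,z,t)$, $(x,y,z+\frac1\lambda,t)$, $(x,y,z,t+1)$, $\lambda\ne0$ an integer; two fibrations, induced by $(x,y,z,t)\mapsto(x,y)$ and by $(x,y,z,t)\mapsto(y,t)$. (1b) $X=\mathit{Nil}^3\times\mathbb{R}$, generators $(x,y,z+\beta_1,t)$, $(x+\alpha_1,y,z+\alpha_1y,t)$, $(x+\alpha_2,y,z+\alpha_2y+\beta_2,t+1)$, $(-x,y+1,-z+\gamma_3,t)$, $\alpha_1,\beta_1\neq0$; fibration induced by $(y,t)$. (1c) $X=\mathit{Nil}^3\times\mathbb{R}$, generators $(x,y,z+\beta_1,t)$, $(x+\alpha_1,y,z+\alpha_1y,t)$, $(x+\alpha_3,y+1,z+\alpha_3y+\beta_4,t)$, $(-x,y,-z,t+1)$, $\alpha_1,\beta_1\neq0$; fibration induced by $(y,t)$. (2) $X=\mathit{Nil}^4$, $\Gamma$ a lattice of $\mathit{Nil}^4$ acting by left multiplication whose image under $(x,y,z,t)\mapsto(z,t)$ is $\mathbb{Z}^2$; fibration induced by $(z,t)$. (3a) $X=\mathit{Sol}^3\times\mathbb{R}$, generators $(x+\alpha_1,y+\beta_1,z,t)$, $(x+\alpha_2,y+\beta_2,z,t)$,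 $(x+\alpha_3,y+\beta_3,z+1,t)$, $(\epsilon e^\delta x+\alpha_4,\epsilon e^{-\delta}y+\beta_4,z,t+\delta)$, $\epsilon=\pm1$; fibration induced by $(z,t)$. (3b) $X=\mathit{Sol}^3\times\mathbb{R}$, generators $(x+\alpha_1,y+\beta_1,z,t)$, $(x+\alpha_2,y+\beta_2,z,t)$, $(-x+\alpha_3,-y+\beta_3,z+1,t)$, $(e^\delta x+\alpha_4,e^{-\delta}y+\beta_4,z,t+\delta)$; fibration induced by $(z,t)$. An almost-Kähler structure $(g,J,\Omega)$ consists of a Riemannian metric $g$, a $g$-orthogonal almost-complex structure $J$ and a closed $2$-form $\Omega$ with $\Omega(X,Y)=g(JX,Y)$. A tensor (or structure) on $M$ is invariant if it is induced from a left-invariant one on $X$ which is also invariant under $\Gamma$. ''$\Omega$ is non-zero on the fibres'' means that its restriction to each fibre is nowhere zero. $\pi$ is $J$-holomorphic if there is a complex structure $\mathbb{J}$ on $\mathbb{T}^2$ with $\pi_*\circ J=\mathbb{J}\circ\pi_*$. A real $2$-form $\omega$ is a positive-definite $(1,1)$-form relative to $J$ if $\omega(JX,JY)=\omega(X,Y)$ for all $X,Y$ and $\omega(X,JX)>0$ for $X\ne0$. *)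

(* Defs.v *)
From HB Require Import structures.
From mathcomp Require Import all_boot all_order all_algebra.
From mathcomp Require Import all_classical all_reals all_analysis.
From mathcomp Require Import ring.
Set Implicit Arguments.
Unset Strict Implicit.
Unset Printing Implicit Defensive.
Import Order.TTheory GRing.Theory Num.Theory.
Import numFieldNormedType.Exports.
Local Open Scope classical_set_scope.
Local Open Scope ring_scope.

(* The groups X all have underlying manifold R^4, so tensors on the quotient
   M = Gamma \ X are encoded as Gamma-invariant tensors on R^4, and functions
   on the base torus as functions on R^2 periodic under the lattice of base
   translations of Gamma.  Tangent vectors are row vectors; a bilinear form is
   the matrix A of (u, v) |-> u A v^T, an endomorphism is the matrix J of
   u |-> u J, a 1-form is the row vector of its components, and a 4-form is
   its coefficient with respect to dx /\ dy /\ dz /\ dt. *)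

Section Coordinates.
Variable R : realType.

Definition pt (x y z t : R) : 'rV[R]_4 := \row_(i < 4) [:: x; y; z; t]`_i.

Definition cx (p : 'rV[R]_4) : R := p 0 (inord 0).
Definition cy (p : 'rV[R]_4) : R := p 0 (inord 1).
Definition cz (p : 'rV[R]_4) : R := p 0 (inord 2).
Definition ct (p : 'rV[R]_4) : R := p 0 (inord 3).

Definition on_coords (f : R -> R -> R -> R -> 'rV[R]_4) (p : 'rV[R]_4) :
  'rV[R]_4 := f (cx p) (cy p) (cz p) (ct p).

Definition pt2 (a b : R) : 'rV[R]_2 := \row_(i < 2) [:: a; b]`_i.

Definition proj_xy (p : 'rV[R]_4) := pt2 (cx p) (cy p).
Definition proj_yt (p : 'rV[R]_4) := pt2 (cy p) (ct p).
Definition proj_zt (p : 'rV[R]_4) := pt2 (cz p) (ct p).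

Lemma cxE x y z t : cx (pt x y z t) = x.
Proof. by rewrite /cx mxE inordK. Qed.
Lemma cyE x y z t : cy (pt x y z t) = y.
Proof. by rewrite /cy mxE inordK. Qed.
Lemma czE x y z t : cz (pt x y z t) = z.
Proof. by rewrite /cz mxE inordK. Qed.
Lemma ctE x y z t : ct (pt x y z t) = t.
Proof. by rewrite /ct mxE inordK. Qed.

End Coordinates.

Section Groups.
Variable R : realType.
Local Notation E := 'rV[R]_4.

(* In each of the three groups the identity element is 0. *)
Definition nil3R_mul (p q : E) : E :=
  pt (cx p + cx q) (cy p + cy q) (cz p + cz q + cx p * cy q) (ct p + ct q).

Definition nil4_mul (p q : E) : E :=
  pt (cx p + cx q + ct p * cy q + 2^-1 * ct p ^+ 2 * cz q)
     (cy p + cy q + ct p * cz q)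
     (cz p + cz q)
     (ct p + ct q).

Definition sol3R_mul (p q : E) : E :=
  pt (cx p + expR (ct p) * cx q) (cy p + expR (- ct p) * cy q)
     (cz p + cz q) (ct p + ct q).

Definition nil3_mx (p : E) : 'M[R]_3 :=
  \matrix_(i < 3, j < 3)
    (nth [::] [:: [:: 1; cx p; cz p];
                  [:: 0; 1;    cy p];
                  [:: 0; 0;    1]] i)`_j.

Definition nil4_mx (p : E) : 'M[R]_4 :=
  \matrix_(i < 4, j < 4)
    (nth [::] [:: [:: 1; ct p; 2^-1 * ct p ^+ 2; cx p];
                  [:: 0; 1;    ct p;             cy p];
                  [:: 0; 0;    1;                cz p];
                  [:: 0; 0;    0;                1]] i)`_j.

Lemma nil3_mxM p q : nil3_mx (nil3R_mul p q) = nil3_mx p *m nil3_mx q.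
Proof.
apply/matrixP => i j; rewrite !mxE !big_ord_recl big_ord0 !mxE /=.
rewrite /nil3R_mul !cxE !cyE !czE.
by case: i => [[|[|[|//]]] /= _]; case: j => [[|[|[|//]]] /= _]; ring.
Qed.

Lemma nil4_mxM p q : nil4_mx (nil4_mul p q) = nil4_mx p *m nil4_mx q.
Proof.
apply/matrixP => i j; rewrite !mxE !big_ord_recl big_ord0 !mxE /=.
rewrite /nil4_mul !cxE !cyE !czE !ctE.
by case: i => [[|[|[|[|//]]]] /= _]; case: j => [[|[|[|[|//]]]] /= _]; field.
Qed.

Definition is_subgroup (mul : E -> E -> E) (H : set E) : Prop :=
  [/\ H 0,
      forall a b, H a -> H b -> H (mul a b) &
      forall a, H a -> exists2 b, H b & mul a b = 0].

(* For the nilpotent groups to which this is applied, finite covolume and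
   cocompactness of a discrete subgroup are equivalent. *)
Definition is_lattice (mul : E -> E -> E) (H : set E) : Prop :=
  [/\ is_subgroup mul H,
      \forall a \near (0 : E), H a -> a = 0 &
      exists2 K : set E, compact K &
        forall p, exists a k, [/\ H a, K k & p = mul a k]].

Definition left_translations (mul : E -> E -> E) (H : set E) : set (E -> E) :=
  [set mul a | a in H].

End Groups.

Section Actions.
Variable R : realType.
Local Notation E := 'rV[R]_4.
Local Notation B := 'rV[R]_2.
Implicit Types (Gamma : set (E -> E)) (pr : E -> B).

Definition transformation_group Gamma : Prop :=
  [/\ Gamma id,
      forall f g, Gamma f -> Gamma g -> Gamma (f \o g) &
      forall f, Gamma f -> exists2 g, Gamma g & cancel f g /\ cancel g f].

Definition generated (S : set (E -> E)) : set (E -> E) :=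
  smallest transformation_group S.

Definition acts_freely Gamma : Prop :=
  forall f p, Gamma f -> f p = p -> f = id.

Definition acts_properly_discontinuously Gamma : Prop :=
  forall K : set E, compact K ->
    finite_set [set f | Gamma f /\ (f @` K) `&` K !=set0].

Definition acts_cocompactly Gamma : Prop :=
  exists2 K : set E, compact K &
    forall p, exists f k, [/\ Gamma f, K k & p = f k].

Definition rank2_lattice n (L : set 'rV[R]_n) : Prop :=
  exists u v : 'rV[R]_n, row_free (col_mx u v) /\
    L = [set w | exists a b : int, w = a%:~R *: u + b%:~R *: v].

Definition base_lattice Gamma pr : set B :=
  [set v | exists2 f, Gamma f & forall p, pr (f p) = pr p + v].

(* pr descends to a bundle of 2-tori, with orientable total space, over the
   flat torus R^2 / base_lattice: Gamma acts on the base as a lattice of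
   translations, and the stabiliser of a point b of the base acts on the fibre
   of pr over b as a lattice of translations. *)
Definition torus_bundle Gamma pr : Prop :=
  [/\ forall f, Gamma f -> exists v, forall p, pr (f p) = pr p + v,
      rank2_lattice (base_lattice Gamma pr),
      forall b : B, exists2 L : set E, rank2_lattice L &
        forall q, pr q = b ->
          [set f q - q | f in [set f | Gamma f /\ pr (f q) = pr q]] = L &
      forall f p, Gamma f -> 0 < \det (jacobian f p)].

(* A fundamental domain is a measurable set of representatives of the orbits;
   R^4 carries the Borel sigma-algebra and Lebesgue measure of (R^2)^2. *)
Definition leb2 := (@lebesgue_measure R \x @lebesgue_measure R)%E.
Definition leb4 := (leb2 \x leb2)%E.

Definition of_pairs (w : (R * R) * (R * R)) : E :=
  pt w.1.1 w.1.2 w.2.1 w.2.2.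

Definition fundamental_domain Gamma (D : set E) : Prop :=
  measurable (of_pairs @^-1` D : set ((measurableTypeR R * measurableTypeR R)
                        * (measurableTypeR R * measurableTypeR R))%type) /\
  forall p, exists! q, D q /\ exists2 f, Gamma f & f p = q.

(* The integral over M = Gamma \ R^4 of a Gamma-invariant 4-form. *)
Definition integral_over (D : set E) (sigma : E -> R) : \bar R :=
  (\int[leb4]_(w in of_pairs @^-1` D) (sigma (of_pairs w))%:E)%E.

End Actions.

Section Families.
Variable R : realType.
Local Notation E := 'rV[R]_4.
Local Notation B := 'rV[R]_2.
Local Notation tr f := (on_coords f).

Definition Z2 : set B := [set v | exists a b : int, v = pt2 a%:~R b%:~R].

Definition Gamma1a (l : int) : set (E -> E) := generated
  [set tr (fun x y z t => pt (x + 1) y (z + y) t);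
       tr (fun x y z t => pt x (y + 1) z t);
       tr (fun x y z t => pt x y (z + 1 / l%:~R) t);
       tr (fun x y z t => pt x y z (t + 1))].

Definition Gamma1b (a1 a2 b1 b2 c3 : R) : set (E -> E) := generated
  [set tr (fun x y z t => pt x y (z + b1) t);
       tr (fun x y z t => pt (x + a1) y (z + a1 * y) t);
       tr (fun x y z t => pt (x + a2) y (z + a2 * y + b2) (t + 1));
       tr (fun x y z t => pt (- x) (y + 1) (- z + c3) t)].

Definition Gamma1c (a1 a3 b1 b4 : R) : set (E -> E) := generated
  [set tr (fun x y z t => pt x y (z + b1) t);
       tr (fun x y z t => pt (x + a1) y (z + a1 * y) t);
       tr (fun x y z t => pt (x + a3) (y + 1) (z + a3 * y + b4) t);
       tr (fun x y z t => pt (- x) y (- z) (t + 1))].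

Definition Gamma3a (a1 a2 a3 a4 b1 b2 b3 b4 e d : R) : set (E -> E) := generated
  [set tr (fun x y z t => pt (x + a1) (y + b1) z t);
       tr (fun x y z t => pt (x + a2) (y + b2) z t);
       tr (fun x y z t => pt (x + a3) (y + b3) (z + 1) t);
       tr (fun x y z t => pt (e * expR d * x + a4) (e * expR (- d) * y + b4)
                             z (t + d))].

Definition Gamma3b (a1 a2 a3 a4 b1 b2 b3 b4 d : R) : set (E -> E) := generated
  [set tr (fun x y z t => pt (x + a1) (y + b1) z t);
       tr (fun x y z t => pt (x + a2) (y + b2) z t);
       tr (fun x y z t => pt (- x + a3) (- y + b3) (z + 1) t);
       tr (fun x y z t => pt (expR d * x + a4) (expR (- d) * y + b4)
                             z (t + d))].

(* fibration_family mul Gamma pr: pr induces one of the fibrations considered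
   on the quotient by Gamma of the group with product mul. *)
Inductive fibration_family :
    (E -> E -> E) -> set (E -> E) -> (E -> B) -> Prop :=
| Family1a_xy (l : int) : l != 0 ->
    fibration_family (@nil3R_mul R) (Gamma1a l) (@proj_xy R)
| Family1a_yt (l : int) : l != 0 ->
    fibration_family (@nil3R_mul R) (Gamma1a l) (@proj_yt R)
| Family1b (a1 a2 b1 b2 c3 : R) : a1 != 0 -> b1 != 0 ->
    fibration_family (@nil3R_mul R) (Gamma1b a1 a2 b1 b2 c3) (@proj_yt R)
| Family1c (a1 a3 b1 b4 : R) : a1 != 0 -> b1 != 0 ->
    fibration_family (@nil3R_mul R) (Gamma1c a1 a3 b1 b4) (@proj_yt R)
| Family2 (H : set E) : is_lattice (@nil4_mul R) H ->
    [set proj_zt a | a in H] = Z2 ->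
    fibration_family (@nil4_mul R) (left_translations (@nil4_mul R) H)
      (@proj_zt R)
| Family3a (a1 a2 a3 a4 b1 b2 b3 b4 e d : R) : e = 1 \/ e = -1 ->
    fibration_family (@sol3R_mul R)
      (Gamma3a a1 a2 a3 a4 b1 b2 b3 b4 e d) (@proj_zt R)
| Family3b (a1 a2 a3 a4 b1 b2 b3 b4 d : R) :
    fibration_family (@sol3R_mul R)
      (Gamma3b a1 a2 a3 a4 b1 b2 b3 b4 d) (@proj_zt R).

End Families.

Section Tensors.
Variable R : realType.
Local Notation E := 'rV[R]_4.
Local Notation B := 'rV[R]_2.
Implicit Types (Gamma : set (E -> E)) (mul : E -> E -> E) (pr : E -> B).
Implicit Types (w g J : E -> 'M[R]_4) (al : E -> 'rV[R]_4).

Definition partial n (i : 'I_n) (f : 'rV[R]_n -> R) (p : 'rV[R]_n) : R :=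
  'D_(delta_mx 0 i) f p.

Fixpoint Ck n (k : nat) (f : 'rV[R]_n -> R) : Prop :=
  if k is k'.+1 then
    forall i : 'I_n,
      (forall p, derivable f p (delta_mx 0 i)) /\ Ck k' (partial i f)
  else continuous f.

Definition smooth n (f : 'rV[R]_n -> R) : Prop := forall k, Ck k f.

Definition smooth_mx n a b (A : 'rV[R]_n -> 'M[R]_(a, b)) : Prop :=
  forall i j, smooth (fun p => A p i j).

Definition bil n (A : 'M[R]_n) (u v : 'rV[R]_n) : R := (u *m A *m v^T) 0 0.

Definition preserves_form (f : E -> E) w : Prop :=
  forall p u v, bil (w (f p)) ('d f p u) ('d f p v) = bil (w p) u v.

Definition preserves_endo (f : E -> E) J : Prop :=
  forall p u, 'd f p u *m J (f p) = 'd f p (u *m J p).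

Definition preserves_1form (f : E -> E) al : Prop :=
  forall p u, ('d f p u *m (al (f p))^T) 0 0 = (u *m (al p)^T) 0 0.

Definition invariant_form mul Gamma w : Prop :=
  (forall a, preserves_form (mul a) w) /\
  (forall f, Gamma f -> preserves_form f w).

Definition invariant_endo mul Gamma J : Prop :=
  (forall a, preserves_endo (mul a) J) /\
  (forall f, Gamma f -> preserves_endo f J).

Definition two_form w : Prop :=
  smooth_mx w /\ forall p i j, w p i j = - w p j i.

(* The (i, j, k) component of dw is
   D_i w_jk + D_j w_ki + D_k w_ij. *)
Definition closed_form w : Prop :=
  forall p (i j k : 'I_4),
    partial i (fun q => w q j k) p + partial j (fun q => w q k i) p
    + partial k (fun q => w q i j) p = 0.

Definition ext_d al (p : E) : 'M[R]_4 :=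
  \matrix_(i, j) (partial i (fun q => al q 0 j) p
                  - partial j (fun q => al q 0 i) p).

Definition entry (a : 'M[R]_4) (i j : nat) : R := a (inord i) (inord j).

(* With v = 1/2 sum_ij v_ij dx^i /\ dx^j and likewise w, the coefficient of
   v /\ w with respect to dx /\ dy /\ dz /\ dt. *)
Definition wedge (v w : 'M[R]_4) : R :=
  entry v 0 1 * entry w 2 3 - entry v 0 2 * entry w 1 3
  + entry v 0 3 * entry w 1 2 + entry v 1 2 * entry w 0 3
  - entry v 1 3 * entry w 0 2 + entry v 2 3 * entry w 0 1.

Definition symplectic w : Prop :=
  [/\ two_form w, closed_form w &
      forall p u, (forall v, bil (w p) u v = 0) -> u = 0].

Definition nonzero_on_fibres pr w : Prop :=
  forall p, exists u v,
    [/\ 'd pr p u = 0, 'd pr p v = 0 & bil (w p) u v != 0].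

Definition riemannian_metric g : Prop :=
  [/\ smooth_mx g,
      forall p u v, bil (g p) u v = bil (g p) v u &
      forall p u, u != 0 -> 0 < bil (g p) u u].

Definition almost_complex n (J : 'rV[R]_n -> 'M[R]_n) : Prop :=
  smooth_mx J /\ forall p, J p *m J p = - 1%:M.

Definition almost_kahler g J w : Prop :=
  [/\ riemannian_metric g, almost_complex J,
      forall p u v, bil (g p) (u *m J p) (v *m J p) = bil (g p) u v,
      two_form w /\ closed_form w &
      forall p u v, bil (w p) u v = bil (g p) (u *m J p) v].

Definition invariant_almost_kahler mul Gamma g J w : Prop :=
  [/\ almost_kahler g J w, invariant_form mul Gamma g,
      invariant_endo mul Gamma J & invariant_form mul Gamma w].

Definition base_periodic (L : set B) T (h : B -> T) : Prop :=
  forall b v, L v -> h (b + v) = h b.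

(* Every almost-complex structure on a surface is integrable, so the complex
   structures on the base torus are its almost-complex structures. *)
Definition J_holomorphic Gamma pr J : Prop :=
  exists JB : B -> 'M[R]_2,
    [/\ almost_complex JB, base_periodic (base_lattice Gamma pr) JB &
        forall p u, 'd pr p (u *m J p) = 'd pr p u *m JB (pr p)].

Definition positive_11 J w : Prop :=
  [/\ two_form w,
      forall p u v, bil (w p) (u *m J p) (v *m J p) = bil (w p) u v &
      forall p u, u != 0 -> 0 < bil (w p) u (u *m J p)].

End Tensors.

(* Main.v *)
Require Import Defs.
From HB Require Import structures.
From mathcomp Require Import all_boot all_order all_algebra.
From mathcomp Require Import all_classical all_reals all_analysis.
From mathcomp Require Import measurable_realfun ring lra.
Set Implicit Arguments.
Unset Strict Implicit.
Unset Printing Implicit Defensive.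
Import Order.TTheory GRing.Theory Num.Theory.
Import numFieldNormedType.Exports.
Local Open Scope classical_set_scope.
Local Open Scope ring_scope.

(** Let x_i, x_j be the coordinates of the base of the fibration and x_k, x_l
    those of the fibre.  The perturbed form is
      Omega + (exp F - 1) (Pf / Omega_kl) dx_i /\ dx_j,
    where Pf is the Pfaffian of Omega, so that Omega^2 is Pf up to a constant;
    both Pf and Omega_kl are constant, because left translations act on tangent
    vectors by matrices M(a) that preserve the fibre direction, its area and the
    projection to the base.  Adding c dx_i /\ dx_j to Omega adds c Omega_kl to
    the Pfaffian (pfaffianD), so the square of the perturbed form is
    exp F Omega^2.  No equation remains to be solved; three facts are needed.

    The perturbed form is a positive (1,1)-form.  As the projection is
    J-holomorphic, J induces a complex structure on each tangent space of the
    base; it has determinant 1 and hence preserves dx_i /\ dx_j (base_area_J).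
    A tangent vector is the sum of a vertical vector and of a vector that is
    Omega-orthogonal to the fibre; J preserves this splitting, and on the second
    summand dx_i /\ dx_j equals (Omega_kl / Pf) Omega (horizontal_pfaffian).
    The perturbation thus multiplies the horizontal part of Omega by exp F and
    leaves the vertical part unchanged (rescaled_positive).

    The perturbation is exact.  A doubly periodic function on the plane minus
    its average is the curl of a periodic vector field, obtained by integrating
    against a linear weight along each of the two periods (periodic_curl), and
    this 1-form is pulled back to R^4.

    The average of exp F over the base torus is 1.  The hypothesis on volumes is
    about integrals over a fundamental domain of Gamma in R^4.  Right
    translations by elements with vanishing fibre coordinates commute with
    Gamma, preserve the Lebesgue measure and act on the base by arbitrary
    translations; so the integral over a fundamental domain of a function pulled
    back from the base is unchanged when the function is translated, and by
    Tonelli when it is replaced by its average (mean_mean_eq1).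

    For the existence of the almost-Kaehler structure it suffices to choose J at
    the identity and to move it by left translations.  At the identity, J
    rotates the fibre and its Omega-orthogonal complement by a right angle, in
    the directions in which Omega is positive (adapted_J).  Elements of Gamma
    are left translations, possibly composed with the reflection of the fibre
    coordinates; when the reflection occurs, invariance of Omega rules out mixed
    components, and J commutes with the reflection (adapted_J_twist).

    All this is done for an arbitrary group structure a + p M(a) on R^4 with the
    properties listed in fibred_model, which are then verified for the three
    groups and their fibrations. *)

(** * Smooth functions on Euclidean space *)

Section DirectionalDerivatives.
Variables (R : realType) (V : normedModType R).
Implicit Types (f : V -> R) (p u v : V).

Lemma is_derive_line f p v (s : R) : derivable f (p + s *: v) v ->
  is_derive s 1 (fun r : R => f (p + r *: v)) ('D_v f (p + s *: v)).
Proof.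
have eq_quot : (fun h : R => h^-1 *: (f (p + (h *: 1 + s) *: v) - f (p + s *: v)))
    = (fun h => h^-1 *: (f (h *: v + (p + s *: v)) - f (p + s *: v))).
  apply/funext => h; congr (_ *: (f _ - _)).
  by rewrite [h *: 1]mulr1 scalerDl addrCA.
move=> df; apply: DeriveDef; first by rewrite /derivable /= eq_quot.
by rewrite /derive /= eq_quot.
Qed.

Lemma continuous_line f p v : continuous f ->
  continuous (fun r : R => f (p + r *: v)).
Proof.
move=> cf s; apply: (@continuous_comp _ _ _ (fun r : R => p + r *: v)); last exact: cf.
by apply: continuousD; [exact: cst_continuous|exact: scalel_continuous].
Qed.

(** The intermediate point is only located in [-1, 1]. *)
Lemma MVT_line f p v : (forall q, derivable f q v) ->
  exists2 th : R, `|th| <= 1 & f (p + v) - f p = 'D_v f (p + th *: v).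
Proof.
move=> df.
have cf : continuous (fun r : R => f (p + r *: v)).
  move=> s; apply: differentiable_continuous.
  by apply/derivable1_diffP; have [] := is_derive_line (df (p + s *: v)).
have [//||c] := @MVT_segment R (fun r => f (p + r *: v))
    (fun r => 'D_v f (p + r *: v)) 0 1 ler01.
- by move=> x _; exact: is_derive_line.
- exact: continuous_subspaceT.
rewrite in_itv/= => /andP[c0 c1].
rewrite scale1r scale0r addr0 subr0 mulr1 => ->.
by exists c => //; rewrite ger0_norm.
Qed.

(** The derivative along c v, without assuming f differentiable. *)
Lemma is_derive_scaledir f p v (c : R) : derivable f p v ->
  is_derive p (c *: v) f (c * 'D_v f p).
Proof.
move=> df; have [->|c0] := eqVneq c 0.
  by rewrite scale0r mul0r; exact: is_derive0.
have key : h^-1 *: (f (h *: (c *: v) + p) - f p) @[h --> (0 : R)^'] -->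
    c * 'D_v f p.
  have lim : (c * h)^-1 *: (f ((c * h) *: v + p) - f p) @[h --> (0 : R)^'] -->
      'D_v f p.
    apply: (@cvg_comp _ _ _ (fun h : R => c * h)
      (fun h => h^-1 *: (f (h *: v + p) - f p)) (0 : R)^' (0 : R)^'); last exact: df.
    move=> A [e /= e0 eA]; exists (e / `|c|) => /=; first by rewrite divr_gt0 ?normr_gt0.
    move=> h; rewrite /ball_/= sub0r normrN ltr_pdivlMr ?normr_gt0// => hd h0.
    apply: eA; last by rewrite mulf_neq0.
    by rewrite /ball_/= sub0r normrN normrM mulrC.
  have lim2 : c * ((c * h)^-1 *: (f ((c * h) *: v + p) - f p)) @[h --> (0 : R)^']
      --> c * 'D_v f p by apply: cvgM; [exact: cvg_cst|exact: lim].
  apply: cvg_trans lim2; apply: near_eq_cvg; near=> h.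
  have -> : h *: (c *: v) = (c * h) *: v by rewrite scalerA mulrC.
  by rewrite /= -[LHS]/(c * (_ * _)) -[RHS]/(_ * _) mulrA invfM mulrA divff// mul1r.
apply: DeriveDef; first by apply/cvg_ex; exists (c * 'D_v f p).
exact: cvg_lim.
Unshelve. all: by end_near. Qed.

(** Additivity in the direction; only the derivative along v has to be
    continuous. *)
Lemma is_derive_adddir f p u v :
  derivable f p u -> (forall q, derivable f q v) ->
  continuous (fun q => 'D_v f q) ->
  is_derive p (u + v) f ('D_u f p + 'D_v f p).
Proof.
move=> dfu dfv cDv.
have key : h^-1 *: (f (h *: (u + v) + p) - f p) @[h --> (0 : R)^'] -->
    'D_u f p + 'D_v f p.
  pose g (h : R) := h^-1 *: (f ((h *: u + p) + h *: v) - f (h *: u + p)).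
  have gcvg : g h @[h --> (0 : R)^'] --> 'D_v f p.
    apply/cvgrPdist_lt => e e0.
    have /cvgrPdist_lt/(_ _ e0)/nbhs_ballP[d /= d0 dP] := cDv p.
    have : \forall h \near (0 : R)^', `|h| * (`|u| + `|v| + 1) < d.
      have uv0 : 0 < `|u| + `|v| + 1 by rewrite ltr_wpDl// addr_ge0.
      exists (d / (`|u| + `|v| + 1)) => /=; first by rewrite divr_gt0.
      by move=> h; rewrite /ball_/= sub0r normrN ltr_pdivlMr.
    move=> hd; near=> h.
    have h0 : h != 0 by near: h; exact: nbhs_dnbhs_neq.
    have dfhv q : derivable f q (h *: v) by have [] := is_derive_scaledir h (dfv q).
    have [th th1 fE] := @MVT_line f (h *: u + p) (h *: v) dfhv.
    rewrite /g fE.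
    have -> : 'D_(h *: v) f (h *: u + p + th *: (h *: v)) =
        h * 'D_v f (h *: u + p + th *: (h *: v)).
      by have [_ ->] := is_derive_scaledir h (dfv (h *: u + p + th *: (h *: v))).
    rewrite /GRing.scale/= mulrA mulVf// mul1r; apply: dP; rewrite /= -ball_normE/=.
    rewrite [h *: u + p]addrC -addrA opprD addrA subrr add0r normrN.
    have hd' : `|h| * (`|u| + `|v| + 1) < d by near: h.
    apply: le_lt_trans hd'; rewrite (le_trans (ler_normD _ _))//.
    rewrite !normrZ 2!mulrDr mulr1 -[leLHS]addr0 lerD// lerD2l.
    by rewrite ler_piMl// mulr_ge0.
  have lim : h^-1 *: (f (h *: u + p) - f p) + g h @[h --> (0 : R)^'] -->
      'D_u f p + 'D_v f p by apply: cvgD; [exact: dfu|exact: gcvg].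
  apply: cvg_trans lim; apply: near_eq_cvg; near=> h.
  have -> : h *: (u + v) + p = h *: u + p + h *: v by rewrite scalerDr addrAC.
  rewrite /g -scalerDr; congr (_ *: _).
  by ring.
apply: DeriveDef; first by apply/cvg_ex; exists ('D_u f p + 'D_v f p).
exact: cvg_lim.
Unshelve. all: by end_near. Qed.

End DirectionalDerivatives.

Section SmoothFunctions.
Variables (R : realType) (n : nat).
Implicit Types (f g : 'rV[R]_n -> R) (p u : 'rV[R]_n).

Lemma smooth_continuous f : smooth f -> continuous f.
Proof. by move=> /(_ 0%N). Qed.

Lemma smooth_derivable f p (i : 'I_n) :
  smooth f -> derivable f p (delta_mx 0 i).
Proof. by move=> /(_ 1%N)/(_ i)[+ _]; exact. Qed.

Arguments smooth_derivable {f} p i.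

Lemma smooth_partial f (i : 'I_n) : smooth f -> smooth (partial i f).
Proof. by move=> sf k; have [_] := sf k.+1 i. Qed.

(** Although the definition of smoothness refers to the coordinate directions
    only, a smooth function has derivatives in all directions. *)
Lemma smooth_is_derive f p u : smooth f ->
  is_derive p u f (\sum_i u 0 i * partial i f p).
Proof.
move=> sf; rewrite [in X in is_derive _ X _ _](row_sum_delta u).
have cpart i : continuous (partial i f).
  exact/smooth_continuous/smooth_partial.
suff H (s : seq 'I_n) q : is_derive q (\sum_(i <- s) u 0 i *: delta_mx 0 i) f
    (\sum_(i <- s) u 0 i * partial i f q) by exact: H.
elim: s q => [|i s IH] q; first by rewrite !big_nil; exact: is_derive0.
rewrite !big_cons addrC [X in is_derive _ _ _ X]addrC.
have [dIH <-] := IH q.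
have di r := is_derive_scaledir (u 0 i) (smooth_derivable r i sf).
rewrite {1}/partial; have [_ <-] := di q.
apply: is_derive_adddir => //.
rewrite (_ : 'D_(_) f = (fun r => u 0 i * partial i f r)); last first.
  by apply/funext => r; have [_ ->] := di r.
by move=> r; apply: continuousM; [exact: cst_continuous|exact: cpart].
Qed.

Arguments smooth_is_derive {f} p u.

Lemma smooth_derivable_dir f p u : smooth f -> derivable f p u.
Proof. by move=> sf; have [? ?] := smooth_is_derive p u sf. Qed.

Lemma smooth_deriveE f p u : smooth f ->
  'D_u f p = \sum_i u 0 i * partial i f p.
Proof. by move=> sf; have [? ?] := smooth_is_derive p u sf. Qed.

Lemma Ck_cst (c : R) k : Ck k (fun _ : 'rV[R]_n => c).
Proof.
elim: k c => [c|k IH c i] /=; first exact: cst_continuous.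
split=> [p|]; first exact: derivable_cst.
rewrite (_ : partial i _ = fun=> 0); first exact: IH.
by apply/funext => p; exact: derive_cst.
Qed.

Lemma smooth_cst (c : R) : smooth (fun _ : 'rV[R]_n => c).
Proof. by move=> k; exact: Ck_cst. Qed.

Lemma smooth_coord (j : 'I_n) : smooth (fun p : 'rV[R]_n => p 0 j).
Proof.
case=> [|k i] /=; first exact: coord_continuous.
have dc p : is_derive p (delta_mx 0 i) (fun p : 'rV[R]_n => p 0 j)
   ((delta_mx 0 i : 'rV[R]_n) 0 j).
  have df := differentiable_coord p 0 j.
  apply: DeriveDef; first exact: diff_derivable.
  apply: cvg_lim => //.
  have lim : (fun h : R => (delta_mx 0 i : 'rV[R]_n) 0 j) @ (0 : R)^' -->
      (delta_mx 0 i : 'rV[R]_n) 0 j by exact: cvg_cst.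
  apply: cvg_trans lim; apply: near_eq_cvg; near=> h.
  rewrite /= !mxE addrK -[RHS]/(_ * _) mulKf//.
  by near: h; exact: nbhs_dnbhs_neq.
split=> [p|]; first by have [? ?] := dc p.
rewrite (_ : partial i _ = fun=> (delta_mx 0 i : 'rV[R]_n) 0 j).
  exact: Ck_cst.
by apply/funext => p; have [? ?] := dc p.
Unshelve. all: by end_near. Qed.

Lemma CkD k f g : Ck k f -> Ck k g -> Ck k (fun p => f p + g p).
Proof.
elim: k f g => [|k IH] f g /= cf cg.
  by move=> p; apply: continuousD; [exact: cf|exact: cg].
move=> i; have [df pf] := cf i; have [dg pg] := cg i.
split=> [p|]; first exact: (derivableD (df p) (dg p)).
rewrite (_ : partial i _ = fun p => partial i f p + partial i g p).
  exact: IH.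
by apply/funext => p; exact: (deriveD (df p) (dg p)).
Qed.

Lemma smoothD f g : smooth f -> smooth g -> smooth (fun p => f p + g p).
Proof. by move=> sf sg k; exact: CkD. Qed.

Lemma partialM f g p (i : 'I_n) : smooth f -> smooth g ->
  partial i (fun q => f q * g q) p = partial i f p * g p + f p * partial i g p.
Proof.
move=> sf sg; have := deriveM (smooth_derivable p i sf) (smooth_derivable p i sg).
by rewrite /partial => ->; rewrite addrC [_ *: _]mulrC.
Qed.

Lemma smoothM f g : smooth f -> smooth g -> smooth (fun p => f p * g p).
Proof.
move=> sf sg k; elim: k f g sf sg => [|k IH] f g sf sg /=.
  by move=> p; apply: continuousM; exact: smooth_continuous.
move=> i; split=> [p|]; first exact: (derivableM (smooth_derivable p i sf) (smooth_derivable p i sg)).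
rewrite (_ : partial i _ = fun p => partial i f p * g p + f p * partial i g p).
  by apply: CkD; apply: IH => //; exact: smooth_partial.
by apply/funext => p; exact: partialM.
Qed.

Lemma smoothN f : smooth f -> smooth (fun p => - f p).
Proof.
move=> sf; rewrite (_ : (fun p => _) = fun p => -1 * f p); last first.
  by apply/funext => p; rewrite mulN1r.
by apply: smoothM => //; exact: smooth_cst.
Qed.

Lemma smooth_sum (I : Type) (r : seq I) (F : I -> 'rV[R]_n -> R) :
  (forall i, smooth (F i)) -> smooth (fun p => \sum_(i <- r) F i p).
Proof.
move=> sF; elim: r => [|i r IH].
  rewrite (_ : (fun p => _) = fun=> 0); first exact: smooth_cst.
  by apply/funext => p; rewrite big_nil.
rewrite (_ : (fun p => _) = fun p => F i p + \sum_(j <- r) F j p).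
  exact: smoothD.
by apply/funext => p; rewrite big_cons.
Qed.

Lemma smooth_derive_dir f u : smooth f -> smooth (fun q => 'D_u f q).
Proof.
move=> sf; rewrite (_ : (fun q => _) = fun q => \sum_i u 0 i * partial i f q).
  by apply: smooth_sum => i; apply: smoothM; [exact: smooth_cst|
    exact: smooth_partial].
by apply/funext => q; rewrite smooth_deriveE.
Qed.
Arguments smooth_derive_dir {f} u.

Lemma smooth_expR f : smooth f -> smooth (fun p => expR (f p)).
Proof.
move=> sf k.
(* The derivatives of exp f are products of exp f with smooth functions. *)
suff H g : smooth g -> Ck k (fun p => g p * expR (f p)).
  rewrite (_ : (fun p => _) = fun p => 1 * expR (f p)).
    by apply: H; exact: smooth_cst.
  by apply/funext => p; rewrite mul1r.
elim: k g => [|k IH] g sg /=.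
  move=> p; apply: (@continuousM _ _ g (fun q => expR (f q))).
    exact: smooth_continuous.
  apply: (@continuous_comp _ _ _ f expR); first exact: smooth_continuous.
  exact: continuous_expR.
move=> i.
have dexp p : is_derive p (delta_mx 0 i) (fun q => expR (f q))
    (partial i f p * expR (f p)).
  have df := smooth_derivable p i sf.
  have H : is_derive (0 : R) 1 (fun h : R => expR (f (h *: delta_mx 0 i + p)))
     (expR (f p) *: partial i f p).
    apply: (@is_derive1_comp _ expR (fun h : R => f (h *: delta_mx 0 i + p))).
      by rewrite scale0r add0r; exact: is_derive_expR.
    have := @is_derive_line _ _ f p (delta_mx 0 i) 0.
    rewrite scale0r addr0 => /(_ df).
    rewrite (_ : (fun r => _) = (fun h : R => f (h *: delta_mx 0 i + p))) //.
    by apply/funext => h; rewrite addrC.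
  have [H1 H2] := H.
  apply: DeriveDef; first by apply/(derivable1P (fun q => expR (f q)) p (delta_mx 0 i)).
  rewrite [RHS]mulrC; move: H2; rewrite /derive /= => H2; rewrite -[RHS]H2.
  rewrite (_ : (fun h : R => h^-1 *: (expR (f ((h *: 1 + 0) *: 'e_i + p)) - _)) =
    (fun h => h^-1 *: (expR (f (h *: 'e_i + p)) - expR (f p)))) //.
  by apply/funext => h; rewrite addr0 scale0r add0r [_%:A]mulr1.
split=> [p|].
  by apply: (derivableM (smooth_derivable p i sg)); have [? ?] := dexp p.
rewrite (_ : partial i _ =
    fun p => (partial i g p + g p * partial i f p) * expR (f p)).
  by apply: IH; apply: smoothD; [|apply: smoothM => //]; exact: smooth_partial.
apply/funext => p; have [d1 d2] := dexp p.
have := deriveM (smooth_derivable p i sg) d1.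
rewrite /partial => ->; rewrite d2 -![_ *: _]/(_ * _) /partial.
by ring.
Qed.

End SmoothFunctions.

Arguments smooth_derivable {R n f} p i.
Arguments smooth_is_derive {R n f} p u.
Arguments smooth_derive_dir {R n f} u.

Section SmoothComposition.
Variables (R : realType) (m n : nat) (P : 'M[R]_(m, n)).
Implicit Types f : 'rV[R]_n -> R.

Lemma mulmx_continuous : continuous (fun p : 'rV[R]_m => p *m P).
Proof.
rewrite (_ : (fun p => _) = fun p : 'rV[R]_m => \sum_i p 0 i *: row i P).
  have := @continuous_big 'rV[R]_n 'I_m +%R 0 predT
    (@add_continuous 'rV[R]_n) 'rV[R]_m (index_enum 'I_m)
    (fun i q => q 0 i *: row i P).
  apply=> i _ p; have ci := @coord_continuous R 1 m 0 i p.
  exact: (cvgZr_tmp ci).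
by apply/funext => p; rewrite mulmx_sum_row.
Qed.

Lemma partial_comp_linear f (p : 'rV[R]_m) (i : 'I_m) : smooth f ->
  is_derive p (delta_mx 0 i) (fun q => f (q *m P))
    (\sum_j P i j * partial j f (p *m P)).
Proof.
move=> sf; have [df De] := smooth_is_derive (p *m P) (row i P) sf.
have eq_quot : (fun h : R => h^-1 *: (f ((h *: delta_mx 0 i + p) *m P) - f (p *m P)))
    = (fun h => h^-1 *: (f (h *: row i P + p *m P) - f (p *m P))).
  by apply/funext => h; rewrite mulmxDl -scalemxAl -rowE.
apply: DeriveDef; first by rewrite /derivable /= eq_quot.
rewrite /derive /= eq_quot -/(derive _ _ _) -[LHS]/('D_(row i P) f (p *m P)) De.
by apply: eq_bigr => j _; rewrite !mxE.
Qed.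

Lemma smooth_comp_linear f : smooth f -> smooth (fun p => f (p *m P)).
Proof.
move=> sf k; elim: k f sf => [|k IH] f sf /=.
  move=> p; have H1 := @mulmx_continuous p.
  have H2 := @smooth_continuous _ _ f sf (p *m P).
  exact: (continuous_comp H1 H2).
move=> i; split=> [p|]; first by have [? ?] := partial_comp_linear p i sf.
rewrite (_ : partial i _ = fun p => \sum_j P i j * partial j f (p *m P)).
  have : forall r : seq 'I_n,
      Ck k (fun p => \sum_(j <- r) P i j * partial j f (p *m P)).
    elim=> [|j r IHr].
      rewrite (_ : (fun p => _) = fun=> 0); first exact: Ck_cst.
      by apply/funext => p; rewrite big_nil.
    rewrite (_ : (fun p => _) = fun p => P i j * partial j f (p *m P) +
      \sum_(j <- r) P i j * partial j f (p *m P)); last first.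
      by apply/funext => p; rewrite big_cons.
    apply: CkD => //.
    apply: (IH (fun q => P i j * partial j f q)).
    by apply: smoothM; [exact: smooth_cst|exact: smooth_partial].
  exact.
by apply/funext => p; have [? ?] := partial_comp_linear p i sf.
Qed.

End SmoothComposition.

Section SmoothMatrices.
Variables (R : realType) (n : nat).

Lemma smooth_mx_cst a b (A : 'M[R]_(a, b)) : smooth_mx (fun _ : 'rV[R]_n => A).
Proof. by move=> i j; exact: smooth_cst. Qed.

Lemma smooth_mxD a b (A B : 'rV[R]_n -> 'M[R]_(a, b)) :
  smooth_mx A -> smooth_mx B -> smooth_mx (fun p => A p + B p).
Proof.
move=> sA sB i j; rewrite (_ : (fun p => _) = fun p => A p i j + B p i j).
  exact: smoothD.
by apply/funext => p; rewrite mxE.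
Qed.

Lemma smooth_mxM a b c (A : 'rV[R]_n -> 'M[R]_(a, b))
    (B : 'rV[R]_n -> 'M[R]_(b, c)) :
  smooth_mx A -> smooth_mx B -> smooth_mx (fun p => A p *m B p).
Proof.
move=> sA sB i j; rewrite (_ : (fun p => _) = fun p => \sum_k A p i k * B p k j).
  by apply: smooth_sum => k; exact: smoothM.
by apply/funext => p; rewrite mxE.
Qed.

Lemma smooth_mxZ a b (c : 'rV[R]_n -> R) (A : 'M[R]_(a, b)) :
  smooth c -> smooth_mx (fun p => c p *: A).
Proof.
move=> sc i j; rewrite (_ : (fun p => _) = fun p => c p * A i j).
  by apply: smoothM => //; exact: smooth_cst.
by apply/funext => p; rewrite mxE.
Qed.

Lemma smooth_mxT a b (A : 'rV[R]_n -> 'M[R]_(a, b)) :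
  smooth_mx A -> smooth_mx (fun p => (A p)^T).
Proof.
move=> sA i j; rewrite (_ : (fun p => _) = fun p => A p j i) //.
by apply/funext => p; rewrite mxE.
Qed.

End SmoothMatrices.

(** * Averages over segments and periodic functions on the plane *)

Lemma closed_ball_compact (R : realType) n (r : R) :
  compact [set p : 'rV[R]_n | `|p| <= r].
Proof.
apply: bounded_closed_compact.
  exists r; split; first exact: num_real.
  by move=> x rx p /= pr; exact: le_trans pr (ltW rx).
by apply: (@closed_comp _ _ (@Num.norm R 'rV[R]_n) [set x | x <= r]);
  [move=> p _; exact: norm_continuous|exact: closed_le].
Qed.

Section Averages.
Variables (R : realType) (n : nat).
Local Notation V := 'rV[R]_n.
Local Notation mu := (@lebesgue_measure R).
Implicit Types (f : V -> R) (w : R -> R) (p u v : V).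

Lemma continuous_bounded_ball f (r : R) : continuous f ->
  exists2 C, 0 < C & forall p, `|p| <= r -> `|f p| <= C.
Proof.
move=> cf.
have /compact_bounded [M [_ MP]] : compact (f @` [set p : V | `|p| <= r]).
  apply: continuous_compact; last exact: closed_ball_compact.
  exact: continuous_subspaceT.
exists (`|M| + 1); first by rewrite ltr_wpDl.
move=> p pr; apply: (MP (`|M| + 1)); last by exists p.
by rewrite (le_lt_trans (ler_norm _))// ltrDl.
Qed.

(** The weighted average of f over the segment from p to p + u. *)
Definition avg w u f (p : V) : R :=
  \int[mu]_(s in `[0, 1]) (w s * f (p + s *: u)).

Lemma avg_integrand_continuous w u f p : continuous w -> continuous f ->
  continuous (fun s : R => w s * f (p + s *: u)).
Proof.
move=> cw cf s; have H := @continuous_line _ _ f p u cf s.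
exact: (continuousM (cw s) H).
Qed.

Lemma avg_integrable w u f p : continuous w -> continuous f ->
  mu.-integrable `[0, 1] (EFin \o (fun s : R => w s * f (p + s *: u))).
Proof.
move=> cw cf; apply: continuous_compact_integrable; first exact: segment_compact.
exact/continuous_subspaceT/avg_integrand_continuous.
Qed.

(** The weight is bounded by 1 for simplicity. *)
Lemma avg_continuous w u f : continuous w ->
  (forall s, 0 <= s <= 1 -> `|w s| <= 1) -> continuous f ->
  continuous (avg w u f).
Proof.
move=> cw w1 cf p.
apply/(@cvgrPdist_le _ _ _ (nbhs p) (nbhs_filter p) (avg w u f)) => e e0.
have cadd (q : V) (s : R) : (x.2 + x.1 *: u) @[x --> (s, q)] --> q + s *: u.
  by apply: cvgD; [exact: cvg_snd|apply: cvgZr_tmp; exact: cvg_fst].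
have : \forall q \near p, `[0, 1]%classic `<=`
    [set s | `|f (p + s *: u) - f (q + s *: u)| <= e].
  have /compact_near_coveringP ncov := @segment_compact R 0 1.
  apply: (ncov V (nbhs p)
    (fun q s => `|f (p + s *: u) - f (q + s *: u)| <= e) (nbhs_filter p)) => s _.
  have e20 : 0 < e / 2 by rewrite divr_gt0.
  have /cvgrPdist_lt/(_ _ e20) near1 := cf (p + s *: u).
  have Hq : \forall x \near (s, p), `|f (p + s *: u) - f (x.2 + x.1 *: u)| < e / 2.
    exact: (cadd p s _ near1).
  have Hp : \forall x \near (s, p), `|f (p + s *: u) - f (p + x.1 *: u)| < e / 2.
    have cp : (p + x.1 *: u) @[x --> (s, p)] --> p + s *: u.
      by apply: cvgD; [exact: cvg_cst|apply: cvgZr_tmp; exact: cvg_fst].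
    exact: (cp _ near1).
  near=> x.
  have H1 : `|f (p + s *: u) - f (x.2 + x.1 *: u)| < e / 2 by near: x.
  have H2 : `|f (p + s *: u) - f (p + x.1 *: u)| < e / 2 by near: x.
  rewrite /= -[X in `|X|](subrKA (f (p + s *: u))) (le_trans (ler_normD _ _))//.
  by rewrite [leRHS]splitr lerD ?ltW// distrC.
move=> near_e; near=> q.
have qe : `[0, 1]%classic `<=` [set s | `|f (p + s *: u) - f (q + s *: u)| <= e].
  by near: q.
have ip := @avg_integrable w u f p cw cf.
have iq := @avg_integrable w u f q cw cf.
rewrite /avg -RintegralB//.
have iB : mu.-integrable `[0, 1]
  (EFin \o (fun s => w s * f (p + s *: u) - w s * f (q + s *: u))).
  exact: (@integrableB _ _ _ mu _ _ _ _ ip iq).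
apply: (le_trans (le_normr_Rintegral _ iB)) => //.
have mu01 : mu `[0, 1]%classic = 1%E.
  by rewrite lebesgue_measure_itv /= lte_fin ltr01 oppr0 adde0.
have -> : e = \int[mu]_(s in `[0, 1]) (cst e s).
  by rewrite Rintegral_cst//= mu01 mulr1.
apply: le_Rintegral => //.
- rewrite (_ : EFin \o _ = (fun x => `|(EFin \o (fun s : R => (w s * f (p + s *: u) - w s * f (q + s *: u))%R)) x|)%E).
    exact: integrable_abse.
  by apply/funext.
- by apply: continuous_compact_integrable; [exact: segment_compact|
    apply/continuous_subspaceT => x; exact: cst_continuous].
- move=> s s01; rewrite -mulrBr normrM -[leRHS]mul1r ler_pM//.
    by apply: w1; move: s01; rewrite /= in_itv.
  exact: qe.
Unshelve. all: by end_near. Qed.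

Lemma is_derive_avg w u f p v : continuous w ->
  (forall s, 0 <= s <= 1 -> `|w s| <= 1) -> continuous f ->
  (forall q, derivable f q v) -> continuous (fun q => 'D_v f q) ->
  is_derive p v (avg w u f) (avg w u (fun q => 'D_v f q) p).
Proof.
move=> cw w1 cf df cDf.
(* Differentiation under the integral sign at x = 0, for x in ]-1, 1[, with the
   bound of the derivative of f on a ball that contains all the points used. *)
pose F (x s : R) := w s * f (p + s *: u + x *: v).
have dF (x s : R) : is_derive x 1 (F ^~ s) (w s * 'D_v f (p + s *: u + x *: v)).
  have H := is_derive_line (df (p + s *: u + x *: v)).
  exact: (is_deriveZ (w s)).
have [C C0 CP] := continuous_bounded_ball (`|p| + `|u| + `|v|) cDf.
have I0 : `]-1, 1[%classic (0 : R) by rewrite /= in_itv/= ltrN10 ltr01.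
have intF x : `]-1, 1[%classic x -> mu.-integrable `[0, 1] (EFin \o F x).
  move=> _; rewrite (_ : _ \o _ = EFin \o (fun s => w s * f ((p + x *: v) + s *: u))).
    exact: avg_integrable.
  by apply/funext => s; rewrite /F/= addrAC.
have derF x s : `]-1, 1[%classic x -> `[0, 1]%classic s -> derivable (F ^~ s) x 1.
  by move=> _ _; have [? _] := dF x s.
have intC : mu.-integrable `[0, 1] (EFin \o (fun=> C)).
  by apply: continuous_compact_integrable; [exact: segment_compact|
    apply/continuous_subspaceT => x; exact: cst_continuous].
have d1E x s : partial1of2 F x s = w s * 'D_v f (p + s *: u + x *: v).
  by rewrite partial1of2E; have [_ ->] := dF x s.
have d1C x s : `]-1, 1[%classic x -> `[0, 1]%classic s -> `|partial1of2 F x s| <= C.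
  rewrite /= !in_itv/= -ltr_norml d1E normrM => x1 s01.
  rewrite -[leRHS]mul1r ler_pM//; first exact: w1.
  apply: CP; rewrite (le_trans (ler_normD _ _))// lerD//.
    rewrite (le_trans (ler_normD _ _))// lerD2l normrZ ler_piMl//.
    by move: s01 => /andP[s0 s1]; rewrite ger0_norm.
  by rewrite normrZ ler_piMl// ltW.
have m01 : measurable (`[0, 1]%classic : set (measurableTypeR R)) by [].
have H1 := @derivable_under_integral R _ _ mu F _ m01 0 (-1) 1 I0 intF derF
  (fun=> C) (fun=> ltW C0) intC d1C.
have H2 := @differentiation_under_integral R _ _ mu F _ m01 0 (-1) 1 I0 intF derF
  (fun=> C) (fun=> ltW C0) intC d1C.
have FE : (fun x => \int[mu]_(s in `[0, 1]) F x s) =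
    (fun h : R => avg w u f (h *: v + p)).
  apply/funext => x; apply: eq_Rintegral => s _.
  by rewrite /F addrAC [x *: v + p]addrC.
rewrite FE in H1 H2.
apply: DeriveDef; first by apply/derivable1P.
transitivity (\int[mu]_(s in `[0, 1]) partial1of2 F 0 s); last first.
  by apply: eq_Rintegral => s _; rewrite d1E scale0r addr0.
rewrite -[RHS]H2 derive1E /derive.
rewrite (_ : (fun h : R => h^-1 *: ((avg w u f \o shift p) (h *: v) - avg w u f p)) =
  (fun h : R => h^-1 *: (((fun h0 : R => avg w u f (h0 *: v + p)) \o shift 0)
     (h *: 1) - avg w u f (0 *: v + p)))) //.
by apply/funext => h /=; rewrite addr0 scale0r add0r [_%:A]mulr1.
Qed.

Lemma partial_avg w u f (i : 'I_n) : continuous w ->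
  (forall s, 0 <= s <= 1 -> `|w s| <= 1) -> smooth f ->
  partial i (avg w u f) = avg w u (partial i f).
Proof.
move=> cw w1 sf; apply/funext => p.
have [_ H] := @is_derive_avg w u f p (delta_mx 0 i) cw w1
  (smooth_continuous sf) (fun q => smooth_derivable q i sf)
  (smooth_continuous (@smooth_partial _ _ f i sf)).
exact: H.
Qed.

Lemma smooth_avg w u f : continuous w ->
  (forall s, 0 <= s <= 1 -> `|w s| <= 1) -> smooth f -> smooth (avg w u f).
Proof.
move=> cw w1 sf k; elim: k f sf => [|k IH] f sf.
  by apply: avg_continuous => //; exact: smooth_continuous.
move=> i; rewrite partial_avg//; split; last exact/IH/smooth_partial.
move=> p; have [H _] := @is_derive_avg w u f p (delta_mx 0 i) cw w1
  (smooth_continuous sf) (fun q => smooth_derivable q i sf)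
  (smooth_continuous (@smooth_partial _ _ f i sf)).
exact: H.
Qed.

Let ccst1 : continuous (fun _ : R => 1 : R).
Proof. exact: cst_continuous. Qed.

Let cst1_le1 (s : R) : 0 <= s <= 1 -> `|1 : R| <= 1.
Proof. by rewrite normr1. Qed.

Let cid : continuous (fun s : R => s).
Proof. by move=> s; exact: cvg_id. Qed.

Let id_le1 (s : R) : 0 <= s <= 1 -> `|s| <= 1.
Proof. by move=> /andP[s0 s1]; rewrite ger0_norm. Qed.

(** The plain average of f over the segment from p to p + u. *)
Definition mean u f : V -> R := avg (fun=> 1) u f.

(** The average with linear weight; when f has period u, its derivative along u
    is f minus the plain average of f. *)
Definition primitive u f : V -> R := avg (fun s => s) u f.

Lemma smooth_mean u f : smooth f -> smooth (mean u f).
Proof. exact: smooth_avg. Qed.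

Lemma smooth_primitive u f : smooth f -> smooth (primitive u f).
Proof. exact: smooth_avg. Qed.

Lemma mean_continuous u f : continuous f -> continuous (mean u f).
Proof. exact: avg_continuous. Qed.

Lemma avg_periodic w u f v : (forall p, f (p + v) = f p) ->
  forall p, avg w u f (p + v) = avg w u f p.
Proof. by move=> fv p; apply: eq_Rintegral => s _; rewrite addrAC fv. Qed.

Lemma derive_primitive u f p : smooth f -> (forall q, f (q + u) = f q) ->
  'D_u (primitive u f) p = f p - mean u f p.
Proof.
move=> sf fu.
have cDf := smooth_continuous (smooth_derive_dir u sf).
have df q : derivable f q u by exact: smooth_derivable_dir.
(* The derivative is the integral of s G'(s) over [0, 1], where
   G(s) = f(p + s u); it is integrated by parts. *)
have [_ ->] := @is_derive_avg (fun s => s) u f p u cid id_le1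
  (smooth_continuous sf) df cDf.
pose G (s : R) := f (p + s *: u).
have dG (s : R) : is_derive s 1 G ('D_u f (p + s *: u)).
  exact: is_derive_line.
have cG : continuous G by exact/continuous_line/smooth_continuous.
have cDG := @continuous_line _ _ _ p u cDf.
have LR (h : R -> R) : (forall s : R, derivable h s 1) ->
    derivable_oo_LRcontinuous h 0 1.
  move=> dh; have ch : continuous h.
    by move=> s; apply/differentiable_continuous/derivable1_diffP.
  split=> [s _||]; first exact: dh.
    by apply: cvg_at_right_filter; exact: ch.
  by apply: cvg_at_left_filter; exact: ch.
rewrite /avg (@Rintegration_by_parts R (fun s => s) G (fun=> 1)
  (fun s => 'D_u f (p + s *: u)) 0 1 ltr01).
- rewrite mul1r mul0r subr0 /G scale1r fu; congr (_ - _).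
- exact/continuous_subspaceT/ccst1.
- by apply: LR => s; exact: derivable_id.
- by move=> s _; rewrite derive1E derive_id.
- exact/continuous_subspaceT/cDG.
- by apply: LR => s; have [? _] := dG s.
- by move=> s _; rewrite derive1E; have [_ ->] := dG s.
Qed.

(** The average over a period does not depend on the starting point. *)
Lemma mean_dir_const u f p (c : R) : smooth f -> (forall q, f (q + u) = f q) ->
  mean u f (p + c *: u) = mean u f p.
Proof.
move=> sf fu.
have cDf := smooth_continuous (smooth_derive_dir u sf).
have D0 q : is_derive q u (mean u f) 0.
  have df r : derivable f r u by exact: smooth_derivable_dir.
  have [H1 H2] := @is_derive_avg (fun=> 1) u f q u ccst1 cst1_le1
    (smooth_continuous sf) df cDf.
  apply: DeriveDef => //; rewrite [LHS]H2 /avg.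
  under eq_Rintegral do rewrite mul1r.
  pose G (s : R) := f (q + s *: u).
  have dG (s : R) : is_derive s 1 G ('D_u f (q + s *: u)) by exact: is_derive_line.
  have cG : continuous G by exact/continuous_line/smooth_continuous.
  have cDG := @continuous_line _ _ _ q u cDf.
  rewrite /Rintegral (@continuous_FTC2 R (fun s => 'D_u f (q + s *: u)) G).
  - by rewrite /G scale1r scale0r addr0 fu -EFinB /= subrr.
  - exact: ltr01.
  - exact: continuous_subspaceT.
  - split=> [s _||]; first by have [? _] := dG s.
      by apply: cvg_at_right_filter; exact: cG.
    by apply: cvg_at_left_filter; exact: cG.
  - by move=> s _; rewrite derive1E; have [_ ->] := dG s.
have H (s : R) : is_derive s 1 (fun r : R => mean u f (p + r *: u)) 0.
  have [H1 H2] := D0 (p + s *: u).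
  by rewrite -H2; exact: is_derive_line.
by rewrite (is_derive_0_is_cst c 0 H) scale0r addr0.
Qed.

End Averages.

Section PlanePeriodic.
Variable R : realType.
Local Notation B := 'rV[R]_2.
Implicit Types (f : B -> R) (u v p : B).

Lemma plane_basis u v p : row_free (col_mx u v) ->
  exists c d : R, p = c *: u + d *: v.
Proof.
move=> uv; have /row_fullP[X XE] : row_full (col_mx u v : 'M[R]_(1 + 1, 2)).
  exact: uv.
exists ((p *m X) 0 (lshift 1 0)), ((p *m X) 0 (rshift 1 0)).
rewrite -[LHS]mulmx1 -XE mulmxA -[p *m X in LHS]hsubmxK mul_row_col.
by rewrite [lsubmx _]mx11_scalar [rsubmx _]mx11_scalar !mul_scalar_mx !mxE.
Qed.

(** The average over both periods is constant. *)
Lemma mean_mean_const u v f p : row_free (col_mx u v) -> smooth f ->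
  (forall q, f (q + u) = f q) -> (forall q, f (q + v) = f q) ->
  mean v (mean u f) p = mean v (mean u f) 0.
Proof.
move=> uv sf fu fv; have [c [d ->]] := plane_basis p uv.
rewrite mean_dir_const; last 2 first.
- exact: smooth_mean.
- exact: avg_periodic.
rewrite -[c *: u]add0r; apply: eq_Rintegral => s _.
by rewrite addrAC mean_dir_const.
Qed.

Lemma int_periodic T (g : B -> T) u : (forall q, g (q + u) = g q) ->
  forall (k : int) q, g (q + k%:~R *: u) = g q.
Proof.
move=> gu; have gn (k : nat) q : g (q + k%:R *: u) = g q.
  elim: k q => [|k IH] q; first by rewrite scale0r addr0.
  by rewrite -natr1 scalerDl scale1r addrA gu.
case=> k q; first exact: gn.
by rewrite NegzE -(gn k.+1) -addrA -scalerDl mulrNz addNr scale0r addr0.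
Qed.

Lemma smooth_deriveE2 f p u : smooth f ->
  'D_u f p = u 0 0 * partial 0 f p + u 0 1 * partial 1 f p.
Proof.
move=> sf; rewrite smooth_deriveE//.
have -> : 1 = lift ord0 ord0 :> 'I_2 by exact: val_inj.
by rewrite !big_ord_recl big_ord0 addr0.
Qed.
Arguments smooth_deriveE2 {f} p u.

(** Every smooth doubly periodic 2-form on the plane is, up to a constant
    multiple of the area form, the differential of a periodic 1-form. *)
Lemma periodic_curl u v f (L : set B) : row_free (col_mx u v) ->
  L = [set w | exists a b : int, w = a%:~R *: u + b%:~R *: v] ->
  smooth f -> base_periodic L f ->
  exists beta : B -> B, [/\ smooth_mx beta, base_periodic L beta &
    forall q, partial 0 (fun r => beta r 0 1) q - partial 1 (fun r => beta r 0 0) q =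
      f q - mean v (mean u f) 0].
Proof.
move=> uv LE sf fL.
have fu q : f (q + u) = f q.
  by apply: fL; rewrite LE; exists 1, 0; rewrite scale1r scale0r addr0.
have fv q : f (q + v) = f q.
  by apply: fL; rewrite LE; exists 0, 1; rewrite scale1r scale0r add0r.
have perL T (g : B -> T) : (forall q, g (q + u) = g q) ->
    (forall q, g (q + v) = g q) -> base_periodic L g.
  move=> gu gv q w; rewrite LE => -[k [l ->]].
  by rewrite addrA (int_periodic gv) (int_periodic gu).
(* f = D_u a + D_v b + constant, by two successive averages; the components of
   a u + b v then give the 1-form. *)
set a := primitive u f; set b := primitive v (mean u f).
have smu : smooth (mean u f) by exact: smooth_mean.
have sa : smooth a by exact: smooth_primitive.
have sb : smooth b by exact: smooth_primitive.
pose h (i : 'I_2) q := u 0 i * a q + v 0 i * b q.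
have sh i : smooth (h i).
  by apply: smoothD; apply: smoothM => //; exact: smooth_cst.
have dh i j q : partial j (h i) q = u 0 i * partial j a q + v 0 i * partial j b q.
  have da := smooth_derivable q j sa.
  have db := smooth_derivable q j sb.
  have H := deriveD (derivableZ (k := u 0 i) da) (derivableZ (k := v 0 i) db).
  by rewrite [LHS]H !deriveZ.
have mp : forall q, mean u f (q + v) = mean u f q by exact: avg_periodic.
have fE q : f q = 'D_u a q + 'D_v b q + mean v (mean u f) 0.
  by rewrite !derive_primitive// -(mean_mean_const q uv sf fu fv); ring.
pose beta q : B := \row_j (if j == 0 then - h 1 q else h 0 q).
exists beta; split.
- move=> i j; rewrite (_ : (fun p => _) = fun p => if j == 0 then - h 1 p else h 0 p).
    by case: (j == 0); [exact: smoothN|exact: sh].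
  by apply/funext => p; rewrite mxE.
- move=> q w Lw; apply/rowP => j; rewrite [LHS]mxE [RHS]mxE /h.
  have -> : a (q + w) = a q by apply: perL Lw => r; exact: avg_periodic.
  have -> // : b (q + w) = b q.
  apply: perL Lw => r; last exact: avg_periodic.
  apply: avg_periodic => s; have := mean_dir_const s 1 sf fu.
  by rewrite scale1r.
- move=> q; rewrite (_ : (fun r => beta r 0 1) = h 0); last first.
    by apply/funext => r; rewrite mxE.
  rewrite (_ : (fun r => beta r 0 0) = fun r => - h 1 r); last first.
    by apply/funext => r; rewrite mxE.
  have -> : partial 1 (fun r => - h 1 r) q = - partial 1 (h 1) q.
    exact: (deriveN (smooth_derivable q 1 (sh 1))).
  rewrite !dh fE (smooth_deriveE2 q u sa) (smooth_deriveE2 q v sb).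
  move: (partial 0 a q) (partial 1 a q) (partial 0 b q) (partial 1 b q).
  move: (mean v (mean u f) 0) (u 0 0) (u 0 1) (v 0 0) (v 0 1).
  by move=> *; ring.
Qed.

End PlanePeriodic.

(** * Maps that scale the Lebesgue measure *)

(** f is measurable and the preimage of every set under f has k times the
    measure of the set. *)
Definition scales_measure d (T : measurableType d) (R : realType)
    (m : set T -> \bar R) (k : R) (f : T -> T) : Prop :=
  measurable_fun setT f /\
  forall A, measurable A -> m (f @^-1` A) = (k%:E * m A)%E.

Lemma scales_measure_comp d (T : measurableType d) (R : realType)
    (m : set T -> \bar R) (k l : R) (f g : T -> T) :
  scales_measure m k f -> scales_measure m l g ->
  scales_measure m (k * l) (f \o g).
Proof.
move=> [mf fP] [mg gP]; split; first exact: measurableT_comp.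
move=> A mA; rewrite comp_preimage gP ?fP//.
  by rewrite muleA -EFinM mulrC.
by rewrite -[X in measurable X]setTI; exact: mf.
Qed.

Section SkewProducts.
Context d1 d2 (T1 : measurableType d1) (T2 : measurableType d2) (R : realType).
Variable m1 : {sigma_finite_measure set T1 -> \bar R}.
Variable m2 : {sigma_finite_measure set T2 -> \bar R}.

(** By Tonelli, a map of a product that only changes one coordinate scales the
    product measure when it does so on every slice. *)
Lemma skew_fst (psi : T2 -> T1 -> T1) (k : R) : 0 <= k ->
  measurable_fun setT (fun w : T1 * T2 => psi w.2 w.1) ->
  (forall v, scales_measure m1 k (psi v)) ->
  scales_measure (m1 \x m2)%E k (fun w => (psi w.2 w.1, w.2)).
Proof.
move=> k0 mpsi psiP.
have mf : measurable_fun setT (fun w : T1 * T2 => (psi w.2 w.1, w.2)).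
  exact: measurable_fun_pair.
split=> // A mA.
have E (X : set (T1 * T2)) : measurable X ->
    (m1 \x m2)%E X = (\int[m2]_y m1 (ysection X y))%E.
  move=> mX; apply: (@product_measure_unique _ _ _ _ _ m1 m2 (m1 \x^ m2)%E) => //.
  by move=> *; exact: product_measure2E.
have mfA : measurable ((fun w : T1 * T2 => (psi w.2 w.1, w.2)) @^-1` A).
  by rewrite -[X in measurable X]setTI; exact: mf.
rewrite !E// -ge0_integralZl//; last first.
  exact: (measurable_fun_ysection m1 mA).
apply: eq_integral => y _; have [_ <-] := psiP y; last exact: measurable_ysection.
by congr (m1 _); apply/seteqP; split=> x; rewrite /= /ysection /= !inE.
Qed.

Lemma skew_snd (psi : T1 -> T2 -> T2) (k : R) : 0 <= k ->
  measurable_fun setT (fun w : T1 * T2 => psi w.1 w.2) ->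
  (forall v, scales_measure m2 k (psi v)) ->
  scales_measure (m1 \x m2)%E k (fun w => (w.1, psi w.1 w.2)).
Proof.
move=> k0 mpsi psiP.
have mf : measurable_fun setT (fun w : T1 * T2 => (w.1, psi w.1 w.2)).
  exact: measurable_fun_pair.
split=> // A mA.
have mfA : measurable ((fun w : T1 * T2 => (w.1, psi w.1 w.2)) @^-1` A).
  by rewrite -[X in measurable X]setTI; exact: mf.
rewrite /product_measure1 -ge0_integralZl//; last first.
  exact: (measurable_fun_xsection m2 mA).
apply: eq_integral => x _ /=; have [_ <-] := psiP x; last exact: measurable_xsection.
by congr (m2 _); apply/seteqP; split=> y; rewrite /= /xsection /= !inE.
Qed.

End SkewProducts.

Section AffineLine.
Variable R : realType.
Local Notation mu := (@lebesgue_measure R).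

Lemma affine_measurable (s c : R) :
  measurable_fun setT (fun r : measurableTypeR R => s * r + c : measurableTypeR R).
Proof.
apply: measurable_funD; last exact: measurable_cst.
exact: mulrl_measurable.
Qed.

Let preimage_pos (s c : R) : 0 < s -> forall A, measurable A ->
  mu ((fun r : measurableTypeR R => s * r + c) @^-1` A) = (s^-1%:E * mu A)%E.
Proof.
move=> s0 A mA.
pose f := (fun r : measurableTypeR R => s * r + c : measurableTypeR R).
have mf : measurable_fun setT f := affine_measurable s c.
have H X : ocitv X -> mu X = (s%:E * mu (f @^-1` X))%E.
  move=> [[a b] _ <-].
  have -> : f @^-1` `]a, b]%classic = `](a - c) / s, (b - c) / s]%classic.
    apply/seteqP; split=> r /=; rewrite /f !in_itv/= ltr_pdivrMr// ler_pdivlMr//;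
    by rewrite ltrBlDr lerBrDr [r * s]mulrC.
  rewrite !lebesgue_measure_itv/= !lte_fin ltr_pM2r ?invr_gt0// ltrD2r.
  case: ifP => _; last by rewrite mule0.
  rewrite -!EFinB -EFinM -mulrBl mulrCA divff ?gt_eqF// mulr1.
  by congr (_%:E); ring.
pose nu := (mscale (NngNum (ltW s0)) (pushforward mu f)
  : {measure set (measurableTypeR R) -> \bar R}).
have -> : mu A = nu mf A by apply: lebesgue_measure_unique => //; exact: H.
by rewrite /mscale/= /pushforward muleA -EFinM mulVf ?gt_eqF// mul1e.
Qed.

Lemma scales_affine (s c : R) : s != 0 ->
  scales_measure mu `|s|^-1 (fun r : measurableTypeR R => s * r + c).
Proof.
move=> s0; split; first exact: affine_measurable.
move=> A mA; have [sp|sn] := ltP 0 s; first by rewrite ger0_norm ?ltW// preimage_pos.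
have sn0 : 0 < - s by rewrite oppr_gt0 lt_neqAle s0.
rewrite ler0_norm// -(preimage_pos c)//.
set B := (X in _ = mu X).
have mB : measurable B.
  by rewrite -[X in measurable X]setTI; apply: (affine_measurable (- s) c).
rewrite -[RHS](lebesgue_measureN mB) /pushforward; congr (mu _).
by rewrite /B; apply/seteqP; split=> r /=; rewrite mulrNN.
Qed.

End AffineLine.

(** * Integrals over fundamental domains *)

Section OrbitIntegrals.
Context d (T : measurableType d) (R : realType) (mu : {measure set T -> \bar R}).
Local Open Scope ereal_scope.

Lemma integral_scales1 (f : T -> T) (X : set T) (phi : T -> \bar R) :
  scales_measure mu 1 f -> measurable X -> measurable_fun setT phi ->
  (forall p, 0 <= phi p) ->
  \int[mu]_(p in f @^-1` X) phi (f p) = \int[mu]_(p in X) phi p.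
Proof.
move=> [mf fP] mX mphi phi0.
rewrite -(ge0_integral_pushforward mf mu mX) //; last exact: measurable_funTS.
apply: eq_measure_integral => A mA _.
by rewrite -[RHS]mul1e -fP.
Qed.

Variable G : set (T -> T).
Hypothesis Gcountable : countable G.
Hypothesis Ginv : forall f, G f -> exists2 g, G g & cancel f g /\ cancel g f.
Hypothesis Gmeas : forall f, G f -> scales_measure mu 1 f.

(** A measurable set meeting every orbit exactly once; for every point there is
    exactly one group element that moves it into the set. *)
Definition orbit_representatives (D : set T) : Prop :=
  [/\ measurable D, forall p, exists2 f, G f & D (f p) &
      forall p f g, G f -> G g -> D (f p) -> D (g p) -> f = g].

Let measurable_G f A : G f -> measurable A -> measurable (f @^-1` A).
Proof. by move=> /Gmeas[mf _] mA; rewrite -[X in measurable X]setTI; exact: mf. Qed.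

(* An injective numbering of the group. *)
Let code := projT1 (cid (countable_injP _ Gcountable)).

Let code_inj f g : G f -> G g -> code f = code g -> f = g.
Proof.
move=> Gf Gg fg; apply: (projT2 (cid (countable_injP _ Gcountable))) fg;
by rewrite inE.
Qed.

(* The translate of A by the element with number n, empty if there is none. *)
Let translate (A : set T) (n : nat) : set T :=
  [set p | exists f q, [/\ G f, code f = n, A q & p = f q]].

Let translateE A f g : G f -> G g -> cancel f g -> cancel g f ->
  translate A (code f) = g @^-1` A.
Proof.
move=> Gf Gg fK gK; apply/seteqP; split=> p /=.
  by move=> [f' [q [Gf' ff' Aq ->]]]; rewrite (code_inj Gf' Gf ff') fK.
by move=> Ap; exists f, (g p); rewrite gK.
Qed.

Let translate0 A n : ~ (exists2 f, G f & code f = n) -> translate A n = set0.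
Proof.
move=> nf; apply/seteqP; split=> p //= -[f [q [Gf fn _ _]]].
by apply: nf; exists f.
Qed.

Let measurable_translate A n : measurable A -> measurable (translate A n).
Proof.
move=> mA; have [[f Gf <-]|/translate0->//] := pselect (exists2 f, G f & code f = n).
have [g Gg [fK gK]] := Ginv Gf.
by rewrite (translateE A Gf Gg fK gK); exact: measurable_G.
Qed.

(** A is cut into the pieces moved into D by the different group elements. *)
Lemma integral_translates D A (phi : T -> \bar R) :
  orbit_representatives D -> measurable A -> measurable_fun setT phi ->
  (forall p, 0 <= phi p) -> (forall f p, G f -> phi (f p) = phi p) ->
  \int[mu]_(p in A) phi p = \sum_(n <oo) \int[mu]_(p in D `&` translate A n) phi p.
Proof.
move=> [mD Dex Duniq] mA mphi phi0 phiG.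
pose H n := [set p | A p /\ exists f, [/\ G f, code f = n & D (f p)]].
have H0 n : ~ (exists2 f, G f & code f = n) -> H n = set0.
  move=> nf; apply/seteqP; split=> p //= -[_ [f [Gf fn _]]].
  by apply: nf; exists f.
have HE f : G f -> H (code f) = f @^-1` (D `&` translate A (code f)).
  move=> Gf; have [g Gg [fK gK]] := Ginv Gf.
  rewrite (translateE A Gf Gg fK gK); apply/seteqP; split=> p /=.
    by move=> [Ap [f' [Gf' /(code_inj Gf' Gf)-> Dfp]]]; rewrite fK.
  by rewrite fK => -[Dfp Ap]; split=> //; exists f.
have mDA n : measurable (D `&` translate A n).
  by apply: measurableI => //; exact: measurable_translate.
have mH n : measurable (H n).
  have [[f Gf <-]|/H0->//] := pselect (exists2 f, G f & code f = n).
  by rewrite HE//; exact: measurable_G.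
have HA : \bigcup_n H n = A.
  apply/seteqP; split=> [p [n _ []]//|p Ap].
  by have [f Gf Dfp] := Dex p; exists (code f) => //; split => //; exists f.
have tH : trivIset setT H.
  apply/trivIsetP => i j _ _ ij; apply/seteqP; split=> p //=.
  move=> [[_ [f [Gf fi Df]]] [_ [g [Gg gj Dg]]]]; move: ij.
  by rewrite -fi -gj (Duniq p f g Gf Gg Df Dg) eqxx.
rewrite -{1}HA ge0_integral_bigcup//; last exact: measurable_funTS.
apply: eq_eseriesr => n _.
have [[f Gf <-]|nf] := pselect (exists2 f, G f & code f = n); last first.
  by rewrite H0// translate0// setI0.
rewrite HE// -[RHS](integral_scales1 (Gmeas Gf))//.
by apply: eq_integral => p _; rewrite phiG.
Qed.

(** The integral of an invariant function over a fundamental domain does not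
    depend on the domain. *)
Lemma integral_representatives D A (phi : T -> \bar R) :
  orbit_representatives D -> orbit_representatives A ->
  measurable_fun setT phi ->
  (forall p, 0 <= phi p) -> (forall f p, G f -> phi (f p) = phi p) ->
  \int[mu]_(p in A) phi p = \int[mu]_(p in D) phi p.
Proof.
move=> rD [mA Aex Auniq] mphi phi0 phiG; have [mD _ _] := rD.
rewrite (integral_translates rD)//.
have DA : D = \bigcup_n (D `&` translate A n).
  apply/seteqP; split=> [p Dp|p [n _ []]//].
  have [g Gg Ag] := Aex p; have [f Gf [gK fK]] := Ginv Gg.
  by exists (code f) => //; split=> //; exists f, (g p); rewrite gK.
rewrite [in RHS]DA ge0_integral_bigcup//.
- by move=> n; apply: measurableI => //; exact: measurable_translate.
- exact: measurable_funTS.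
apply/trivIsetP => i j _ _ ij; apply/seteqP; split=> p //=.
move=> [[_ [f [q [Gf fi Aq pf]]]] [_ [g [r [Gg gj Ar pg]]]]]; move: ij.
have [f' Gf' [fK f'K]] := Ginv Gf; have [g' Gg' [gK g'K]] := Ginv Gg.
have Af : A (f' p) by rewrite pf fK.
have Ag : A (g' p) by rewrite pg gK.
have fg' := Auniq p f' g' Gf' Gg' Af Ag.
suff -> : i = j by rewrite eqxx.
rewrite -fi -gj; congr code; apply/funext => x.
by rewrite -[LHS]g'K -fg' fK.
Qed.

(** A fundamental domain is not larger than a set whose translates cover. *)
Lemma measure_representatives_le D K : orbit_representatives D ->
  measurable K -> (forall p, exists f q, [/\ G f, K q & p = f q]) ->
  mu D <= mu K.
Proof.
move=> rD mK Kcov; have [mD _ _] := rD.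
have mDK n : measurable (D `&` translate K n).
  by apply: measurableI => //; exact: measurable_translate.
have E X : measurable X -> mu X = \int[mu]_(p in X) 1%:E.
  by move=> mX; rewrite integral_cst// mul1e.
rewrite (E K)// (integral_translates rD)//.
under eq_eseriesr do rewrite -E//.
apply: (@measure_sigma_subadditive _ _ _ mu) => // p Dp.
have [f [q [Gf Kq pf]]] := Kcov p.
by exists (code f) => //; split=> //; exists f, q.
Qed.

Lemma measure_representatives_neq0 D : orbit_representatives D ->
  mu setT != 0 -> mu D != 0.
Proof.
move=> rD; apply: contra => /eqP D0; have [mD _ _] := rD; apply/eqP.
have mDT n : measurable (D `&` translate setT n).
  by apply: measurableI => //; exact: measurable_translate.
transitivity (\int[mu]_(p in setT) 1%:E); first by rewrite integral_cst// mul1e.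
rewrite (integral_translates rD)//; apply: eseries0 => n _ _.
rewrite integral_cst// mul1e; apply/eqP; rewrite -measure_le0 -D0.
by apply: le_measure; rewrite ?inE//; exact: subIsetl.
Qed.

End OrbitIntegrals.

(** * Lebesgue measure in four coordinates *)

Section ContinuousPlane.
Variable R : realType.

(** An open set is the union of the boxes with rational vertices in it. *)
Lemma open_plane_measurable (U : set (R * R)) : open U ->
  measurable (U : set (measurableTypeR R * measurableTypeR R)).
Proof.
move=> oU.
pose box (q : rat * rat * (rat * rat)) : set (measurableTypeR R * measurableTypeR R) :=
  `]ratr q.1.1, ratr q.1.2[%classic `*` `]ratr q.2.1, ratr q.2.2[%classic.
have -> : U = \bigcup_q (if `[< box q `<=` U >] then box q else set0).
  apply/seteqP; split=> [[x y] Uxy|p [q _]]; last first.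
    by case: asboolP => // bU bp; exact: bU.
  have /nbhs_ballP[e /= e0 eU] : nbhs (x, y) U by exact: open_nbhs_nbhs.
  have rb (z : R) : exists q1 q2 : rat, [/\ z - e < ratr q1, ratr q1 < z,
      z < ratr q2 & ratr q2 < z + e].
    have [q1] : exists q : rat, ratr q \in `]z - e, z[.
      by apply: rat_in_itvoo; rewrite ltrBlDr ltrDl.
    rewrite in_itv/= => /andP[? ?].
    have [q2] : exists q : rat, ratr q \in `]z, z + e[.
      by apply: rat_in_itvoo; rewrite ltrDl.
    by rewrite in_itv/= => /andP[? ?]; exists q1, q2.
  have [a1 [a2 [? ? ? ?]]] := rb x; have [b1 [b2 [? ? ? ?]]] := rb y.
  exists ((a1, a2), (b1, b2)) => //; case: asboolP => [_|].
    by split; rewrite /= in_itv/=; apply/andP.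
  case; move=> [x' y']; rewrite /box/= => -[]; rewrite /= !in_itv/=.
  move=> /andP[? ?] /andP[? ?]; apply: eU; split; rewrite /ball/= ltr_norml;
    apply/andP; split; lra.
apply: countable_bigcupT_measurable => [|q]; first exact: countableP.
case: asboolP => // _; apply: measurableX; exact: measurable_itv.
Qed.

Lemma continuous_plane_measurable (f : R * R -> R) : continuous f ->
  measurable_fun setT (f : measurableTypeR R * measurableTypeR R -> R).
Proof.
move=> cf; apply: (measurability _ (RGenOpens.measurableE R)).
move=> _ [_ [a [b ->] <-]]; rewrite setTI; apply: open_plane_measurable.
by move/continuousP : cf; apply; exact: interval_open.
Qed.

End ContinuousPlane.

Lemma sigma_finite_product d1 d2 (T1 : measurableType d1)
    (T2 : measurableType d2) (R : realType)
    (m1 : {sigma_finite_measure set T1 -> \bar R})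
    (m2 : {sigma_finite_measure set T2 -> \bar R}) :
  sigma_finite setT (m1 \x m2)%E.
Proof.
have /sigma_finiteP[F [FT ndF Foo]] := sigma_finiteT m1.
have /sigma_finiteP[G [GT ndG Goo]] := sigma_finiteT m2.
exists (fun n => F n `*` G n).
  apply/seteqP; split=> // -[x y] _.
  have [n _ Fx] : (\bigcup_n F n) x by rewrite -FT.
  have [m _ Gy] : (\bigcup_n G n) y by rewrite -GT.
  exists (maxn n m) => //; split => /=.
    by move: x Fx; apply/subsetPset/ndF/leq_maxl.
  by move: y Gy; apply/subsetPset/ndG/leq_maxr.
move=> n; have [mF Fn] := Foo n; have [mG Gn] := Goo n.
split; first exact: measurableX.
by rewrite product_measure1E// lte_mul_pinfty// ge0_fin_numE.
Qed.

(** The Lebesgue measures of the plane and of R^4 with the structure of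
    sigma-finite measures. *)
Definition plane_measure (R : realType) :
    {sigma_finite_measure set (measurableTypeR R * measurableTypeR R)%type -> \bar R} :=
  HB.pack (@lebesgue_measure R \x @lebesgue_measure R)%E
    (@Measure_isSigmaFinite.Build _ _ _ (@lebesgue_measure R \x @lebesgue_measure R)%E
      (sigma_finite_product _ _)).

Definition space_measure (R : realType) :
    {sigma_finite_measure set ((measurableTypeR R * measurableTypeR R) *
       (measurableTypeR R * measurableTypeR R))%type -> \bar R} :=
  HB.pack (plane_measure R \x plane_measure R)%E
    (@Measure_isSigmaFinite.Build _ _ _ (plane_measure R \x plane_measure R)%E
      (sigma_finite_product _ _)).

Lemma leb4E (R : realType) : @leb4 R = space_measure R.
Proof. by []. Qed.

Section TriangularMaps.
Variable R : realType.
Local Notation M1 := (measurableTypeR R).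
Local Notation M2 := (measurableTypeR R * measurableTypeR R)%type.
Implicit Types s c : R.

(** Triangular maps whose diagonal part is linear scale the Lebesgue measure. *)
Lemma plane_triangular s1 s2 (phi : M1 -> R) c2 : s1 != 0 -> s2 != 0 ->
  measurable_fun setT phi ->
  scales_measure (plane_measure R) (`|s1|^-1 * `|s2|^-1)
    (fun w : M2 => (s1 * w.1 + phi w.2, s2 * w.2 + c2)).
Proof.
move=> s10 s20 mphi; rewrite mulrC.
have H1 : scales_measure (plane_measure R) `|s1|^-1 (fun w : M2 => (s1 * w.1 + phi w.2, w.2)).
  apply: (@skew_fst _ _ _ _ _ _ _ (fun y x : M1 => s1 * x + phi y : M1)).
  - by rewrite invr_ge0.
  - apply: measurable_funD; last exact: measurableT_comp.
    by apply: measurable_funM => //; exact: measurable_cst.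
  - by move=> v; exact: scales_affine.
have H2 : scales_measure (plane_measure R) `|s2|^-1 (fun w : M2 => (w.1, s2 * w.2 + c2)).
  apply: (@skew_snd _ _ _ _ _ _ _ (fun _ y : M1 => s2 * y + c2 : M1)).
  - by rewrite invr_ge0.
  - apply: measurable_funD; last exact: measurable_cst.
    by apply: measurable_funM => //; exact: measurable_cst.
  - by move=> v; exact: scales_affine.
exact: (scales_measure_comp H2 H1).
Qed.

Lemma triangular_zt s1 s2 s3 s4 c1 c2 (phi : M2 -> R) c4 :
  s1 != 0 -> s2 != 0 -> s3 != 0 -> s4 != 0 -> measurable_fun setT phi ->
  scales_measure (space_measure R) (`|s1|^-1 * `|s2|^-1 * (`|s3|^-1 * `|s4|^-1))
    (fun w : M2 * M2 => ((s1 * w.1.1 + c1, s2 * w.1.2 + c2),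
                         (s3 * w.2.1 + phi w.1, s4 * w.2.2 + c4))).
Proof.
move=> s10 s20 s30 s40 mphi.
have H1 : scales_measure (space_measure R) (`|s3|^-1 * `|s4|^-1)
    (fun w : M2 * M2 => (w.1, (s3 * w.2.1 + phi w.1, s4 * w.2.2 + c4))).
  apply: (@skew_snd _ _ _ _ _ (plane_measure R) (plane_measure R)
    (fun (u v : M2) => (s3 * v.1 + phi u, s4 * v.2 + c4) : M2)).
  - by rewrite mulr_ge0 ?invr_ge0.
  - apply: measurable_fun_pair; apply: measurable_funD => /=.
    + apply: measurable_funM; first exact: measurable_cst.
      exact: (measurableT_comp measurable_fst measurable_snd).
    + exact: (measurableT_comp mphi measurable_fst).
    + apply: measurable_funM; first exact: measurable_cst.
      exact: (measurableT_comp measurable_snd measurable_snd).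
    + exact: measurable_cst.
  - by move=> v; apply: (plane_triangular (phi := fun=> phi v)).
have H2 : scales_measure (space_measure R) (`|s1|^-1 * `|s2|^-1)
    (fun w : M2 * M2 => ((s1 * w.1.1 + c1, s2 * w.1.2 + c2), w.2)).
  apply: (@skew_fst _ _ _ _ _ (plane_measure R) (plane_measure R)
    (fun (v u : M2) => (s1 * u.1 + c1, s2 * u.2 + c2) : M2)).
  - by rewrite mulr_ge0 ?invr_ge0.
  - apply: measurable_fun_pair; apply: measurable_funD => /=;
      try exact: measurable_cst.
    + apply: measurable_funM; first exact: measurable_cst.
      exact: (measurableT_comp measurable_fst measurable_fst).
    + apply: measurable_funM; first exact: measurable_cst.
      exact: (measurableT_comp measurable_snd measurable_fst).
  - by move=> v; apply: (plane_triangular (phi := fun=> c1)).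
exact: (scales_measure_comp H2 H1).
Qed.

Lemma triangular_xy s1 s2 s3 s4 (phi : M1 * M2 -> R) (chi : M2 -> R) c3 c4 :
  s1 != 0 -> s2 != 0 -> s3 != 0 -> s4 != 0 ->
  measurable_fun setT phi -> measurable_fun setT chi ->
  scales_measure (space_measure R) (`|s3|^-1 * `|s4|^-1 * (`|s1|^-1 * `|s2|^-1))
    (fun w : M2 * M2 => ((s1 * w.1.1 + phi (w.1.2, w.2), s2 * w.1.2 + chi w.2),
                         (s3 * w.2.1 + c3, s4 * w.2.2 + c4))).
Proof.
move=> s10 s20 s30 s40 mphi mchi.
have H1 : scales_measure (space_measure R) (`|s1|^-1 * `|s2|^-1)
    (fun w : M2 * M2 => ((s1 * w.1.1 + phi (w.1.2, w.2), s2 * w.1.2 + chi w.2), w.2)).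
  apply: (@skew_fst _ _ _ _ _ (plane_measure R) (plane_measure R)
    (fun (v u : M2) => (s1 * u.1 + phi (u.2, v), s2 * u.2 + chi v) : M2)).
  - by rewrite mulr_ge0 ?invr_ge0.
  - apply: measurable_fun_pair; apply: measurable_funD => /=.
    + apply: measurable_funM; first exact: measurable_cst.
      exact: (measurableT_comp measurable_fst measurable_fst).
    + apply: (measurableT_comp mphi); apply: measurable_fun_pair => //.
      exact: (measurableT_comp measurable_snd measurable_fst).
    + apply: measurable_funM; first exact: measurable_cst.
      exact: (measurableT_comp measurable_snd measurable_fst).
    + exact: (measurableT_comp mchi measurable_snd).
  - move=> v; apply: (plane_triangular (phi := fun y => phi (y, v))) => //.
    exact: (measurableT_comp mphi (measurable_pair2 v)).
have H2 : scales_measure (space_measure R) (`|s3|^-1 * `|s4|^-1)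
    (fun w : M2 * M2 => (w.1, (s3 * w.2.1 + c3, s4 * w.2.2 + c4))).
  apply: (@skew_snd _ _ _ _ _ (plane_measure R) (plane_measure R)
    (fun (v u : M2) => (s3 * u.1 + c3, s4 * u.2 + c4) : M2)).
  - by rewrite mulr_ge0 ?invr_ge0.
  - apply: measurable_fun_pair; apply: measurable_funD => /=;
      try exact: measurable_cst.
    + apply: measurable_funM; first exact: measurable_cst.
      exact: (measurableT_comp measurable_fst measurable_snd).
    + apply: measurable_funM; first exact: measurable_cst.
      exact: (measurableT_comp measurable_snd measurable_snd).
  - by move=> v; apply: (plane_triangular (phi := fun=> c3)).
exact: (scales_measure_comp H2 H1).
Qed.

End TriangularMaps.

Section Coordinates.
Variable R : realType.
Local Notation E := 'rV[R]_4.
Local Notation W := ((measurableTypeR R * measurableTypeR R) *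
                     (measurableTypeR R * measurableTypeR R))%type.

(** The point p of R^4 as an element of the product of two planes. *)
Definition to_pairs (p : E) : W := ((cx p, cy p), (cz p, ct p)).

Lemma ptE (p : E) : pt (cx p) (cy p) (cz p) (ct p) = p.
Proof.
apply/rowP => i; rewrite mxE.
by case: i => [[|[|[|[|//]]]] Hi] /=; rewrite /cx /cy /cz /ct; congr (p 0 _);
  apply: val_inj; rewrite /= inordK.
Qed.

Lemma to_pairsK : cancel to_pairs (@of_pairs R).
Proof. by move=> p; rewrite /of_pairs /= ptE. Qed.

Lemma of_pairsK : cancel (@of_pairs R) to_pairs.
Proof.
by move=> [[x y] [z t]]; rewrite /to_pairs /of_pairs cxE cyE czE ctE.
Qed.

Lemma measurable_of_pairs (i : 'I_4) :
  measurable_fun setT (fun w : W => @of_pairs R w 0 i : measurableTypeR R).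
Proof.
rewrite (_ : (fun w => _) = fun w : W => [:: w.1.1; w.1.2; w.2.1; w.2.2]`_i); last first.
  by apply/funext => w; rewrite mxE.
case: i => [[|[|[|[|//]]]] Hi] /=.
- exact: (measurableT_comp measurable_fst measurable_fst).
- exact: (measurableT_comp measurable_snd measurable_fst).
- exact: (measurableT_comp measurable_fst measurable_snd).
- exact: (measurableT_comp measurable_snd measurable_snd).
Qed.

(** Preservation of the Lebesgue measure, in the coordinates in which R^4 is a
    product of lines. *)
Definition volume_preserving (f : E -> E) : Prop :=
  scales_measure (space_measure R) 1 (fun w : W => to_pairs (f (of_pairs w))).

End Coordinates.

(** * Averages over the base as integrals over the total space *)

Lemma properly_discontinuous_countable (R : realType)
    (Gamma : set ('rV[R]_4 -> 'rV[R]_4)) :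
  acts_properly_discontinuously Gamma -> countable Gamma.
Proof.
move=> pd; pose K n := [set p : 'rV[R]_4 | `|p| <= n%:R].
apply: (@sub_countable _ _ _
  (\bigcup_n [set f | Gamma f /\ (f @` K n) `&` K n !=set0])).
  apply: subset_card_le => f Gf; exists (Num.truncn `|f 0|).+1 => //; split=> //.
  exists (f 0); split; last first.
    by rewrite /K/= ltW// truncnS_gt.
  by exists 0 => //; rewrite /K/= normr0.
apply: bigcup_countable => // n _; apply: finite_set_countable.
exact/pd/closed_ball_compact.
Qed.

Lemma pt2_delta (R : realType) (a b : R) :
  pt2 a b = a *: delta_mx 0 0 + b *: delta_mx 0 1.
Proof.
apply/rowP => k; rewrite !mxE.
by case: k => [[|[|//]]] Hk /=; rewrite ?mulr1 ?mulr0 ?addr0 ?add0r.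
Qed.

Lemma space_measure_box (R : realType) (A1 A2 A3 A4 : set (measurableTypeR R)) :
  measurable A1 -> measurable A2 -> measurable A3 -> measurable A4 ->
  let mu := @lebesgue_measure R in
  space_measure R ((A1 `*` A2) `*` (A3 `*` A4)) =
    (mu A1 * mu A2 * (mu A3 * mu A4))%E.
Proof.
move=> m1 m2 m3 m4 mu.
rewrite -[LHS]/((plane_measure R \x plane_measure R)%E _).
rewrite product_measure1E; [|exact: measurableX|exact: measurableX].
by congr (_ * _)%E; exact: (@product_measure1E _ _ _ _ _ mu mu).
Qed.

Section OrbitMean.
Variables (R : realType) (Gamma : set ('rV[R]_4 -> 'rV[R]_4)).
Variables (pr : 'rV[R]_4 -> 'rV[R]_2) (i j : 'I_4).
(* T v is a measure-preserving lift of the translation by v of the base that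
   commutes with Gamma. *)
Variable (T : 'rV[R]_2 -> 'rV[R]_4 -> 'rV[R]_4).
Local Notation E := 'rV[R]_4.
Local Notation B := 'rV[R]_2.
Local Notation mu := (space_measure R).
Local Notation W := ((measurableTypeR R * measurableTypeR R) *
                     (measurableTypeR R * measurableTypeR R))%type.
Implicit Types (phi : B -> R) (u v : B) (D : set E).

Hypothesis prE : forall p, pr p = pt2 (p 0 i) (p 0 j).
Hypothesis Ggroup : transformation_group Gamma.
Hypothesis Gfree : acts_freely Gamma.
Hypothesis Gpd : acts_properly_discontinuously Gamma.
Hypothesis Gcc : acts_cocompactly Gamma.
Hypothesis Gvol : forall f, Gamma f -> volume_preserving f.
Hypothesis Gpr : forall f, Gamma f -> exists v, forall p, pr (f p) = pr p + v.
Hypothesis TG : forall v f p, Gamma f -> T v (f p) = f (T v p).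
Hypothesis Tpr : forall v p, pr (T v p) = pr p + v.
Hypothesis Tvol : forall v, volume_preserving (T v).

(* Gamma acting on the product of two planes. *)
Let conj (f : E -> E) (w : W) : W := to_pairs (f (of_pairs w)).

Let G : set (W -> W) := [set conj f | f in Gamma].

Let Gcountable : countable G.
Proof. exact/card_le_trans/(properly_discontinuous_countable Gpd)/card_image_le. Qed.

Let Ginv g : G g -> exists2 h, G h & cancel g h /\ cancel h g.
Proof.
move=> [f Gf <-]; have [_ _ /(_ _ Gf)[f' Gf' [fK f'K]]] := Ggroup.
exists (conj f'); first by exists f'.
by split=> w; rewrite /conj to_pairsK ?fK ?f'K of_pairsK.
Qed.

Let Gmeas g : G g -> scales_measure mu 1 g.
Proof. by move=> [f Gf <-]; exact: Gvol. Qed.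

Let fundamental_representatives D : fundamental_domain Gamma D ->
  orbit_representatives G (@of_pairs R @^-1` D).
Proof.
move=> [mD Dex]; split=> // [w|w _ _ [f Gf <-] [g Gg <-] /=].
  have [q [[Dq [f Gf fq]] _]] := Dex (of_pairs w).
  by exists (conj f); [exists f|rewrite /conj /= to_pairsK fq].
rewrite /conj !to_pairsK => Df Dg; congr conj.
have [q [_ qU]] := Dex (of_pairs w).
have fgw : f (of_pairs w) = g (of_pairs w).
  rewrite -(qU (f (of_pairs w))); first apply: qU.
    by split=> //; exists g.
  by split=> //; exists f.
have [_ Gcomp /(_ _ Gg)[g' Gg' [gK g'K]]] := Ggroup.
have id1 : g' \o f = id.
  by apply: (Gfree (p := of_pairs w)); [exact: Gcomp|rewrite /= fgw gK].
apply/funext => p; rewrite -[LHS]g'K.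
by have /= -> := congr1 (fun h => h p) id1.
Qed.

Let continuous_pt2 phi : continuous phi ->
  continuous (fun a : R * R => phi (pt2 a.1 a.2)).
Proof.
move=> cphi a; apply: (@continuous_comp _ _ _ (fun a : R * R => pt2 a.1 a.2) phi).
  rewrite (_ : (fun a : R * R => _) = fun a : R * R =>
    a.1 *: (delta_mx 0 0 : B) + a.2 *: (delta_mx 0 1 : B)).
    have c1 : (fun a : R * R => a.1) @ a --> a.1 by exact: cvg_fst.
    have c2 : (fun a : R * R => a.2) @ a --> a.2 by exact: cvg_snd.
    exact: (cvgD (cvgZr_tmp c1) (cvgZr_tmp c2)).
  by apply/funext => b; exact: pt2_delta.
exact: cphi.
Qed.

Lemma measurable_base_function phi : continuous phi ->
  measurable_fun setT (fun w : W => phi (pr (of_pairs w))).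
Proof.
move=> cphi.
have cpt := continuous_pt2 cphi.
under eq_fun do rewrite prE.
apply: (measurableT_comp (continuous_plane_measurable cpt)
  (g := fun w : W => (of_pairs w 0 i, of_pairs w 0 j))).
by apply: measurable_fun_pair; exact: measurable_of_pairs.
Qed.

Variable D : set E.
Hypothesis fD : fundamental_domain Gamma D.

Local Notation D' := (@of_pairs R @^-1` D : set W).
Local Notation I phi := (\int[mu]_(w in D') (phi (pr (of_pairs w)))%:E)%E.

Let mD : measurable D'. Proof. by case: fD. Qed.

Let repD : orbit_representatives G D'.
Proof. exact: fundamental_representatives. Qed.

Let pr_G phi : base_periodic (base_lattice Gamma pr) phi ->
  forall f p, Gamma f -> phi (pr (f p)) = phi (pr p).
Proof.
move=> phiL f p Gf; have [v fv] := Gpr Gf.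
by rewrite fv phiL//; exists f.
Qed.

(** The preimage of a fundamental domain under T v is a fundamental domain. *)
Lemma integral_base_translate phi v : continuous phi -> (forall b, 0 <= phi b) ->
  base_periodic (base_lattice Gamma pr) phi ->
  I (fun b => phi (b + v)) = I phi.
Proof.
move=> cphi phi0 phiL.
pose Tv (w : W) : W := to_pairs (T v (of_pairs w)).
have Tvm : scales_measure mu 1 Tv := Tvol v.
have repT : orbit_representatives G (Tv @^-1` D').
  have [mD' Dex Du] := repD; split.
  - by have [mT _] := Tvm; rewrite -[X in measurable X]setTI; exact: mT.
  - move=> w; have [_ [f Gf <-] Df] := Dex (Tv w); exists (conj f); first by exists f.
    by move: Df; rewrite /Tv /conj /= !to_pairsK TG.
  - move=> w _ _ [f Gf <-] [g Gg <-]; rewrite /Tv /conj /= !to_pairsK !TG// => Df Dg.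
    apply: (Du (Tv w)); [by exists f|by exists g| |];
    by rewrite /Tv /conj /= !to_pairsK.
have cphiv : continuous (fun b : B => phi (b + v)).
  move=> b; apply: (@continuous_comp _ _ _ (fun b : B => b + v) phi); last exact: cphi.
  exact: (cvgD (cvg_id (F := nbhs b)) (cvg_cst v)).
rewrite -(@integral_scales1 _ _ _ mu Tv D' (fun w => (phi (pr (of_pairs w)))%:E))//.
- under [RHS]eq_integral do rewrite /Tv to_pairsK Tpr.
  apply: esym; apply: (@integral_representatives _ _ _ mu G Gcountable Ginv Gmeas D' _
    (fun w => (phi (pr (of_pairs w) + v))%:E)) => //.
  + by apply/measurable_EFinP; exact: (measurable_base_function cphiv).
  + by move=> w; rewrite lee_fin.
  + move=> _ w [f Gf <-]; rewrite /conj to_pairsK.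
    have phivL : base_periodic (base_lattice Gamma pr) (fun b => phi (b + v)).
      by move=> b u Lu /=; rewrite addrAC; exact: phiL.
    by have /= -> := pr_G phivL (of_pairs w) Gf.
- by apply/measurable_EFinP; exact: (measurable_base_function cphi).
- by move=> w; rewrite lee_fin.
Qed.

(* A compact set whose translates cover R^4 lies in a box. *)
Let measure_finite : (mu D' < +oo)%E.
Proof.
have [K cK Kcov] := Gcc.
have [M [_ MK]] := compact_bounded cK.
pose N := `|M| + 1.
pose Q : set W := (`[- N, N] `*` `[- N, N]) `*` (`[- N, N] `*` `[- N, N]).
have mQ : measurable Q by repeat apply: measurableX => //; exact: measurable_itv.
have coordK p k : K p -> - N <= p 0 k <= N.
  move=> Kp; rewrite -ler_norml (le_trans _ (MK N _ p Kp))//.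
    by rewrite [leRHS]/Num.norm /= mx_normrE; apply/bigmax_geP; right => /=; exists (0, k).
  by rewrite (le_lt_trans (ler_norm _))// ltrDl.
have le1 := @measure_representatives_le _ _ _ mu G Gcountable Ginv Gmeas D' Q repD mQ.
have mI : measurable (`[- N, N]%classic : set (measurableTypeR R)).
  exact: measurable_itv.
have Qfin : (mu Q < +oo)%E.
  have := space_measure_box mI mI mI mI; rewrite -/Q /= => ->.
  rewrite lebesgue_measure_itv/=.
  by case: ifPn => _; rewrite -?EFinB -?EFinM ?mul0e ltry.
apply: le_lt_trans Qfin; apply: le1.
  move=> w; have [f [k [Gf Kk wk]]] := Kcov (of_pairs w).
  exists (conj f), (to_pairs k); split; first by exists f.
    by split; split; rewrite /= in_itv/=; exact: coordK.
  by rewrite /conj to_pairsK -wk of_pairsK.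
Qed.

Let measure_neq0 : mu D' != 0%E.
Proof.
apply: (@measure_representatives_neq0 _ _ _ mu G Gcountable Ginv Gmeas D' repD).
pose Q : set W := (`[0, 1] `*` `[0, 1]) `*` (`[0, 1] `*` `[0, 1]).
have mQ : measurable Q by repeat apply: measurableX => //; exact: measurable_itv.
have Q1 : mu Q = 1%E.
  have mI : measurable (`[0, 1]%classic : set (measurableTypeR R)).
    exact: measurable_itv.
  have -> := space_measure_box mI mI mI mI.
  by rewrite lebesgue_measure_itv/= lte_fin ltr01 oppr0 adde0 !mule1.
have : (mu Q <= mu setT)%E by apply: le_measure; rewrite ?inE.
by rewrite Q1; apply: contraTneq => ->; rewrite -ltNge lte_fin.
Qed.

Let meanE phi u b : continuous phi ->
  ((mean u phi b)%:E = \int[@lebesgue_measure R]_(s in `[0%R, 1%R]) (phi (b + s *: u))%:E)%E.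
Proof.
move=> cphi; have c1 : continuous (fun _ : R => 1 : R) by exact: cst_continuous.
have H := avg_integrable u b c1 cphi.
rewrite /mean /avg /Rintegral fineK; last exact: integrable_fin_num.
by apply: eq_integral => s _; rewrite mul1r.
Qed.

(** Tonelli for the integral of phi(pr p + s u) over p in the domain and s in
    [0, 1]. *)
Lemma integral_mean phi u : continuous phi -> (forall b, 0 <= phi b) ->
  base_periodic (base_lattice Gamma pr) phi -> I (mean u phi) = I phi.
Proof.
move=> cphi phi0 phiL.
pose g (x : W * measurableTypeR R) := (phi (pr (of_pairs x.1) + x.2 *: u))%:E.
have m01 : measurable (`[0, 1]%classic : set (measurableTypeR R)).
  exact: measurable_itv.
have mg : measurable_fun setT g.
  apply/measurable_EFinP.
  have cpt : continuous (fun a : R * R => phi (pt2 a.1 a.2)) by exact: continuous_pt2.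
  rewrite (_ : (fun x => _) = fun x : W * measurableTypeR R =>
      phi (pt2 (of_pairs x.1 0 i + x.2 * u 0 0) (of_pairs x.1 0 j + x.2 * u 0 1))).
    apply: (measurableT_comp (continuous_plane_measurable cpt)
      (g := fun x : W * measurableTypeR R =>
        (of_pairs x.1 0 i + x.2 * u 0 0, of_pairs x.1 0 j + x.2 * u 0 1))).
    apply: measurable_fun_pair; apply: measurable_funD.
    - exact: (measurableT_comp (measurable_of_pairs i) measurable_fst).
    - by apply: measurable_funM; [exact: measurable_snd|exact: measurable_cst].
    - exact: (measurableT_comp (measurable_of_pairs j) measurable_fst).
    - by apply: measurable_funM; [exact: measurable_snd|exact: measurable_cst].
  apply/funext => x; congr phi; rewrite prE; apply/rowP => k; rewrite !mxE.
  by case: k => [[|[|//]]] Hk /=; congr (_ + _ * u _ _); apply: val_inj.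
pose h := g \_ (D' `*` `[0, 1]%classic).
have mD01 : measurable (D' `*` `[0, 1]%classic : set (W * measurableTypeR R)).
  exact: measurableX.
have mh : measurable_fun setT h.
  apply/(measurable_restrict g mD01 measurableT).
  by rewrite setTI; exact: measurable_funTS.
have h0 x : (0 <= h x)%E by rewrite /h patchE; case: ifP => // _; rewrite lee_fin.
have := @fubini_tonelli _ _ _ _ _ mu (@lebesgue_measure R) h mh h0.
have -> : (\int[mu]_w \int[@lebesgue_measure R]_s h (w, s) = I (mean u phi))%E.
  rewrite [RHS]integral_mkcond; apply: eq_integral => w _; rewrite patchE.
  case: ifPn => wD; last first.
    apply: integral0_eq => s _; rewrite /h patchE.
    case: ifPn => //; rewrite inE => -[/= Dw _]; move: wD.
    by rewrite notin_setE.
  rewrite meanE// [RHS]integral_mkcond; apply: eq_integral => s _.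
  rewrite /h !patchE; congr (if _ then _ else _); move: wD; rewrite inE => wD.
  by apply/idP/idP; rewrite !inE; [case|split].
have -> : (\int[@lebesgue_measure R]_s \int[mu]_w h (w, s) =
    \int[@lebesgue_measure R]_(s in `[0%R, 1%R]) I phi)%E.
  rewrite [RHS]integral_mkcond; apply: eq_integral => s _; rewrite patchE.
  case: ifPn => s01; last first.
    apply: integral0_eq => w _; rewrite /h patchE.
    case: ifPn => //; rewrite inE => -[/= _ s01']; move: s01.
    by rewrite notin_setE.
  rewrite -(integral_base_translate (s *: u) cphi phi0 phiL).
  rewrite [RHS]integral_mkcond; apply: eq_integral => w _.
  rewrite /h !patchE; congr (if _ then _ else _); move: s01; rewrite inE => s01.
  by apply/idP/idP; rewrite !inE; [case|split].
have lam1 : @lebesgue_measure R `[0, 1]%classic = 1%E.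
  by rewrite lebesgue_measure_itv/= lte_fin ltr01 oppr0 adde0.
move=> ->; rewrite integral_cst// -[RHS]mule1.
by congr (_ * _)%E; exact: lam1.
Qed.

(** The average over the torus of a function on it can be computed on the total
    space: if it integrates there like the constant 1, then it has average 1. *)
Lemma mean_mean_eq1 phi u v : base_lattice Gamma pr u -> base_lattice Gamma pr v ->
  row_free (col_mx u v) -> smooth phi -> (forall b, 0 <= phi b) ->
  base_periodic (base_lattice Gamma pr) phi ->
  I phi = (\int[mu]_(w in D') 1%:E)%E -> mean v (mean u phi) 0 = 1.
Proof.
move=> Lu Lv uv sphi phi0 phiL Iphi.
have phiu b : phi (b + u) = phi b by exact: phiL.
have phiv b : phi (b + v) = phi b by exact: phiL.
have cphi := smooth_continuous sphi.
have cm : continuous (mean u phi) by exact: mean_continuous.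
have m0 b : 0 <= mean u phi b.
  by apply: Rintegral_ge0 => s _; rewrite mul1r.
have mL : base_periodic (base_lattice Gamma pr) (mean u phi).
  by move=> b w Lw; apply: avg_periodic => q; exact: phiL.
have H := integral_mean v cm m0 mL.
move: (etrans H (etrans (integral_mean u cphi phi0 phiL) Iphi)).
under eq_integral do rewrite (mean_mean_const _ uv sphi phiu phiv).
rewrite !integral_cst// mul1e.
have fin : mu D' \is a fin_num by rewrite ge0_fin_numE.
have r0 : fine (mu D') != 0 by rewrite fine_eq0.
move=> /(congr1 fine); rewrite fineM//= => /(canRL (mulfK r0)) ->.
by rewrite divff.
Qed.

End OrbitMean.

(** * Linear algebra of 2-forms in four dimensions *)

Section BilinearForms.
Variables (R : realType) (n : nat).
Implicit Types (A J : 'M[R]_n) (u v w : 'rV[R]_n).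

Lemma bilDl A u v w : bil A (u + v) w = bil A u w + bil A v w.
Proof. by rewrite /bil !mulmxDl mxE. Qed.

Lemma bilDr A u v w : bil A u (v + w) = bil A u v + bil A u w.
Proof. by rewrite /bil linearD mulmxDr mxE. Qed.

Lemma bilNl A u v : bil A (- u) v = - bil A u v.
Proof. by rewrite /bil !mulNmx mxE. Qed.

Lemma bilNr A u v : bil A u (- v) = - bil A u v.
Proof. by rewrite /bil linearN mulmxN mxE. Qed.

Lemma bilD A B u v : bil (A + B) u v = bil A u v + bil B u v.
Proof. by rewrite /bil mulmxDr mulmxDl mxE. Qed.

Lemma bilZ (c : R) A u v : bil (c *: A) u v = c * bil A u v.
Proof. by rewrite /bil -scalemxAr -scalemxAl mxE. Qed.

Lemma bil_mul A (X Y : 'M[R]_n) u v :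
  bil A (u *m X) (v *m Y) = bil (X *m A *m Y^T) u v.
Proof. by rewrite /bil trmx_mul !mulmxA. Qed.

Lemma bil_trmx A u v : bil A u v = bil A^T v u.
Proof.
by rewrite /bil -[in LHS](trmxK (u *m A *m v^T)) mxE !trmx_mul trmxK mulmxA.
Qed.

Lemma bil_delta A (a b : 'I_n) : bil A (delta_mx 0 a) (delta_mx 0 b) = A a b.
Proof. by rewrite /bil -rowE trmx_delta -colE !mxE. Qed.

Lemma bil_inj A B : (forall u v, bil A u v = bil B u v) -> A = B.
Proof. by move=> AB; apply/matrixP => a b; rewrite -!bil_delta AB. Qed.

Lemma bilE A u v : bil A u v = \sum_a \sum_b u 0 a * A a b * v 0 b.
Proof.
rewrite /bil !mxE exchange_big /=; apply: eq_bigr => b _.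
by rewrite !mxE mulr_suml.
Qed.

Lemma bil_antisym A u v : (forall a b, A a b = - A b a) -> bil A u v = - bil A v u.
Proof.
move=> HA; rewrite !bilE exchange_big -sumrN; apply: eq_bigr => b _.
rewrite -sumrN; apply: eq_bigr => a _.
by rewrite (HA a b); ring.
Qed.

Lemma antisym_diag A a : (forall a b, A a b = - A b a) -> A a a = 0.
Proof.
by move=> HA; apply/eqP; rewrite -[_ == 0](mulrn_eq0 _ 2) mulr2n {1}HA addNr.
Qed.

End BilinearForms.

Section PlaneComplex.
Variable R : realType.

Lemma sum2 (F : 'I_2 -> R) : \sum_a F a = F 0 + F 1.
Proof.
rewrite !big_ord_recl big_ord0 addr0; congr (F _ + F _); exact: val_inj.
Qed.

(** A complex structure on the plane preserves the area. *)
Lemma complex_det (JB : 'M[R]_2) : JB *m JB = - 1%:M ->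
  JB 0 0 * JB 1 1 - JB 0 1 * JB 1 0 = 1.
Proof.
move=> JJ.
have E a b : JB a 0 * JB 0 b + JB a 1 * JB 1 b = - (a == b)%:R.
  by have := congr1 (fun X : 'M[R]_2 => X a b) JJ; rewrite !mxE sum2.
have := E 0 0; have := E 0 1; have := E 1 0; have := E 1 1.
move: (JB 0 0) (JB 0 1) (JB 1 0) (JB 1 1) => a b c d /=.
rewrite oppr0 => h11 h10 h01 h00.
(* The off-diagonal entries of the square are b (a + d) and c (a + d); a nonzero
   trace would give b = 0 and a^2 = -1. *)
have [ad|ad] := eqVneq (a + d) 0; first by nra.
have b0 : b = 0.
  by apply/eqP; move: h01 => /eqP; rewrite mulrC -mulrDr mulf_eq0 [_ + _]addrC; rewrite ?(negPf ad) ?orbF //; rewrite addrC (negPf ad) orbF.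
rewrite b0 in h00; nra.
Qed.

End PlaneComplex.

Section FourIndices.
Variables (R : realType) (i j k l : 'I_4).
Hypothesis ijkl : uniq [:: i; j; k; l].
Implicit Types (A J : 'M[R]_4) (u v : 'rV[R]_4).

Lemma four_perm : perm_eq (index_enum 'I_4) [:: i; j; k; l].
Proof.
rewrite perm_sym; apply: uniq_perm => //; first exact: index_enum_uniq.
move=> a; rewrite mem_index_enum.
have sub : {subset [:: i; j; k; l] <= enum 'I_4} by move=> b; rewrite mem_enum.
have le4 : (size (enum 'I_4) <= 4)%N by rewrite -cardE card_ord.
by have [_ ->] := uniq_min_size ijkl sub le4; rewrite mem_enum.
Qed.

Lemma sum4 (F : 'I_4 -> R) : \sum_a F a = F i + F j + F k + F l.
Proof.
rewrite (perm_big _ four_perm) !big_cons big_nil /=.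
by rewrite addr0 !addrA.
Qed.

(** Case analysis on an index, with the four indices named i, j, k, l. *)
Lemma ind4 (P : 'I_4 -> Prop) : P i -> P j -> P k -> P l -> forall a, P a.
Proof.
move=> Pi Pj Pk Pl a; have := mem_index_enum a.
rewrite (perm_mem four_perm) !inE.
by case/or4P => /eqP->.
Qed.

Lemma neq4 : (((i == j) = false) * ((i == k) = false) * ((i == l) = false) *
  ((j == i) = false) * ((j == k) = false) * ((j == l) = false) *
  ((k == i) = false) * ((k == j) = false) * ((k == l) = false) *
  ((l == i) = false) * ((l == j) = false) * ((l == k) = false))%type.
Proof.
move: ijkl; rewrite /= !inE !negb_or -!andbA.
case/and4P => ij ik il /and4P[jk jl kl _].
by do !split; apply/negbTE => //; rewrite eq_sym.
Qed.

(** The Pfaffian with respect to the ordered basis of index i, j, k, l. *)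
Definition pfaffian A : R := A i j * A k l - A i k * A j l + A i l * A j k.

(** The matrix of the 2-form dx_i /\ dx_j. *)
Definition base_area : 'M[R]_4 := delta_mx i j - delta_mx j i.

Lemma bil_base_area u v : bil base_area u v = u 0 i * v 0 j - u 0 j * v 0 i.
Proof. by rewrite bilE sum4 !sum4 !mxE !eqxx !neq4 /=; ring. Qed.

Lemma base_area_antisym a b : base_area a b = - base_area b a.
Proof.
by rewrite !mxE opprB; congr (_%:R - _%:R); rewrite andbC.
Qed.

Lemma pfaffianD A (c : R) :
  pfaffian (A + c *: base_area) = pfaffian A + c * A k l.
Proof. by rewrite /pfaffian !mxE !eqxx !neq4 /=; ring. Qed.

(** Block-unipotent changes of basis preserving the projection to the plane of
    the coordinates i and j. *)
Definition fibred (M : 'M[R]_4) : Prop :=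
  [/\ forall a, M a i = (a == i)%:R, forall a, M a j = (a == j)%:R &
      M k k * M l l - M k l * M l k = 1].

Lemma fibred_entry M A : fibred M -> (forall a b, A a b = - A b a) ->
  (M *m A *m M^T) k l = A k l.
Proof.
move=> [Mi Mj Mkl] HA; rewrite !mxE sum4 !mxE !sum4.
rewrite !Mi !Mj !neq4 (HA l k) !(antisym_diag _ HA).
by rewrite -[RHS]mul1r -[in X in _ = X * _]Mkl /=; ring.
Qed.

Lemma fibred_pfaffian M A : fibred M -> (forall a b, A a b = - A b a) ->
  pfaffian (M *m A *m M^T) = pfaffian A.
Proof.
move=> [Mi Mj Mkl] HA; rewrite /pfaffian !mxE !sum4 !mxE !sum4.
rewrite !Mi !Mj !eqxx !neq4 !(antisym_diag _ HA).
rewrite (HA j i) (HA k i) (HA l i) (HA k j) (HA l j) (HA l k).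
rewrite -[RHS]mul1r -[in X in _ = X * _]Mkl /=.
move: (M i k) (M i l) (M j k) (M j l) (M k k) (M k l) (M l k) (M l l).
move: (A i j) (A i k) (A i l) (A j k) (A j l) (A k l) => *.
by ring.
Qed.

(** On vectors that are A-orthogonal to the fibre, A is a multiple of the area
    form of the base. *)
Lemma horizontal_pfaffian A u v : (forall a b, A a b = - A b a) ->
  bil A u (delta_mx 0 k) = 0 -> bil A u (delta_mx 0 l) = 0 ->
  A k l * bil A u v = pfaffian A * bil base_area u v.
Proof.
move=> HA; rewrite bil_base_area /pfaffian !bilE !sum4 !mxE !eqxx !neq4 /=.
rewrite (HA j i) (HA k i) (HA l i) (HA k j) (HA l j) (HA l k) !(antisym_diag _ HA).
move: (u 0 i) (u 0 j) (u 0 k) (u 0 l) (v 0 i) (v 0 j) (v 0 k) (v 0 l).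
move: (A i j) (A i k) (A i l) (A j k) (A j l) (A k l).
move=> aij aik ail ajk ajl akl ui uj uk ul vi vj vk vl.
rewrite !mulr0 !mulr1 !addr0 ?add0r => hk hl.
set X := (X in X = 0) in hk; set Y := (X in X = 0) in hl.
(* Both sides agree modulo the two expressions that vanish by orthogonality. *)
transitivity ((aij * akl - aik * ajl + ail * ajk) * (ui * vj - uj * vi) +
  X * (akl * vk + ail * vi + ajl * vj) + Y * (akl * vl - aik * vi - ajk * vj)).
  by rewrite /X /Y; ring.
by rewrite hk hl !mul0r !addr0.
Qed.

End FourIndices.

Section RescaledForm.
Variables (R : realType) (i j k l : 'I_4).
Hypothesis ijkl : uniq [:: i; j; k; l].
Implicit Types (A J : 'M[R]_4) (u v : 'rV[R]_4).

(** The matrix of the projection to the coordinates i and j. *)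
Definition base_proj : 'M[R]_(4, 2) :=
  \matrix_(a, b) (if b == 0 then a == i else a == j)%:R.

Lemma base_projE u : u *m base_proj = pt2 (u 0 i) (u 0 j).
Proof.
apply/rowP => b; rewrite !mxE (sum4 ijkl) !mxE.
case: b => [[|[|//]]] Hb /=; rewrite ?eqxx !(neq4 ijkl) /=;
  by rewrite !mulr0 mulr1 ?addr0 ?add0r.
Qed.

Lemma base_areaE u v : bil (base_area R i j) u v =
  (u *m base_proj) 0 0 * (v *m base_proj) 0 1 -
  (u *m base_proj) 0 1 * (v *m base_proj) 0 0.
Proof. by rewrite (bil_base_area ijkl) !base_projE !mxE. Qed.

Variables (A J : 'M[R]_4) (JB : 'M[R]_2).
Hypothesis Aanti : forall a b, A a b = - A b a.
Hypothesis Akl : A k l != 0.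
Hypothesis JJ : J *m J = - 1%:M.
Hypothesis AJ : forall u v, bil A (u *m J) (v *m J) = bil A u v.
Hypothesis JBJB : JB *m JB = - 1%:M.
Hypothesis JP : J *m base_proj = base_proj *m JB.

Let Q := base_area R i j.

(** A complex structure compatible with one on the base preserves the area form
    of the base. *)
Lemma base_area_J u v : bil Q (u *m J) (v *m J) = bil Q u v.
Proof.
rewrite !base_areaE -!mulmxA JP !mulmxA.
have := complex_det JBJB.
move: (u *m base_proj) (v *m base_proj) => x y det1.
by rewrite !mxE !sum2 -[RHS]mul1r -det1; ring.
Qed.

Lemma rescaled_J (c : R) u v :
  bil (A + c *: Q) (u *m J) (v *m J) = bil (A + c *: Q) u v.
Proof. by rewrite !bilD !bilZ AJ base_area_J. Qed.

Let vertical u := u *m base_proj = 0.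

(* Vertical vectors are combinations of the fibre coordinate vectors. *)
Let vertical_bil h w : bil A h (delta_mx 0 k) = 0 -> bil A h (delta_mx 0 l) = 0 ->
  vertical w -> bil A h w = 0.
Proof.
move=> hk hl; rewrite /vertical base_projE => w0.
have wi : w 0 i = 0 by have := congr1 (fun x : 'rV_2 => x 0 0) w0; rewrite !mxE.
have wj : w 0 j = 0 by have := congr1 (fun x : 'rV_2 => x 0 1) w0; rewrite !mxE.
have -> : w = w 0 k *: delta_mx 0 k + w 0 l *: delta_mx 0 l.
  apply/rowP; apply: (ind4 ijkl); rewrite !mxE ?eqxx !(neq4 ijkl) /=;
    by rewrite ?wi ?wj; ring.
have bilZr (c : R) x y : bil A x (c *: y) = c * bil A x y.
  by rewrite /bil linearZ -scalemxAr mxE.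
by rewrite bilDr !bilZr hk hl !mulr0 addr0.
Qed.

(** Only the horizontal part of the form is rescaled, by the factor s. *)
Lemma rescaled_positive (s : R) : 0 < s ->
  (forall u, u != 0 -> 0 < bil A u (u *m J)) ->
  forall u, u != 0 ->
    0 < bil (A + ((s - 1) * (pfaffian i j k l A / A k l)) *: Q) u (u *m J).
Proof.
move=> s0 Apos u u0.
(* v is the vertical part of u and h its A-orthogonal, horizontal part. *)
pose v : 'rV[R]_4 := (bil A u (delta_mx 0 l) / A k l) *: delta_mx 0 k
  - (bil A u (delta_mx 0 k) / A k l) *: delta_mx 0 l.
pose h := u - v.
have vv : vertical v.
  rewrite /vertical base_projE; apply/rowP => b; rewrite !mxE !eqxx !(neq4 ijkl) /=.
  by case: b => [[|[|//]]] Hb /=; ring.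
have bv w : bil A v w = bil A u (delta_mx 0 l) / A k l * bil A (delta_mx 0 k) w
   - bil A u (delta_mx 0 k) / A k l * bil A (delta_mx 0 l) w.
  rewrite /v bilDl bilNl.
  by rewrite /bil -!scalemxAl !mxE.
have hk : bil A h (delta_mx 0 k) = 0.
  rewrite bilDl bilNl bv !bil_delta (antisym_diag _ Aanti) (Aanti l k).
  by field.
have hl : bil A h (delta_mx 0 l) = 0.
  rewrite bilDl bilNl bv !bil_delta (antisym_diag _ Aanti).
  by field.
have vJ : vertical (v *m J) by rewrite /vertical -mulmxA JP mulmxA vv mul0mx.
have hvJ : bil A h (v *m J) = 0 by exact: vertical_bil.
have vhJ : bil A v (h *m J) = 0.
  rewrite -AJ -mulmxA JJ mulmxN mulmx1 bilNr (bil_antisym _ _ Aanti) opprK.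
  exact: vertical_bil.
have uE : u = h + v by rewrite /h subrK.
have QE : bil Q u (u *m J) = bil Q h (h *m J).
  have up : u *m base_proj = h *m base_proj by rewrite uE mulmxDl vv addr0.
  by rewrite !base_areaE -!mulmxA JP !mulmxA up.
have AE : bil A u (u *m J) = bil A h (h *m J) + bil A v (v *m J).
  by rewrite uE mulmxDl bilDl !bilDr hvJ vhJ; ring.
rewrite bilD bilZ QE AE.
have -> : (s - 1) * (pfaffian i j k l A / A k l) * bil Q h (h *m J) =
    (s - 1) * bil A h (h *m J).
  have H := horizontal_pfaffian ijkl (h *m J) Aanti hk hl.
  rewrite -mulrA; congr (_ * _); by rewrite mulrAC -H [A k l * _]mulrC mulfK.
rewrite [X in 0 < X](_ : _ = s * bil A h (h *m J) + bil A v (v *m J)); last by ring.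
have [h0|h0] := eqVneq h 0.
  have v0 : v != 0 by move: u0; rewrite uE h0 add0r.
  by rewrite h0 mul0mx /bil !mul0mx mxE mulr0 add0r Apos.
rewrite ltr_pwDl ?mulr_gt0 ?Apos//.
have [->|v0] := eqVneq v 0; last exact/ltW/Apos.
by rewrite mul0mx /bil !mul0mx mxE.
Qed.

End RescaledForm.

Section CompatibleStructure.
Variables (R : realType) (i j k l : 'I_4).
Hypothesis ijkl : uniq [:: i; j; k; l].
Variable A : 'M[R]_4.
Hypothesis Aanti : forall a b, A a b = - A b a.
Hypothesis Akl : A k l != 0.
Implicit Types u v : 'rV[R]_4.

Local Notation Pf := (pfaffian i j k l A).

(** If the Pfaffian vanishes, the horizontal lift of e_i is in the kernel. *)
Lemma pfaffian_neq0 : (forall u, (forall v, bil A u v = 0) -> u = 0) -> Pf != 0.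
Proof.
move=> nd; apply/eqP => Pf0.
pose h : 'rV[R]_4 := delta_mx 0 i - (A i l / A k l) *: delta_mx 0 k
  + (A i k / A k l) *: delta_mx 0 l.
have bh w : bil A h w = bil A (delta_mx 0 i) w - A i l / A k l * bil A (delta_mx 0 k) w
  + A i k / A k l * bil A (delta_mx 0 l) w.
  by rewrite /h !bilDl bilNl /bil -!scalemxAl !mxE.
have hk : bil A h (delta_mx 0 k) = 0.
  by rewrite bh !bil_delta (antisym_diag _ Aanti) (Aanti l k); field.
have hl : bil A h (delta_mx 0 l) = 0.
  by rewrite bh !bil_delta (antisym_diag _ Aanti); field.
have h0 : h = 0.
  apply: nd => v; apply: (mulfI Akl); rewrite mulr0.
  by rewrite (horizontal_pfaffian ijkl _ Aanti hk hl) Pf0 mul0r.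
have := congr1 (fun x : 'rV_4 => x 0 i) h0; rewrite !mxE !eqxx !(neq4 ijkl) /=.
by rewrite !mulr0 subr0 addr0 => /eqP; rewrite oner_eq0.
Qed.

(* The shear 1 + N takes the base coordinate vectors to their lifts that are
   A-orthogonal to the fibre and fixes the fibre coordinate vectors. *)
Let N : 'M[R]_4 := (- A i l / A k l) *: delta_mx i k + (A i k / A k l) *: delta_mx i l
  + (- A j l / A k l) *: delta_mx j k + (A j k / A k l) *: delta_mx j l.

(* The 2-form, or infinitesimal rotation, with blocks of sizes x and y. *)
Let split (x y : R) : 'M[R]_4 :=
  x *: (delta_mx i j - delta_mx j i) + y *: (delta_mx k l - delta_mx l k).

Let delta_simp := (mulmxDl, mulmxDr, mulmxBl, mulmxBr, mulNmx, mulmxN, mul_delta_mx_cond,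
  eqxx, neq4 ijkl, mulr0n, mulr1n, scaler0, addr0, add0r, subr0, sub0r, oppr0).

Let NN : N *m N = 0.
Proof. by rewrite /N !(mulmxDl, mulmxDr) -!(scalemxAl, scalemxAr) !delta_simp. Qed.

Let N1 : (1%:M - N) *m (1%:M + N) = 1%:M.
Proof. by rewrite mulmxDr mulmx1 mulmxBl mul1mx NN subr0 subrK. Qed.

Let N1' : (1%:M + N) *m (1%:M - N) = 1%:M.
Proof. exact: mulmx1C. Qed.

Let NP : N *m base_proj R i j = 0.
Proof.
apply/matrixP; apply: (ind4 ijkl) => b; rewrite !mxE (sum4 ijkl) !mxE !eqxx !(neq4 ijkl) /=;
 by case: (b == 0) => /=; ring.
Qed.

Let splitM x y x' y' : split x y *m split x' y' =
  - (x * x') *: (delta_mx i i + delta_mx j j) - (y * y') *: (delta_mx k k + delta_mx l l).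
Proof.
rewrite /split !(mulmxDl, mulmxDr) -!(scalemxAl, scalemxAr) !delta_simp.
by rewrite -!opprD !scalerN !scalerA !scaleNr.
Qed.

Let splitMD x y x' y' : split x' y' *m
  (x *: (delta_mx i i + delta_mx j j) + y *: (delta_mx k k + delta_mx l l))
  = split (x' * x) (y' * y).
Proof.
rewrite /split !(mulmxDl, mulmxDr) -!(scalemxAl, scalemxAr) !delta_simp.
by rewrite !scalerA.
Qed.

Let one4 : (1%:M : 'M[R]_4) = delta_mx i i + delta_mx j j + (delta_mx k k + delta_mx l l).
Proof.
apply/matrixP; apply: (ind4 ijkl) => [||| ]; apply: (ind4 ijkl);
  rewrite !mxE !eqxx !(neq4 ijkl) /=; ring.
Qed.

Let splitT x y : (split x y)^T = - split x y.
Proof.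
apply/matrixP; apply: (ind4 ijkl) => [||| ]; apply: (ind4 ijkl);
  rewrite !mxE !eqxx !(neq4 ijkl) /=; ring.
Qed.

Let lift_i : delta_mx 0 i *m (1%:M + N) = delta_mx 0 i
  + ((- A i l / A k l) *: delta_mx 0 k + (A i k / A k l) *: delta_mx 0 l) :> 'rV[R]_4.
Proof. by rewrite /N !mulmxDr mulmx1 -!scalemxAr !delta_simp. Qed.

Let lift_j : delta_mx 0 j *m (1%:M + N) = delta_mx 0 j
  + ((- A j l / A k l) *: delta_mx 0 k + (A j k / A k l) *: delta_mx 0 l) :> 'rV[R]_4.
Proof. by rewrite /N !mulmxDr mulmx1 -!scalemxAr !delta_simp. Qed.

Let lift_k : delta_mx 0 k *m (1%:M + N) = delta_mx 0 k :> 'rV[R]_4.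
Proof. by rewrite /N !mulmxDr mulmx1 -!scalemxAr !delta_simp. Qed.

Let lift_l : delta_mx 0 l *m (1%:M + N) = delta_mx 0 l :> 'rV[R]_4.
Proof. by rewrite /N !mulmxDr mulmx1 -!scalemxAr !delta_simp. Qed.

Let bil_lift a (x y : R) w : bil A (delta_mx 0 a + (x *: delta_mx 0 k + y *: delta_mx 0 l)) w
  = bil A (delta_mx 0 a) w + (x * bil A (delta_mx 0 k) w + y * bil A (delta_mx 0 l) w).
Proof. by rewrite !bilDl /bil -!scalemxAl !mxE. Qed.

(* In the sheared basis the base and the fibre are orthogonal. *)
Let blockA : (1%:M + N) *m A *m (1%:M + N)^T = split (Pf / A k l) (A k l).
Proof.
set X := LHS; set C := 1%:M + N in X *.
have XE a b : X a b = bil A (delta_mx 0 a *m C) (delta_mx 0 b *m C).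
  by rewrite bil_mul bil_delta.
have Xanti a b : X a b = - X b a by rewrite !XE bil_antisym.
have Santi x y a b : split x y a b = - split x y b a.
  by have := splitT x y; move/matrixP/(_ b a); rewrite !mxE.
have Xik : X i k = 0.
  by rewrite XE lift_i lift_k bil_lift !bil_delta (antisym_diag _ Aanti) (Aanti l k); field.
have Xil : X i l = 0.
  by rewrite XE lift_i lift_l bil_lift !bil_delta (antisym_diag _ Aanti); field.
have Xjk : X j k = 0.
  by rewrite XE lift_j lift_k bil_lift !bil_delta (antisym_diag _ Aanti) (Aanti l k); field.
have Xjl : X j l = 0.
  by rewrite XE lift_j lift_l bil_lift !bil_delta (antisym_diag _ Aanti); field.
have Xij : X i j = Pf / A k l.
  apply: (canRL (mulfK Akl)); rewrite mulrC XE.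
  have H := horizontal_pfaffian ijkl (delta_mx 0 j *m C) Aanti.
  rewrite H.
  - rewrite (bil_base_area ijkl) lift_i lift_j !mxE !eqxx !(neq4 ijkl) /=.
    by rewrite !(mulr0n, mulr1n, mulr0, mul0r, mulr1, mul1r, addr0, add0r) subr0 mulr1.
  - by move: Xik; rewrite XE lift_k.
  - by move: Xil; rewrite XE lift_l.
have Xkl : X k l = A k l by rewrite XE lift_k lift_l bil_delta.
have SE : [/\ split (Pf / A k l) (A k l) i j = Pf / A k l,
    split (Pf / A k l) (A k l) k l = A k l,
    split (Pf / A k l) (A k l) i k = 0, split (Pf / A k l) (A k l) i l = 0 &
    split (Pf / A k l) (A k l) j k = 0 /\ split (Pf / A k l) (A k l) j l = 0].
  by rewrite !mxE !eqxx !(neq4 ijkl) /=; split; [..|split]; ring.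
case: SE => Sij Skl Sik Sil [Sjk Sjl].
have eqs a b : X a b = split (Pf / A k l) (A k l) a b ->
    X b a = split (Pf / A k l) (A k l) b a.
  by move=> ab; rewrite Xanti ab [RHS]Santi.
apply/matrixP; apply: (ind4 ijkl) => [||| ]; apply: (ind4 ijkl);
  try (by rewrite (antisym_diag _ Xanti) (antisym_diag _ (Santi _ _)));
  try (by rewrite ?Xij ?Xik ?Xil ?Xjk ?Xjl ?Xkl ?Sij ?Sik ?Sil ?Sjk ?Sjl ?Skl);
  apply: eqs;
  by rewrite ?Xij ?Xik ?Xil ?Xjk ?Xjl ?Xkl ?Sij ?Sik ?Sil ?Sjk ?Sjl ?Skl.
Qed.

(* A sign, with a nonzero value at 0. *)
Let sg (x : R) : R := if 0 < x then 1 else -1.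

Let sg2 x : sg x * sg x = 1.
Proof. by rewrite /sg; case: ifP => _; rewrite ?mulr1 // mulrNN mulr1. Qed.

Let sgM x : x != 0 -> 0 < sg x * x.
Proof.
move=> x0; rewrite /sg; case: (ltP 0 x) => [x_gt0|x_le0]; first by rewrite mul1r.
by rewrite mulN1r oppr_gt0 lt_neqAle x0.
Qed.

(** The complex structure that is block-diagonal for the splitting into the
    fibre and its A-orthogonal complement, each block being a rotation by a
    right angle in the direction in which A is positive. *)
Definition adapted_J : 'M[R]_4 :=
  (1%:M - N) *m split (sg (Pf / A k l)) (sg (A k l)) *m (1%:M + N).

(** The rotation by a right angle induced on the base. *)
Definition adapted_JB : 'M[R]_2 :=
  sg (Pf / A k l) *: (delta_mx 0 1 - delta_mx 1 0).

Let J := adapted_J.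
Local Notation rho := (sg (Pf / A k l)).
Local Notation sig := (sg (A k l)).

Lemma adapted_J_sqr : J *m J = - 1%:M.
Proof.
rewrite /J /adapted_J !mulmxA -[X in X *m split _ _ *m _]mulmxA N1' mulmx1.
rewrite -[X in X *m _ = _]mulmxA splitM !sg2 scaleN1r scale1r -opprD -one4.
by rewrite mulmxN mulmx1 mulNmx N1.
Qed.

Lemma adapted_JB_sqr : adapted_JB *m adapted_JB = - 1%:M.
Proof.
apply/matrixP => a b; rewrite !mxE sum2 !mxE.
have := sg2 (Pf / A k l); move: (sg _) => r r2.
by case: a => [[|[|//]]] Ha; case: b => [[|[|//]]] Hb /=; lra.
Qed.

Lemma adapted_J_base : J *m base_proj R i j = base_proj R i j *m adapted_JB.
Proof.
have CP : (1%:M + N) *m base_proj R i j = base_proj R i j.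
  by rewrite mulmxDl mul1mx NP addr0.
have C'P : (1%:M - N) *m base_proj R i j = base_proj R i j.
  by rewrite mulmxBl mul1mx NP subr0.
have sP x y : split x y *m base_proj R i j =
    base_proj R i j *m (x *: (delta_mx 0 1 - delta_mx 1 0)).
  apply/matrixP; apply: (ind4 ijkl) => b;
  rewrite !mxE (sum4 ijkl) sum2 !mxE !eqxx !(neq4 ijkl) /=;
  by case: b => [[|[|//]]] Hb /=; ring.
by rewrite /J /adapted_J -!mulmxA CP sP mulmxA C'P.
Qed.

Let AE : A = (1%:M - N) *m split (Pf / A k l) (A k l) *m (1%:M - N)^T.
Proof.
by rewrite -blockA !mulmxA N1 mul1mx -mulmxA -trmx_mul N1 trmx1 mulmx1.
Qed.

Let AJT : A *m J^T = (1%:M - N) *m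
  ((rho * (Pf / A k l)) *: (delta_mx i i + delta_mx j j)
    + (sig * A k l) *: (delta_mx k k + delta_mx l l)) *m (1%:M - N)^T.
Proof.
rewrite {1}AE /J /adapted_J !trmx_mul splitT.
rewrite -!mulmxA [(1%:M - N)^T *m _]mulmxA -trmx_mul N1' trmx1 mul1mx.
congr (_ *m _); rewrite mulmxA; congr (_ *m _).
by rewrite mulmxN splitM opprD !opprK scaleNr opprK [rho * _]mulrC [sig * _]mulrC.
Qed.

Lemma adapted_J_compat : J *m A *m J^T = A.
Proof.
rewrite -mulmxA AJT /J /adapted_J !mulmxA.
rewrite -[X in X *m _ *m _ = _]mulmxA N1' mulmx1.
rewrite [RHS]AE; congr (_ *m _); rewrite -mulmxA; congr (_ *m _).
by rewrite splitMD !mulrA !sg2 !mul1r.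
Qed.

Hypothesis Pf0 : Pf != 0.

Lemma adapted_J_positive u : u != 0 -> 0 < bil A u (u *m J).
Proof.
move=> u0; rewrite -{1}[u]mulmx1 bil_mul mul1mx AJT -bil_mul.
set y := u *m (1%:M - N).
have y0 : y != 0.
  apply: contraNneq u0 => y0.
  by rewrite -[u]mulmx1 -N1 mulmxA -/y y0 mul0mx.
have a0 : 0 < rho * (Pf / A k l) by rewrite sgM// mulf_neq0// invr_eq0.
have b0 : 0 < sig * A k l by exact: sgM.
move: (_ * (Pf / _)) (_ * A k l) a0 b0 => a b a0 b0.
have -> : bil (a *: (delta_mx i i + delta_mx j j) + b *: (delta_mx k k + delta_mx l l)) y y
    = a * (y 0 i ^+ 2 + y 0 j ^+ 2) + b * (y 0 k ^+ 2 + y 0 l ^+ 2).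
  rewrite bilE !(sum4 ijkl) !mxE !eqxx !(neq4 ijkl) /=.
  by rewrite !(mulr0n, mulr1n, mulr0, mul0r, mulr1, mul1r, addr0, add0r); ring.
have [yi|yi] := eqVneq (y 0 i) 0; last first.
  rewrite ltr_pwDl//; last by rewrite mulr_ge0 ?(ltW b0)// addr_ge0 ?sqr_ge0.
  by rewrite mulr_gt0// ltr_pwDl ?sqr_ge0// exprn_even_gt0.
have [yj|yj] := eqVneq (y 0 j) 0; last first.
  rewrite ltr_pwDl//; last by rewrite mulr_ge0 ?(ltW b0)// addr_ge0 ?sqr_ge0.
  by rewrite mulr_gt0// ltr_wpDl ?sqr_ge0// exprn_even_gt0.
have [yk|yk] := eqVneq (y 0 k) 0; last first.
  rewrite ltr_wpDl//; first by rewrite mulr_ge0 ?(ltW a0)// addr_ge0 ?sqr_ge0.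
  by rewrite mulr_gt0// ltr_pwDl ?sqr_ge0// exprn_even_gt0.
have [yl|yl] := eqVneq (y 0 l) 0; last first.
  rewrite ltr_wpDl//; first by rewrite mulr_ge0 ?(ltW a0)// addr_ge0 ?sqr_ge0.
  by rewrite mulr_gt0// ltr_wpDl ?sqr_ge0// exprn_even_gt0.
case/negP: y0; apply/eqP/rowP; apply: (ind4 ijkl);
by rewrite ?yi ?yj ?yk ?yl mxE.
Qed.

(** If A has no mixed components, the structure is block-diagonal for the
    coordinate splitting. *)
Lemma adapted_J_split : A i k = 0 -> A i l = 0 -> A j k = 0 -> A j l = 0 ->
  exists x y, J = x *: (delta_mx i j - delta_mx j i) + y *: (delta_mx k l - delta_mx l k).
Proof.
move=> ik il jk jl; exists rho, sig.
have N0 : N = 0 by rewrite /N ik il jk jl oppr0 !mul0r !scale0r !addr0.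
by rewrite /J /adapted_J N0 subr0 addr0 mulmx1 mul1mx.
Qed.

End CompatibleStructure.

(** * The Calabi-Yau problem for left-invariant structures *)

(** A constant factor of either sign can be cancelled from an equality of
    integrals of nonnegative functions. *)
Lemma integral_cancel_cst d (T : measurableType d) (R : realType)
    (m : {measure set T -> \bar R}) (D : set T) (h : T -> R) (c : R) :
  measurable D -> measurable_fun D h -> (forall x, 0 <= h x) -> c != 0 ->
  (\int[m]_(x in D) (h x * c)%:E = \int[m]_(x in D) c%:E)%E ->
  (\int[m]_(x in D) (h x)%:E = \int[m]_(x in D) 1%:E)%E.
Proof.
move=> mD mh h0 c0.
have pull (f : T -> R) : measurable_fun D f -> (forall x, 0 <= f x) ->
    (\int[m]_(x in D) (f x * c)%:E = c%:E * \int[m]_(x in D) (f x)%:E)%E.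
  move=> mf f0; have mfE : measurable_fun D (fun x => (f x)%:E).
    exact/measurable_EFinP.
  have pos (b : R) : 0 <= b ->
      (\int[m]_(x in D) (f x * b)%:E = b%:E * \int[m]_(x in D) (f x)%:E)%E.
    move=> b0; rewrite -ge0_integralZl//; last by move=> x _; rewrite lee_fin.
    by apply: eq_integral => x _; rewrite mulrC EFinM.
  have [cp|cn] := leP 0 c; first exact: pos.
  have cn0 : 0 <= - c by rewrite oppr_ge0 ltW.
  transitivity (- \int[m]_(x in D) (f x * - c)%:E)%E; last first.
    by rewrite pos// EFinN mulNe oppeK.
  rewrite -integral_ge0N; last by move=> x _; rewrite lee_fin mulr_ge0.
  by apply: eq_integral => x _; rewrite -EFinN mulrN opprK.
rewrite pull//.
have -> : (\int[m]_(x in D) c%:E = \int[m]_(x in D) (1 * c)%:E)%E.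
  by apply: eq_integral => x _; rewrite mul1r.
rewrite (pull (fun=> 1))//.
move=> /(congr1 (fun y => (c^-1)%:E * y)%E).
by rewrite !muleA -EFinM mulVf// !mul1e.
Qed.

Section AffineMaps.
Variables (R : realType) (m n : nat) (c : 'rV[R]_n) (A : 'M[R]_(m, n)).

Lemma is_diff_affine (f : 'rV[R]_m -> 'rV[R]_n) p :
  (forall q, f q = c + q *m A) -> 'd f p = (fun u => u *m A) :> ('rV[R]_m -> 'rV[R]_n).
Proof.
move=> fE; have -> : f = cst c + (mulmxr A : 'rV[R]_m -> 'rV[R]_n).
  by apply/funext => q; rewrite fE.
have cA : continuous (mulmxr A : 'rV[R]_m -> 'rV[R]_n) by exact: mulmx_continuous.
have dA := @linear_differentiable R _ _ (mulmxr A : {linear 'rV[R]_m -> 'rV[R]_n}) p cA.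
have dl := @diff_lin R _ _ (mulmxr A : {linear 'rV[R]_m -> 'rV[R]_n}) p cA.
have dc := @differentiable_cst R _ _ c p.
apply/funext => u; transitivity (0 + u *m A); last exact: add0r.
have dcu : 'd (cst c : 'rV[R]_m -> 'rV[R]_n) p u = 0.
  exact: (congr1 (fun h => h u) (@diff_cst R _ _ c p)).
have dAu := congr1 (fun h => h u) dl.
exact: (etrans (congr1 (fun h => h u) (diffD dc dA)) (f_equal2 +%R dcu dAu)).
Qed.

End AffineMaps.

Section InvarianceByAffineMaps.
Variables (R : realType) (f : 'rV[R]_4 -> 'rV[R]_4) (c : 'rV[R]_4) (A : 'M[R]_4).
Hypothesis fE : forall q, f q = c + q *m A.

Lemma preserves_formE w : preserves_form f w <->
  forall p, A *m w (f p) *m A^T = w p.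
Proof.
split=> [H p|H p u v]; last by rewrite (is_diff_affine _ fE) bil_mul H.
by apply: bil_inj => u v; rewrite -bil_mul -(H p u v) (is_diff_affine _ fE).
Qed.

Lemma preserves_endoE J : (forall p, A *m J (f p) = J p *m A) ->
  preserves_endo f J.
Proof.
by move=> H p u; rewrite (is_diff_affine _ fE) -!mulmxA H.
Qed.

End InvarianceByAffineMaps.

Section LeftInvariantGeometry.
Variables (R : realType) (i j k l : 'I_4).
Hypothesis ijkl : uniq [:: i; j; k; l].
Local Notation E := 'rV[R]_4.
Local Notation B := 'rV[R]_2.
Variables (mul : E -> E -> E) (Gamma : set (E -> E)) (pr : E -> B).
Variables (M : E -> 'M[R]_4) (signs : R -> Prop).
Variable Omega : E -> 'M[R]_4.

Local Notation P := (base_proj R i j).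
Local Notation Pf := (pfaffian i j k l).

(** Multiplication of the fibre coordinates by e, with which elements of Gamma
    are composed; e = 1 is the identity and e = -1 a reflection. *)
Definition twist (e : R) : 'M[R]_4 :=
  1 *: (delta_mx i i + delta_mx j j) + e *: (delta_mx k k + delta_mx l l).

(* M a is the differential of the left translation by a, which is affine; MM
   makes mul associative, MV makes M a invertible, and Mtwist makes twist e an
   automorphism. *)
Hypothesis prE : forall p, pr p = p *m P.
Hypothesis mulE : forall a p, mul a p = a + p *m M a.
Hypothesis MM : forall a p, M (mul a p) = M p *m M a.
Hypothesis MV : forall p, M (- p) *m M p = 1%:M.
Hypothesis Msmooth : smooth_mx M.
Hypothesis Mfibred : forall a, fibred i j k l (M a).
Hypothesis signsP : forall e, signs e -> e = 1 \/ e = -1.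
Hypothesis Mtwist : forall c e, signs e ->
  M c *m twist e = twist e *m M (c *m twist e).
Hypothesis GammaE : forall f, Gamma f -> exists c e, signs e /\
  forall p, f p = c + p *m (twist e *m M c).

Let MV' p : M p *m M (- p) = 1%:M.
Proof. exact/mulmx1C/MV. Qed.

Let M0 : M 0 = 1%:M.
Proof.
have H : M 0 *m M 0 = M 0 by rewrite -MM mulE mul0mx addr0.
by rewrite -H -{1}oppr0 MV.
Qed.

Let mul0 a : mul a 0 = a.
Proof. by rewrite mulE mul0mx addr0. Qed.

Let MP a : M a *m P = P.
Proof.
have [Mi Mj _] := Mfibred a.
apply/matrixP => x b; rewrite !mxE.
have sumP (F : 'I_4 -> R) (y : 'I_4) : \sum_z F z * (z == y)%:R = F y.
  rewrite (bigD1 y)//= eqxx mulr1 big1 ?addr0// => z /negPf->.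
  by rewrite mulr0.
under eq_bigr do rewrite mxE.
by case: (b == 0); rewrite sumP ?Mi ?Mj.
Qed.

Lemma twist1 : twist 1 = 1%:M.
Proof.
apply/matrixP; apply: (ind4 ijkl) => [||| ]; apply: (ind4 ijkl);
  by rewrite !mxE !eqxx !(neq4 ijkl) /=; ring.
Qed.

Lemma twistM e e' : twist e *m twist e' = twist (e * e').
Proof.
rewrite /twist !(mulmxDl, mulmxDr) -!(scalemxAl, scalemxAr).
by rewrite !(mulmxDl, mulmxDr, mul_delta_mx_cond, eqxx, neq4 ijkl, mulr0n, mulr1n,
  scaler0, addr0, add0r) !scalerA mulr1.
Qed.

Lemma twistT e : (twist e)^T = twist e.
Proof.
apply/matrixP; apply: (ind4 ijkl) => [||| ]; apply: (ind4 ijkl);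
  by rewrite !mxE !eqxx !(neq4 ijkl).
Qed.

Lemma twist_proj e : twist e *m P = P.
Proof.
apply/matrixP; apply: (ind4 ijkl) => b; rewrite !mxE (sum4 ijkl) !mxE !eqxx !(neq4 ijkl) /=;
  by case: (b == 0) => /=; ring.
Qed.

Section InvariantForm.
Hypothesis Oanti : forall p a b, Omega p a b = - Omega p b a.
Hypothesis Oinv : invariant_form mul Gamma Omega.
Hypothesis Onondeg : forall p u, (forall v, bil (Omega p) u v = 0) -> u = 0.
Hypothesis Ofibre : nonzero_on_fibres pr Omega.

Local Notation A := (Omega 0).

(** Left-invariance expresses Omega by its value at the identity. *)
Lemma Omega_left p : M p *m Omega p *m (M p)^T = A.
Proof.
have [/(_ p)/(preserves_formE (mulE p))/(_ 0) + _] := Oinv.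
by rewrite mul0.
Qed.

Let OmegaE p : Omega p = M (- p) *m A *m (M (- p))^T.
Proof.
rewrite -(Omega_left p) !mulmxA MV mul1mx -mulmxA -trmx_mul.
by rewrite MV trmx1 mulmx1.
Qed.

Lemma Omega_fibre_const p : Omega p k l = A k l.
Proof. by rewrite -(Omega_left p) (fibred_entry ijkl). Qed.

Lemma Omega_pfaffian_const p : Pf (Omega p) = Pf A.
Proof. by rewrite -(Omega_left p) (fibred_pfaffian ijkl). Qed.

Lemma Omega_fibre_neq0 : A k l != 0.
Proof.
have [u [v [du dv]]] := Ofibre 0.
have prd w : 'd pr 0 w = w *m P.
  by rewrite (@is_diff_affine _ _ _ 0 P)// => q; rewrite add0r prE.
have vert (w : E) : w *m P = 0 -> w 0 i = 0 /\ w 0 j = 0.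
  rewrite (base_projE ijkl) => w0; split.
    by have := congr1 (fun x : 'rV_2 => x 0 0) w0; rewrite !mxE.
  by have := congr1 (fun x : 'rV_2 => x 0 1) w0; rewrite !mxE.
move: du dv; rewrite !prd => /vert[ui uj] /vert[vi vj].
apply: contraNneq => Akl0.
rewrite bilE !(sum4 ijkl) ui uj vi vj !(antisym_diag _ (Oanti 0)) (Oanti 0 l k) Akl0.
by apply/eqP; ring.
Qed.

Lemma Omega_pfaffian_neq0 : Pf A != 0.
Proof.
apply: (pfaffian_neq0 ijkl (Oanti 0) Omega_fibre_neq0); exact: Onondeg.
Qed.

(** A symmetry that reverses the fibres forces the form to have no mixed
   components, so the adapted structure commutes with it. *)
Lemma adapted_J_twist f c e : Gamma f -> signs e ->
  (forall p, f p = c + p *m (twist e *m M c)) ->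
  twist e *m adapted_J i j k l A = adapted_J i j k l A *m twist e.
Proof.
move=> Gf se fE; have [e1|eN1] := signsP se.
  by rewrite e1 twist1 mul1mx mulmx1.
have [_ /(_ f Gf)/(preserves_formE fE)/(_ 0)] := Oinv.
rewrite fE mul0mx addr0 trmx_mul twistT => H.
have {}H : twist e *m A *m twist e = A.
  by rewrite -[RHS]H -[in LHS](Omega_left c) !mulmxA.
have twR a : delta_mx 0 a *m twist e =
    (if (a == i) || (a == j) then 1 else e) *: delta_mx 0 a :> 'rV[R]_4.
  move: a; apply: (ind4 ijkl); rewrite /twist !mulmxDr -!scalemxAr !mulmxDr;
  by rewrite !(mul_delta_mx_cond, eqxx, neq4 ijkl, mulr0n, mulr1n, scaler0, addr0, add0r).
have twE a b : (twist e *m A *m twist e) a b =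
    (if (a == i) || (a == j) then 1 else e) * (if (b == i) || (b == j) then 1 else e) * A a b.
  have bilZZ (x y : R) (u v : 'rV[R]_4) : bil A (x *: u) (y *: v) = x * y * bil A u v.
    by rewrite /bil linearZ -!scalemxAl -scalemxAr !mxE mulrA.
  have -> : (twist e *m A *m twist e) a b =
      bil A (delta_mx 0 a *m twist e) (delta_mx 0 b *m twist e).
    by rewrite bil_mul twistT bil_delta.
  by rewrite !twR bilZZ bil_delta.
have mixed a b : (a == i) || (a == j) -> (b == i) || (b == j) = false -> A a b = 0.
  move=> aE bE; have := twE a b; rewrite H aE bE eN1 mul1r mulN1r => h; lra.
have [||||x [y ->]] := adapted_J_split (i := i) (j := j) (k := k) (l := l) (A := A);
  rewrite ?mixed ?eqxx ?(neq4 ijkl)//.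
rewrite /twist !(mulmxDl, mulmxDr, mulmxBl, mulmxBr) -!(scalemxAl, scalemxAr).
rewrite !(mulmxDl, mulmxDr, mulmxBl, mulmxBr, mulmxN, mulNmx,
  mul_delta_mx_cond, eqxx, neq4 ijkl, mulr0n, mulr1n, oppr0, scaler0, addr0, add0r,
  subr0, sub0r) !scalerA !mul1r !mulr1.
by rewrite [y * e]mulrC.
Qed.

Section AdaptedStructure.
Variables (J0 : 'M[R]_4) (JB : 'M[R]_2).
Hypothesis J0_twist : forall f c e, Gamma f -> signs e ->
  (forall p, f p = c + p *m (twist e *m M c)) -> twist e *m J0 = J0 *m twist e.
Hypothesis J0_sqr : J0 *m J0 = - 1%:M.
Hypothesis JB_sqr : JB *m JB = - 1%:M.
Hypothesis J0_base : J0 *m P = P *m JB.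
Hypothesis J0_compat : J0 *m A *m J0^T = A.
Hypothesis J0_positive : forall u, u != 0 -> 0 < bil A u (u *m J0).

(** The left-invariant almost-complex structure with value J0 at the identity. *)
Let J p := M (- p) *m J0 *m M p.

Let g p := Omega p *m (J p)^T.

Let J_left a p : M a *m J (mul a p) = J p *m M a.
Proof.
have -> : J (mul a p) = M (- mul a p) *m J0 *m (M p *m M a) by rewrite /J MM.
have MN : M (- mul a p) = M (- a) *m M (- p).
  have one : M p *m M a *m (M (- a) *m M (- p)) = 1%:M.
    by rewrite mulmxA -[M p *m _ *m _]mulmxA MV' mulmx1 MV'.
  by rewrite -[LHS]mulmx1 -one mulmxA -MM MV mul1mx.
by rewrite MN /J !mulmxA MV' mul1mx.
Qed.

Let J_Gamma f : Gamma f -> exists c X, (forall p, f p = c + p *m X) /\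
  forall p, X *m J (f p) = J p *m X.
Proof.
move=> Gf; have [c [e [se fE]]] := GammaE Gf.
exists c, (twist e *m M c); split=> // p.
have -> : f p = mul c (p *m twist e) by rewrite fE mulE mulmxA.
rewrite -mulmxA J_left mulmxA [RHS]mulmxA; congr (_ *m _).
have MtV : twist e *m M (- (p *m twist e)) = M (- p) *m twist e.
  rewrite -[LHS]mul1mx -(MV p) -mulmxA; congr (_ *m _).
  by rewrite mulmxA Mtwist// -mulmxA MV' mulmx1.
rewrite /J; move: J0 (J0_twist Gf se fE) => X XE.
by rewrite !mulmxA MtV -[M (- p) *m twist e *m X]mulmxA XE -!mulmxA Mtwist.
Qed.

Let J_sqr p : J p *m J p = - 1%:M.
Proof.
rewrite /J !mulmxA -[X in X *m J0 *m _]mulmxA MV' mulmx1.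
rewrite -[X in X *m _ = _]mulmxA J0_sqr mulmxN mulmx1 mulNmx.
by rewrite MV.
Qed.

Let J_proj p : J p *m P = P *m JB.
Proof.
by rewrite /J -!mulmxA MP J0_base mulmxA MP.
Qed.

Let J_Omega p : J p *m Omega p *m (J p)^T = Omega p.
Proof.
have JN : J p *m M (- p) = M (- p) *m J0 by rewrite /J -mulmxA MV' mulmx1.
rewrite {1}OmegaE -mulmxA !mulmxA JN -mulmxA -trmx_mul JN trmx_mul !mulmxA.
rewrite -[X in X *m _ = _]mulmxA -mulmxA.
by rewrite [RHS]OmegaE -[in RHS]J0_compat !mulmxA.
Qed.

Let Omega_trmx p : (Omega p)^T = - Omega p.
Proof. by apply/matrixP => a b; rewrite !mxE. Qed.

Let g_sym p : (g p)^T = g p.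
Proof.
rewrite /g trmx_mul trmxK Omega_trmx mulmxN.
have -> : Omega p *m (J p)^T = J p *m Omega p *m (J p *m J p)^T.
  by rewrite [(J p *m J p)^T]trmx_mul mulmxA J_Omega.
by rewrite J_sqr linearN /= trmx1 mulmxN mulmx1.
Qed.

Let J_smooth : smooth_mx J.
Proof.
apply: smooth_mxM => //; apply: smooth_mxM; last exact: smooth_mx_cst.
move=> a b; rewrite (_ : (fun p => _) = fun p => (fun q => M q a b) (p *m (- 1%:M))).
  exact: (@smooth_comp_linear R 4 4 (- 1%:M) (fun q => M q a b) (Msmooth a b)).
by apply/funext => p; rewrite mulmxN mulmx1.
Qed.

Let J_positive p u : u != 0 -> 0 < bil (Omega p) u (u *m J p).
Proof.
move=> u0; have uN0 : u *m M (- p) != 0.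
  by apply: contraNneq u0 => h; rewrite -[u]mulmx1 -(MV p) mulmxA h mul0mx.
have -> : bil (Omega p) u (u *m J p) = bil A (u *m M (- p)) (u *m M (- p) *m J0).
  rewrite OmegaE -bil_mul; congr (bil _ _ _).
  by rewrite /J -!mulmxA MV' mulmx1.
exact: J0_positive.
Qed.

Lemma invariant_structure_of_J0 : two_form Omega -> closed_form Omega ->
  exists g J : E -> 'M[R]_4,
    invariant_almost_kahler mul Gamma g J Omega /\ J_holomorphic Gamma pr J.
Proof.
move=> O2 Ocl; have [Osm _] := O2.
have gE p u : bil (g p) u u = bil (Omega p) u (u *m J p).
  by rewrite -{1}[u in RHS]mulmx1 bil_mul mul1mx.
have gJ p : J p *m g p *m (J p)^T = g p by rewrite /g mulmxA J_Omega.
have gsm : smooth_mx g by apply: smooth_mxM => //; exact: smooth_mxT.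
have ginv f c X : (forall p, f p = c + p *m X) -> preserves_form f Omega ->
    (forall p, X *m J (f p) = J p *m X) -> preserves_form f g.
  move=> fE /(preserves_formE fE) fO fJ; apply/(preserves_formE fE) => p.
  rewrite /g -!mulmxA -trmx_mul fJ trmx_mul !mulmxA.
  by rewrite -(fO p).
have [OL OG] := Oinv.
exists g, J; split; last first.
  exists (fun=> JB); split=> //.
  - split; [exact: smooth_mx_cst|move=> p; exact: JB_sqr].
  - have prd w p : 'd pr p w = w *m P.
      by rewrite (@is_diff_affine _ _ _ 0 P)// => q; rewrite add0r prE.
    by move=> p u; rewrite !prd -[u *m J p *m P]mulmxA J_proj mulmxA.
split=> //.
- split=> //; [split=> //| | ].
  + by move=> p u v; rewrite bil_trmx g_sym.
  + by move=> p u u0; rewrite gE J_positive.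
  + by move=> p u v; rewrite bil_mul gJ.
  + move=> p u v; rewrite -[v in RHS](mulmx1 v) bil_mul trmx1 mulmx1.
    by rewrite /g mulmxA J_Omega.
- split=> [a|f Gf].
    by apply: (ginv (mul a) a (M a)) => // p; exact: J_left.
  have [c [X [fE fJ]]] := J_Gamma Gf.
  by apply: (ginv f c X) => //; exact: OG.
- split=> [a|f Gf].
    by apply: (preserves_endoE (mulE a)) => p; exact: J_left.
  by have [c [X [fE fJ]]] := J_Gamma Gf; exact: (preserves_endoE fE).
Qed.

End AdaptedStructure.

Lemma invariant_almost_kahler_exists : two_form Omega -> closed_form Omega ->
  exists g J : E -> 'M[R]_4,
    invariant_almost_kahler mul Gamma g J Omega /\ J_holomorphic Gamma pr J.
Proof.
apply: (@invariant_structure_of_J0 (adapted_J i j k l A) (adapted_JB i j k l A)).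
- exact: adapted_J_twist.
- exact: adapted_J_sqr.
- exact: adapted_JB_sqr.
- exact: adapted_J_base.
- exact: (adapted_J_compat ijkl (Oanti 0) Omega_fibre_neq0).
- exact: (adapted_J_positive ijkl (Oanti 0) Omega_fibre_neq0 Omega_pfaffian_neq0).
Qed.

(* eps accounts for the factor 2 in the square of a 2-form and for the sign of
   the permutation (i, j, k, l). *)
Variable eps : R.
Hypothesis eps0 : eps != 0.
Hypothesis wedgeE : forall X : 'M[R]_4, (forall a b, X a b = - X b a) ->
  wedge X X = eps * Pf X.
Hypothesis Ggroup : transformation_group Gamma.
Hypothesis Gfree : acts_freely Gamma.
Hypothesis Gpd : acts_properly_discontinuously Gamma.
Hypothesis Gcc : acts_cocompactly Gamma.
Hypothesis Gbundle : torus_bundle Gamma pr.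
Hypothesis Gvol : forall c e, signs e ->
  volume_preserving (fun p => c + p *m (twist e *m M c)).
Hypothesis Rvol : forall v : B, volume_preserving (fun p => p + v *m P^T *m M p).

Let PTP : P^T *m P = 1%:M.
Proof.
apply/matrixP => a b; rewrite !mxE (sum4 ijkl) !mxE !eqxx !(neq4 ijkl).
by case: a => [[|[|//]]] Ha; case: b => [[|[|//]]] Hb /=; ring.
Qed.

Let PT_twist e : P^T *m twist e = P^T.
Proof. by rewrite -[LHS]trmxK trmx_mul trmxK twistT twist_proj. Qed.

(* Right translations by elements with vanishing fibre coordinates.  They commute
   with left translations by associativity, and with twist e because it is an
   automorphism that fixes these elements. *)
Let T (v : B) (p : E) : E := p + v *m P^T *m M p.

Let T_Gamma v f p : Gamma f -> T v (f p) = f (T v p).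
Proof.
move=> Gf; have [c [e [se fE]]] := GammaE Gf.
have H1 := Mtwist p se; have H2 := PT_twist e.
move: (twist e) fE H1 H2 => X fE H1 H2.
have Mf : M (f p) = M (p *m X) *m M c by rewrite -MM mulE fE mulmxA.
rewrite /T Mf !fE [(p + _) *m _]mulmxDl addrA; congr (_ + _).
rewrite !mulmxA; congr (_ *m _).
by rewrite -[RHS]mulmxA H1 mulmxA -[v *m P^T *m X]mulmxA H2.
Qed.

Let pr_T v p : pr (T v p) = pr p + v.
Proof. by rewrite !prE mulmxDl -mulmxA MP -mulmxA PTP mulmx1. Qed.

Let pr_pt2 p : pr p = pt2 (p 0 i) (p 0 j).
Proof. by rewrite prE (base_projE ijkl). Qed.

Let Gvol' f : Gamma f -> volume_preserving f.
Proof.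
move=> Gf; have [c [e [se fE]]] := GammaE Gf.
by rewrite (_ : f = fun p => c + p *m (twist e *m M c)); [exact: Gvol|exact/funext].
Qed.

(* The pull-back to R^4 of a 1-form on the base. *)
Let pullback (beta : B -> B) (p : E) : E := beta (p *m P) *m P^T.

Let ext_d_pullback beta p : smooth_mx beta -> ext_d (pullback beta) p =
  (partial 0 (fun r => beta r 0 1) (p *m P) -
   partial 1 (fun r => beta r 0 0) (p *m P)) *: base_area R i j.
Proof.
move=> sb.
pose h (a : 'I_4) r := P a 0 * beta r 0 0 + P a 1 * beta r 0 1.
have sh a : smooth (h a).
  by apply: smoothD; apply: smoothM => //; exact: smooth_cst.
have hE a : (fun q => pullback beta q 0 a) = fun q => h a (q *m P).
  by apply/funext => q; rewrite mxE sum2 ![P^T _ _]mxE /h ![P _ _ * _]mulrC.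
have ph b a r : partial b (h a) r = P a 0 * partial b (fun r => beta r 0 0) r
    + P a 1 * partial b (fun r => beta r 0 1) r.
  have d0 := smooth_derivable r b (sb 0 0).
  have d1 := smooth_derivable r b (sb 0 1).
  have H := deriveD (derivableZ (k := P a 0) d0) (derivableZ (k := P a 1) d1).
  by rewrite [LHS]H !deriveZ.
have pE a b : partial a (fun q => pullback beta q 0 b) p =
    P a 0 * partial 0 (h b) (p *m P) + P a 1 * partial 1 (h b) (p *m P).
  rewrite hE; have [_ H] := @partial_comp_linear R 4 2 P (h b) p a (sh b).
  by rewrite [LHS]H sum2.
apply/matrixP => a b; rewrite mxE !pE !ph [RHS]mxE.
have -> : base_area R i j a b = P a 0 * P b 1 - P a 1 * P b 0.
  by rewrite !mxE /= -!natrM !mulnb.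
move: (P a 0) (P a 1) (P b 0) (P b 1).
move: (partial 0 _ _) (partial 0 _ _) (partial 1 _ _) (partial 1 _ _) => *.
by ring.
Qed.

(** The solution is Omega + (exp F - 1) (Pf / Omega_kl) dx_i /\ dx_j. *)
Theorem calabi_yau_solvable g' J' : invariant_almost_kahler mul Gamma g' J' Omega ->
  J_holomorphic Gamma pr J' ->
  forall (F : B -> R) (sigma : E -> R) (D : set E),
    smooth F -> base_periodic (base_lattice Gamma pr) F ->
    (forall p, sigma p = expR (F (pr p)) * wedge (Omega p) (Omega p)) ->
    fundamental_domain Gamma D ->
    integral_over D sigma = integral_over D (fun p => wedge (Omega p) (Omega p)) ->
    exists alpha : E -> E,
      [/\ smooth_mx alpha,
          forall f, Gamma f -> preserves_1form f alpha,
          positive_11 J' (fun p => Omega p + ext_d alpha p) &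
          forall p, wedge (Omega p + ext_d alpha p) (Omega p + ext_d alpha p) = sigma p].
Proof.
move=> [[[_ _ gpos] [_ JJ] gJ [[Osm _] Ocl] Og] _ _ _] [JB [[_ JBJB] _ JBpr]].
move=> F sigma D sF Fper sigmaE fD int_eq.
have [Gpr [u [v [uv LE]]] _ _] := Gbundle.
pose phi b := expR (F b).
have sphi : smooth phi by exact: smooth_expR.
have phi0 b : 0 <= phi b by exact: expR_ge0.
have phiL : base_periodic (base_lattice Gamma pr) phi.
  by move=> b w Lw; rewrite /phi Fper.
have Lu : base_lattice Gamma pr u.
  by rewrite LE; exists 1, 0; rewrite scale1r scale0r addr0.
have Lv : base_lattice Gamma pr v.
  by rewrite LE; exists 0, 1; rewrite scale1r scale0r add0r.
have wE p : wedge (Omega p) (Omega p) = eps * Pf A.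
  by rewrite wedgeE// Omega_pfaffian_const.
have c0 : eps * Pf A != 0 by rewrite mulf_neq0// Omega_pfaffian_neq0.
have mean1 : mean v (mean u phi) 0 = 1.
  apply: (@mean_mean_eq1 R Gamma pr i j T pr_pt2 Ggroup Gfree Gpd Gcc Gvol' Gpr
    T_Gamma pr_T Rvol D fD phi u v Lu Lv uv sphi phi0 phiL).
  have [mD _] := fD.
  have mphi := measurable_base_function pr_pt2 (smooth_continuous sphi).
  apply: (@integral_cancel_cst _ _ _ (space_measure R) _
    (fun w => phi (pr (of_pairs w))) (eps * Pf A)) => //.
    exact: measurable_funTS.
  have -> : (fun w => (phi (pr (of_pairs w)) * (eps * Pf A))%:E) =
      (fun w => (sigma (of_pairs w))%:E).
    by apply/funext => w; rewrite sigmaE wE.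
  have wcst : (fun p => wedge (Omega p) (Omega p)) = fun=> eps * Pf A by exact/funext.
  by move: int_eq; rewrite wcst /integral_over leb4E.
have [beta [sbeta betaL curl]] := periodic_curl uv LE sphi phiL.
(* The multiple of the area form of the base that equals Omega on horizontal
   vectors. *)
pose kappa := Pf A / A k l.
pose alpha := pullback (fun b => kappa *: beta b).
have skbeta : smooth_mx (fun b => kappa *: beta b).
  move=> a b; rewrite (_ : (fun p => _) = fun p => kappa * beta p a b).
    by apply: smoothM => //; exact: smooth_cst.
  by apply/funext => p; rewrite mxE.
have dalpha p : ext_d alpha p = ((phi (pr p) - 1) * kappa) *: base_area R i j.
  rewrite /alpha ext_d_pullback// -prE; congr (_ *: _).
  have pk (a b : 'I_2) q : partial a (fun r => (kappa *: beta r) 0 b) q =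
      kappa * partial a (fun r => beta r 0 b) q.
    rewrite (_ : (fun r => (kappa *: beta r) 0 b) = fun r => kappa * beta r 0 b).
      exact: (deriveZ kappa (smooth_derivable q a (sbeta 0 b))).
    by apply/funext => r; rewrite mxE.
  by rewrite !pk -mulrBr curl mean1 mulrC.
have kappaE p : kappa = Pf (Omega p) / Omega p k l.
  by rewrite Omega_pfaffian_const Omega_fibre_const.
have Okl p : Omega p k l != 0 by rewrite Omega_fibre_const Omega_fibre_neq0.
have OJ p x y : bil (Omega p) (x *m J' p) (y *m J' p) = bil (Omega p) x y.
  by rewrite !Og gJ.
have Opos p x : x != 0 -> 0 < bil (Omega p) x (x *m J' p).
  move=> x0; rewrite Og; apply: gpos.
  apply: contraNneq x0 => xJ0; rewrite -[x]opprK -[x]mulmx1 -mulmxN -(JJ p).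
  by rewrite mulmxA xJ0 mul0mx oppr0.
have JP p : J' p *m P = P *m JB (pr p).
  have prd (w : E) : 'd pr p w = w *m P.
    by rewrite (@is_diff_affine _ _ _ 0 P)// => q; rewrite add0r prE.
  apply/row_matrixP => a; rewrite !rowE.
  by have := JBpr p (delta_mx 0 a); rewrite !prd -!mulmxA.
have antiE p (c : R) a b : (Omega p + c *: base_area R i j) a b =
    - (Omega p + c *: base_area R i j) b a.
  have addE x y : (Omega p + c *: base_area R i j) x y =
      Omega p x y + c * base_area R i j x y.
    by rewrite mxE; congr (_ + _); rewrite mxE.
  by rewrite !addE (Oanti p a b) (base_area_antisym _ _ _ a b); ring.
exists alpha; split.
- move=> a b; rewrite (_ : (fun p => _) = fun p =>
      \sum_x (kappa *: beta (p *m P)) a x * P^T x b).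
    apply: smooth_sum => x; apply: smoothM; last exact: smooth_cst.
    exact: (@smooth_comp_linear R 4 2 P (fun q => (kappa *: beta q) a x) (skbeta a x)).
  by apply/funext => p; rewrite mxE.
- move=> f Gf p x; have [c [e [se fE]]] := GammaE Gf.
  have [w fw] := Gpr f Gf.
  have Lw : base_lattice Gamma pr w by exists f.
  rewrite (is_diff_affine _ fE) /alpha /pullback -!prE fw betaL//.
  rewrite trmx_mul trmxK !mulmxA -[x *m _ *m _ *m P]mulmxA.
  by rewrite -!mulmxA [M c *m (P *m _)]mulmxA MP [twist e *m (P *m _)]mulmxA twist_proj.
- have dO p : Omega p + ext_d alpha p = Omega p +
      ((phi (pr p) - 1) * (Pf (Omega p) / Omega p k l)) *: base_area R i j.
    by rewrite dalpha -kappaE.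
  split.
  + split=> [a b|p a b]; last first.
      by rewrite dalpha; exact: antiE.
    rewrite (_ : (fun p => _) = fun p => Omega p a b +
      ((phi (p *m P) - 1) * kappa) * base_area R i j a b); last first.
      by apply/funext => p; rewrite dalpha prE mxE [in LHS]mxE.
    apply: smoothD; first exact: Osm.
    apply: smoothM; last exact: smooth_cst.
    apply: smoothM; last exact: smooth_cst.
    apply: smoothD; last exact: smooth_cst.
    exact: smooth_comp_linear.
  + by move=> p x y; rewrite dO; apply: (rescaled_J ijkl (OJ p) (JBJB _) (JP p)).
  + move=> p x x0; rewrite dO.
    apply: (rescaled_positive ijkl (Oanti p) (Okl p) (JJ p) (OJ p) (JP p)) => //.
    * exact: expR_gt0.
    * exact: Opos.
- move=> p; rewrite dalpha wedgeE; last exact: antiE.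
  rewrite (pfaffianD ijkl) sigmaE wedgeE// (kappaE p) -mulrA divfK//.
  by rewrite /phi; ring.
Qed.

End InvariantForm.

End LeftInvariantGeometry.

(** * Groups of affine transformations *)

(** The group A provides the inverses: if no transformation group contained S,
    generated S would consist of all maps. *)
Lemma generated_group (R : realType) (S A : set ('rV[R]_4 -> 'rV[R]_4)) :
  transformation_group A -> S `<=` A -> transformation_group (generated S).
Proof.
move=> GA SA; split.
- by move=> G [[]].
- move=> f g Sf Sg G [GG SG]; have [_ Gc _] := GG.
  by apply: Gc; [exact: Sf|exact: Sg].
- move=> f Sf; have [_ _ /(_ f (Sf A (conj GA SA)))[g _ [fK gK]]] := GA.
  exists g => // G [GG SG]; have [_ _ /(_ f (Sf G (conj GG SG)))[h Gh [fh hf]]] := GG.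
  by rewrite (_ : g = h)//; apply/funext => p; rewrite -[p in LHS]hf fK.
Qed.

Section AffineGroup.
Variables (R : realType) (i j k l : 'I_4).
Hypothesis ijkl : uniq [:: i; j; k; l].
Local Notation E := 'rV[R]_4.
Variables (mul : E -> E -> E) (M : E -> 'M[R]_4) (signs : R -> Prop).
Local Notation twist := (@twist R i j k l).
Hypothesis mulE : forall a p, mul a p = a + p *m M a.
Hypothesis MM : forall a p, M (mul a p) = M p *m M a.
Hypothesis MV : forall p, M (- p) *m M p = 1%:M.
Hypothesis signs1 : signs 1.
Hypothesis signsM : forall e e', signs e -> signs e' -> signs (e * e').
Hypothesis signsP : forall e, signs e -> e = 1 \/ e = -1.
Hypothesis Mtwist : forall c e, signs e ->
  M c *m twist e = twist e *m M (c *m twist e).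

(** The left translations composed with the maps twist e, for e in signs. *)
Definition affine_group : set (E -> E) := [set f | exists c e, signs e /\
  forall p, f p = c + p *m (twist e *m M c)].

Let MV' p : M p *m M (- p) = 1%:M.
Proof. exact/mulmx1C/MV. Qed.

Let M0 : M 0 = 1%:M.
Proof.
have H : M 0 *m M 0 = M 0 by rewrite -MM mulE mul0mx addr0.
by rewrite -H -{1}oppr0 MV.
Qed.

Let affine_comp c e c' e' p : signs e ->
  c + (c' + p *m (twist e' *m M c')) *m (twist e *m M c) =
  mul c (c' *m twist e) + p *m (twist (e' * e) *m M (mul c (c' *m twist e))).
Proof.
move=> se; rewrite -(twistM ijkl) MM mulE; have H := Mtwist c' se.
move: (twist e) (twist e') H => X X' H.
by rewrite [(c' + _) *m _]mulmxDl addrA !mulmxA -[p *m X' *m M c' *m X]mulmxA H !mulmxA.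
Qed.

Lemma affine_groupP : transformation_group affine_group.
Proof.
split.
- exists 0, 1; split=> // p.
  by rewrite M0 (twist1 _ ijkl) mulmx1 mulmx1 add0r.
- move=> f f' [c [e [se fE]]] [c' [e' [se' fE']]].
  exists (mul c (c' *m twist e)), (e' * e); split; first exact: signsM.
  by move=> p; rewrite /= fE fE' affine_comp.
- move=> f [c [e [se fE]]].
  have ee : e * e = 1 by case: (signsP se) => ->; rewrite ?mulr1// mulrNN mulr1.
  have tt : twist e *m twist e = 1%:M by rewrite (twistM ijkl) ee (twist1 _ ijkl).
  pose c' := - c *m M (- c) *m twist e.
  pose g p := c' + p *m (twist e *m M c').
  have fg : cancel g f.
    move=> p; rewrite fE /g affine_comp// ee (twist1 _ ijkl).
    have -> : mul c (c' *m twist e) = 0.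
      by rewrite mulE /c' -[_ *m twist e *m twist e]mulmxA tt mulmx1 -mulmxA MV mulmx1 subrr.
    by rewrite M0 mulmx1 mulmx1 add0r.
  exists g; first by exists c', e.
  split=> // p; have finj x y : f x = f y -> x = y.
    rewrite !fE => /addrI/(congr1 (fun z => z *m (M (- c) *m twist e))).
    have one : twist e *m M c *m (M (- c) *m twist e) = 1%:M.
      by rewrite mulmxA -[twist e *m M c *m _]mulmxA MV' mulmx1.
    by rewrite -!mulmxA [twist e *m (M c *m _)]mulmxA one !mulmx1.
  by apply: finj; rewrite fg.
Qed.

Lemma generated_affine (S : set (E -> E)) : S `<=` affine_group ->
  generated S `<=` affine_group.
Proof.
by move=> SA f; apply; split=> //; exact: affine_groupP.
Qed.

Lemma mul_assoc a b p : mul a (mul b p) = mul (mul a b) p.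
Proof.
by rewrite [LHS]mulE [mul b p]mulE [RHS]mulE MM [mul a b]mulE mulmxDl addrA mulmxA.
Qed.

Lemma left_translations_group (H : set E) : is_subgroup mul H ->
  transformation_group (left_translations mul H).
Proof.
have mul0p p : mul 0 p = p by rewrite mulE M0 mulmx1 add0r.
have mulp0 p : mul p 0 = p by rewrite mulE mul0mx addr0.
move=> [H0 HM HV]; split.
- by exists 0 => //; apply/funext => p; rewrite mul0p.
- move=> f g [a Ha <-] [b Hb <-]; exists (mul a b); first exact: HM.
  by apply/funext => p; rewrite /= mul_assoc.
- move=> f [a Ha <-]; have [b Hb ab] := HV a Ha; have [c Hc bc] := HV b Hb.
  have ac : a = c by rewrite -[a]mulp0 -bc mul_assoc ab mul0p.
  exists (mul b); first by exists b.
  by split=> p; rewrite mul_assoc ?ab ?ac ?bc mul0p.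
Qed.

Lemma left_translations_affine (H : set E) :
  left_translations mul H `<=` affine_group.
Proof.
by move=> f [a Ha <-]; exists a, 1; split=> // p; rewrite mulE (twist1 _ ijkl) mul1mx.
Qed.

End AffineGroup.

(** * The three groups *)

Section FourCoordinates.
Variable R : realType.
Local Notation E := 'rV[R]_4.
Local Notation ox := (inord 0 : 'I_4).
Local Notation oy := (inord 1 : 'I_4).
Local Notation oz := (inord 2 : 'I_4).
Local Notation ot := (inord 3 : 'I_4).

Lemma uniq_xyzt : uniq [:: ox; oy; oz; ot].
Proof. by rewrite -(map_inj_uniq val_inj) /= !inordK. Qed.

Lemma uniq_ytxz : uniq [:: oy; ot; ox; oz].
Proof. by rewrite -(map_inj_uniq val_inj) /= !inordK. Qed.

Lemma uniq_ztxy : uniq [:: oz; ot; ox; oy].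
Proof. by rewrite -(map_inj_uniq val_inj) /= !inordK. Qed.

Lemma ptP (p q : E) : cx p = cx q -> cy p = cy q -> cz p = cz q -> ct p = ct q ->
  p = q.
Proof. by move=> h1 h2 h3 h4; rewrite -(ptE p) -(ptE q) h1 h2 h3 h4. Qed.

Lemma coordD (p q : E) : (cx (p + q) = cx p + cx q) * (cy (p + q) = cy p + cy q) *
  (cz (p + q) = cz p + cz q) * (ct (p + q) = ct p + ct q).
Proof. by rewrite /cx /cy /cz /ct !mxE. Qed.

Lemma coordN (p : E) : (cx (- p) = - cx p) * (cy (- p) = - cy p) *
  (cz (- p) = - cz p) * (ct (- p) = - ct p).
Proof. by rewrite /cx /cy /cz /ct !mxE. Qed.

Lemma coordM (p : E) (A : 'M[R]_4) a : (p *m A) 0 a =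
  cx p * A ox a + cy p * A oy a + cz p * A oz a + ct p * A ot a.
Proof. by rewrite mxE (sum4 uniq_xyzt). Qed.

Lemma wedge_self (X : 'M[R]_4) : wedge X X =
  2 * (X ox oy * X oz ot - X ox oz * X oy ot + X ox ot * X oy oz).
Proof. by rewrite /wedge /entry; ring. Qed.

(** The differential at the identity of left translation by p in each of the
    three groups. *)
Definition nil3_frame (p : E) : 'M[R]_4 := 1%:M + cx p *: delta_mx oy oz.

Definition nil4_frame (p : E) : 'M[R]_4 := 1%:M + ct p *: delta_mx oy ox
  + (2^-1 * ct p ^+ 2) *: delta_mx oz ox + ct p *: delta_mx oz oy.

Definition sol3_frame (p : E) : 'M[R]_4 := expR (ct p) *: delta_mx ox ox
  + expR (- ct p) *: delta_mx oy oy + 1 *: (delta_mx oz oz + delta_mx ot ot).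

Lemma smooth_cx : smooth (@cx R). Proof. exact: smooth_coord. Qed.
Lemma smooth_ct : smooth (@ct R). Proof. exact: smooth_coord. Qed.

Lemma nil3_frame_smooth : smooth_mx nil3_frame.
Proof.
by apply: smooth_mxD; [exact: smooth_mx_cst|apply: smooth_mxZ; exact: smooth_cx].
Qed.

Lemma nil4_frame_smooth : smooth_mx nil4_frame.
Proof.
apply: smooth_mxD; last by apply: smooth_mxZ; exact: smooth_ct.
apply: smooth_mxD; last first.
  apply: smooth_mxZ; apply: smoothM; first exact: smooth_cst.
  rewrite (_ : (fun p => _) = fun p : E => ct p * ct p).
    by apply: smoothM; exact: smooth_ct.
  by apply/funext => p; rewrite expr2.
by apply: smooth_mxD; [exact: smooth_mx_cst|apply: smooth_mxZ; exact: smooth_ct].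
Qed.

Lemma sol3_frame_smooth : smooth_mx sol3_frame.
Proof.
apply: smooth_mxD; last exact: smooth_mx_cst.
apply: smooth_mxD; apply: smooth_mxZ; apply: smooth_expR; first exact: smooth_ct.
by apply: smoothN; exact: smooth_ct.
Qed.

Local Notation entries := (mxE, eqxx, neq4 uniq_xyzt, mulr0n, mulr1n).
Local Notation unit_simp := (mulr0, mul0r, mulr1, mul1r, addr0, add0r).

Lemma nil3R_mulE a p : nil3R_mul a p = a + p *m nil3_frame a.
Proof.
apply: ptP; rewrite ?cxE ?cyE ?czE ?ctE coordD /cx /cy /cz /ct ?coordM !entries /=;
  by rewrite /cx /cy /cz /ct; ring.
Qed.

Lemma nil4_mulE a p : nil4_mul a p = a + p *m nil4_frame a.
Proof.
apply: ptP; rewrite ?cxE ?cyE ?czE ?ctE coordD /cx /cy /cz /ct ?coordM !entries /=;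
  by rewrite /cx /cy /cz /ct; ring.
Qed.

Lemma sol3R_mulE a p : sol3R_mul a p = a + p *m sol3_frame a.
Proof.
apply: ptP; rewrite ?cxE ?cyE ?czE ?ctE coordD /cx /cy /cz /ct ?coordM !entries /=;
  by rewrite /cx /cy /cz /ct; ring.
Qed.

Local Notation delta_simp := (mulmxDl, mulmxDr, mul1mx, mulmx1, mul_delta_mx_cond,
  eqxx, neq4 uniq_xyzt, mulr0n, mulr1n, scaler0, addr0, add0r).

Lemma nil3_frameM a p : nil3_frame (nil3R_mul a p) = nil3_frame p *m nil3_frame a.
Proof.
rewrite /nil3_frame cxE; move: (cx a) (cx p) => s t.
rewrite !(mulmxDl, mulmxDr, mul1mx, mulmx1) -!(scalemxAl, scalemxAr) !delta_simp.
by rewrite scalerDl addrA.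
Qed.

Lemma nil4_frameM a p : nil4_frame (nil4_mul a p) = nil4_frame p *m nil4_frame a.
Proof.
rewrite /nil4_frame ctE; move: (ct a) (ct p) => s t.
rewrite !(mulmxDl, mulmxDr, mul1mx, mulmx1) -!(scalemxAl, scalemxAr) !delta_simp.
move: (delta_mx oy ox) (delta_mx oz ox) (delta_mx oz oy) 1%:M => X Y Z I.
apply/matrixP => b c; rewrite !mxE; move: (X b c) (Y b c) (Z b c) (I b c) => x y z w.
by field.
Qed.

Lemma sol3_frameM a p : sol3_frame (sol3R_mul a p) = sol3_frame p *m sol3_frame a.
Proof.
rewrite /sol3_frame ctE opprD !expRD.
move: (expR (ct a)) (expR (ct p)) (expR (- ct a)) (expR (- ct p)) => s t s' t'.
rewrite !(mulmxDl, mulmxDr) -!(scalemxAl, scalemxAr) !delta_simp !scalerA !mulr1.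
by rewrite [s * t]mulrC [s' * t']mulrC.
Qed.

Lemma nil3_frameV p : nil3_frame (- p) *m nil3_frame p = 1%:M.
Proof.
rewrite -nil3_frameM /nil3_frame cxE coordN subrr.
by rewrite scale0r addr0.
Qed.

Lemma nil4_frameV p : nil4_frame (- p) *m nil4_frame p = 1%:M.
Proof.
rewrite -nil4_frameM /nil4_frame ctE coordN subrr.
by rewrite expr0n /= mulr0 !scale0r !addr0.
Qed.

Lemma sol3_frame1 : expR 0 *: delta_mx ox ox + expR (- 0) *: delta_mx oy oy
  + 1 *: (delta_mx oz oz + delta_mx ot ot) = 1%:M :> 'M[R]_4.
Proof.
rewrite oppr0 expR0 !scale1r.
apply/matrixP; apply: (ind4 uniq_xyzt) => [||| ]; apply: (ind4 uniq_xyzt);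
  by rewrite !entries /=; ring.
Qed.

Lemma sol3_frameV p : sol3_frame (- p) *m sol3_frame p = 1%:M.
Proof. by rewrite -sol3_frameM /sol3_frame ctE coordN subrr sol3_frame1. Qed.

Lemma nil3_fibred_xy p : fibred ox oy oz ot (nil3_frame p).
Proof.
split; last by rewrite !entries /=; ring.
- by apply: (ind4 uniq_xyzt); rewrite !entries /=; ring.
- by apply: (ind4 uniq_xyzt); rewrite !entries /=; ring.
Qed.

Lemma nil3_fibred_yt p : fibred oy ot ox oz (nil3_frame p).
Proof.
split; last by rewrite !entries /=; ring.
- by apply: (ind4 uniq_xyzt); rewrite !entries /=; ring.
- by apply: (ind4 uniq_xyzt); rewrite !entries /=; ring.
Qed.

Lemma nil4_fibred p : fibred oz ot ox oy (nil4_frame p).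
Proof.
split; last by rewrite !entries /=; ring.
- by apply: (ind4 uniq_xyzt); rewrite !entries /=; ring.
- by apply: (ind4 uniq_xyzt); rewrite !entries /=; ring.
Qed.

Lemma sol3_fibred p : fibred oz ot ox oy (sol3_frame p).
Proof.
have e1 : expR (ct p) * expR (- ct p) = 1 by rewrite -expRD subrr expR0.
split; last by rewrite !entries /= !unit_simp e1; ring.
- by apply: (ind4 uniq_xyzt); rewrite !entries /=; ring.
- by apply: (ind4 uniq_xyzt); rewrite !entries /=; ring.
Qed.

End FourCoordinates.

(** The group law mul on R^4 has left translations with differentials M a, the
    map pr is the projection to the coordinates i and j, and multiplication of
    the fibre coordinates k and l by elements of signs is an automorphism.  The
    constant eps relates the square of a 2-form to its Pfaffian with respect to
    i, j, k, l; left translations, reflections and the right translations that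
    lift translations of the base preserve the Lebesgue measure. *)
Record fibred_model (R : realType) (i j k l : 'I_4)
    (mul : 'rV[R]_4 -> 'rV[R]_4 -> 'rV[R]_4) (pr : 'rV[R]_4 -> 'rV[R]_2)
    (M : 'rV[R]_4 -> 'M[R]_4) (signs : R -> Prop) (eps : R) : Prop := {
  model_uniq : uniq [:: i; j; k; l];
  model_pr : forall p, pr p = p *m base_proj R i j;
  model_mul : forall a p, mul a p = a + p *m M a;
  model_MM : forall a p, M (mul a p) = M p *m M a;
  model_MV : forall p, M (- p) *m M p = 1%:M;
  model_smooth : smooth_mx M;
  model_fibred : forall a, fibred i j k l (M a);
  model_signs1 : signs 1;
  model_signsM : forall e e', signs e -> signs e' -> signs (e * e');
  model_signsP : forall e, signs e -> e = 1 \/ e = -1;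
  model_twist : forall c e, signs e -> M c *m @twist R i j k l e =
    @twist R i j k l e *m M (c *m @twist R i j k l e);
  model_eps : eps != 0;
  model_wedge : forall X : 'M[R]_4, (forall a b, X a b = - X b a) ->
    wedge X X = eps * pfaffian i j k l X;
  model_vol : forall c e, signs e ->
    volume_preserving (fun p => c + p *m (@twist R i j k l e *m M c));
  model_right_vol : forall v : 'rV[R]_2,
    volume_preserving (fun p => p + v *m (base_proj R i j)^T *m M p)
}.

(** Gamma is a group of transformations, each of them a multiplication of the
    fibre coordinates by an element of signs followed by a left translation. *)
Definition affine_action (R : realType) (i j k l : 'I_4) (M : 'rV[R]_4 -> 'M[R]_4)
    (signs : R -> Prop) (Gamma : set ('rV[R]_4 -> 'rV[R]_4)) : Prop :=
  transformation_group Gamma /\ Gamma `<=` affine_group i j k l M signs.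

Theorem model_calabi_yau (R : realType) (i j k l : 'I_4)
    (mul : 'rV[R]_4 -> 'rV[R]_4 -> 'rV[R]_4)
    (Gamma : set ('rV[R]_4 -> 'rV[R]_4)) (pr : 'rV[R]_4 -> 'rV[R]_2)
    (M : 'rV[R]_4 -> 'M[R]_4) (signs : R -> Prop) (eps : R)
    (Omega : 'rV[R]_4 -> 'M[R]_4) :
  fibred_model i j k l mul pr M signs eps ->
  affine_action i j k l M signs Gamma ->
  acts_freely Gamma ->
  acts_properly_discontinuously Gamma ->
  acts_cocompactly Gamma ->
  torus_bundle Gamma pr ->
  symplectic Omega ->
  invariant_form mul Gamma Omega ->
  nonzero_on_fibres pr Omega ->
  (exists g J : 'rV[R]_4 -> 'M[R]_4,
     invariant_almost_kahler mul Gamma g J Omega /\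
     J_holomorphic Gamma pr J) /\
  (forall g J : 'rV[R]_4 -> 'M[R]_4,
     invariant_almost_kahler mul Gamma g J Omega ->
     J_holomorphic Gamma pr J ->
     forall (F : 'rV[R]_2 -> R) (sigma : 'rV[R]_4 -> R) (D : set 'rV[R]_4),
       smooth F ->
       base_periodic (base_lattice Gamma pr) F ->
       (forall p, sigma p = expR (F (pr p)) * wedge (Omega p) (Omega p)) ->
       fundamental_domain Gamma D ->
       integral_over D sigma
         = integral_over D (fun p => wedge (Omega p) (Omega p)) ->
       exists alpha : 'rV[R]_4 -> 'rV[R]_4,
         [/\ smooth_mx alpha,
             forall f, Gamma f -> preserves_1form f alpha,
             positive_11 J (fun p => Omega p + ext_d alpha p) &
             forall p, wedge (Omega p + ext_d alpha p)
                             (Omega p + ext_d alpha p) = sigma p]).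
Proof.
move=> [U Epr Emul EMM EMV Esm Efib Es1 EsM EsP Etw Eeps Ewedge Evol Ervol].
move=> [GG GA] Gfree Gpd Gcc Gbundle [W2 Ocl Ond] Oinv Ofib.
have Oanti : forall p a b, Omega p a b = - Omega p b a by case: W2.
split.
  exact: (invariant_almost_kahler_exists U Epr Emul EMM EMV Esm Efib EsP Etw GA
    Oanti Oinv Ond Ofib W2 Ocl).
move=> g J.
exact: (calabi_yau_solvable U Epr Emul EMM Efib Etw GA Oanti
  Oinv Ond Ofib Eeps Ewedge GG Gfree Gpd Gcc Gbundle Evol Ervol).
Qed.

Section AffineActions.
Variables (R : realType) (i j k l : 'I_4).
Variables (mul : 'rV[R]_4 -> 'rV[R]_4 -> 'rV[R]_4) (pr : 'rV[R]_4 -> 'rV[R]_2).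
Variables (M : 'rV[R]_4 -> 'M[R]_4) (signs : R -> Prop) (eps : R).
Hypothesis model : fibred_model i j k l mul pr M signs eps.

Lemma generated_affine_action (S : set ('rV[R]_4 -> 'rV[R]_4)) :
  S `<=` affine_group i j k l M signs ->
  affine_action i j k l M signs (generated S).
Proof.
case: model => U _ Emul EMM EMV _ _ Es1 EsM EsP Etw _ _ _ _ SA.
have GA := affine_groupP U Emul EMM EMV Es1 EsM EsP Etw.
split; first exact: generated_group GA SA.
exact: (generated_affine U Emul EMM EMV Es1 EsM EsP Etw SA).
Qed.

Lemma left_translations_affine_action (H : set 'rV[R]_4) : is_subgroup mul H ->
  affine_action i j k l M signs (left_translations mul H).
Proof.
case: model => U _ Emul EMM EMV _ _ Es1 _ _ _ _ _ _ _ HH.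
split; first exact: (left_translations_group Emul EMM EMV HH).
exact: left_translations_affine.
Qed.

End AffineActions.

Section Models.
Variable R : realType.
Local Notation E := 'rV[R]_4.
Local Notation ox := (inord 0 : 'I_4).
Local Notation oy := (inord 1 : 'I_4).
Local Notation oz := (inord 2 : 'I_4).
Local Notation ot := (inord 3 : 'I_4).
Local Notation M1 := (measurableTypeR R).
Local Notation M2 := (M1 * M1)%type.
Local Notation entries := (mxE, eqxx, neq4 uniq_xyzt, mulr0n, mulr1n).

(** The signs when no reflections are allowed. *)
Definition plus_one (e : R) : Prop := e = 1.

(** The signs when reflections are allowed. *)
Definition plus_minus_one (e : R) : Prop := e = 1 \/ e = -1.

Lemma plus_minus_oneM e e' : plus_minus_one e -> plus_minus_one e' ->
  plus_minus_one (e * e').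
Proof.
by rewrite /plus_minus_one => -[] -> [] ->; rewrite ?mulr1 ?mul1r ?mulrNN ?mulr1; auto.
Qed.

Lemma plus_oneM e e' : plus_one e -> plus_one e' -> plus_one (e * e').
Proof. by rewrite /plus_one => -> ->; rewrite mulr1. Qed.

Lemma twist_ytE (p : E) e :
  p *m twist oy ot ox oz e = pt (e * cx p) (cy p) (e * cz p) (ct p).
Proof.
apply: ptP; rewrite ?cxE ?cyE ?czE ?ctE /cx /cy /cz /ct coordM !entries /=;
  by rewrite /cx /cy /cz /ct; ring.
Qed.

Lemma twist_ztE (p : E) e :
  p *m twist oz ot ox oy e = pt (e * cx p) (e * cy p) (cz p) (ct p).
Proof.
apply: ptP; rewrite ?cxE ?cyE ?czE ?ctE /cx /cy /cz /ct coordM !entries /=;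
  by rewrite /cx /cy /cz /ct; ring.
Qed.

Lemma base_proj_trE (v : 'rV[R]_2) i j a : (v *m (base_proj R i j)^T) 0 a =
  v 0 0 * (a == i)%:R + v 0 1 * (a == j)%:R.
Proof. by rewrite mxE sum2 !mxE. Qed.

Lemma base_xy_trE (v : 'rV[R]_2) :
  v *m (base_proj R ox oy)^T = pt (v 0 0) (v 0 1) 0 0.
Proof.
by apply: ptP; rewrite ?cxE ?cyE ?czE ?ctE /cx /cy /cz /ct base_proj_trE
  ?eqxx !(neq4 uniq_xyzt) /=; ring.
Qed.

Lemma base_yt_trE (v : 'rV[R]_2) :
  v *m (base_proj R oy ot)^T = pt 0 (v 0 0) 0 (v 0 1).
Proof.
by apply: ptP; rewrite ?cxE ?cyE ?czE ?ctE /cx /cy /cz /ct base_proj_trE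
  ?eqxx !(neq4 uniq_xyzt) /=; ring.
Qed.

Lemma base_zt_trE (v : 'rV[R]_2) :
  v *m (base_proj R oz ot)^T = pt 0 0 (v 0 0) (v 0 1).
Proof.
by apply: ptP; rewrite ?cxE ?cyE ?czE ?ctE /cx /cy /cz /ct base_proj_trE
  ?eqxx !(neq4 uniq_xyzt) /=; ring.
Qed.

(** The criterion fits maps in which x and y are changed separately and z
    receives a function of x and y. *)
Lemma volume_zt (f : E -> E) s1 s2 s3 s4 c1 c2 (phi : M2 -> R) c4 :
  (forall x y z t, f (pt x y z t) = pt (s1 * x + c1) (s2 * y + c2)
     (s3 * z + phi (x, y)) (s4 * t + c4)) ->
  measurable_fun setT phi ->
  s1 != 0 -> s2 != 0 -> s3 != 0 -> s4 != 0 ->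
  `|s1|^-1 * `|s2|^-1 * (`|s3|^-1 * `|s4|^-1) = 1 -> volume_preserving f.
Proof.
move=> fE mphi s10 s20 s30 s40 s1234; rewrite /volume_preserving.
have := @triangular_zt R s1 s2 s3 s4 c1 c2 phi c4 s10 s20 s30 s40 mphi.
rewrite s1234; congr scales_measure.
apply/funext => -[[x y] [z t]]; rewrite /of_pairs /= fE /to_pairs.
by rewrite cxE cyE czE ctE.
Qed.

(** The criterion fits maps in which z and t are changed separately, y receives
    a function of z and t, and x a function of the other three. *)
Lemma volume_xy (f : E -> E) s1 s2 s3 s4 (phi : M1 * M2 -> R) (chi : M2 -> R) c3 c4 :
  (forall x y z t, f (pt x y z t) = pt (s1 * x + phi (y, (z, t))) (s2 * y + chi (z, t))
     (s3 * z + c3) (s4 * t + c4)) ->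
  measurable_fun setT phi -> measurable_fun setT chi ->
  s1 != 0 -> s2 != 0 -> s3 != 0 -> s4 != 0 ->
  `|s3|^-1 * `|s4|^-1 * (`|s1|^-1 * `|s2|^-1) = 1 -> volume_preserving f.
Proof.
move=> fE mphi mchi s10 s20 s30 s40 s1234; rewrite /volume_preserving.
have := @triangular_xy R s1 s2 s3 s4 phi chi c3 c4 s10 s20 s30 s40 mphi mchi.
rewrite s1234; congr scales_measure.
apply/funext => -[[x y] [z t]]; rewrite /of_pairs /= fE /to_pairs.
by rewrite cxE cyE czE ctE.
Qed.

Let norm1 (e : R) : plus_minus_one e -> `|e| = 1 /\ e != 0.
Proof. by case=> ->; rewrite ?normrN normr1 ?oppr_eq0 oner_eq0. Qed.

Let two_neq0 : 2 != 0 :> R. Proof. by rewrite pnatr_eq0. Qed.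

Lemma nil3_xy_model : fibred_model ox oy oz ot (@nil3R_mul R) (@proj_xy R)
  (@nil3_frame R) plus_one 2.
Proof.
have U := uniq_xyzt.
split=> //.
- by move=> p; rewrite (base_projE U).
- exact: nil3R_mulE.
- exact: nil3_frameM.
- exact: nil3_frameV.
- exact: nil3_frame_smooth.
- exact: nil3_fibred_xy.
- exact: plus_oneM.
- by move=> e ->; left.
- by move=> c e ->; rewrite (twist1 _ U) !mulmx1 mul1mx.
- by move=> X _; rewrite wedge_self.
- move=> c e ->; rewrite (twist1 _ U) mul1mx.
  apply: (@volume_zt _ 1 1 1 1 (cx c) (cy c) (fun u => cx c * u.2 + cz c) (ct c));
    rewrite ?oner_eq0 ?normr1 ?invr1 ?mulr1//.
    move=> x y z t; rewrite -nil3R_mulE /nil3R_mul cxE cyE czE ctE /=.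
    by congr pt; ring.
  by apply: measurable_funD => //; apply: measurable_funM => //; exact: measurable_snd.
- move=> v.
  apply: (@volume_zt _ 1 1 1 1 (v 0 0) (v 0 1) (fun u => u.1 * v 0 1) 0);
    rewrite ?oner_eq0 ?normr1 ?invr1 ?mulr1//.
    move=> x y z t; rewrite -nil3R_mulE base_xy_trE /nil3R_mul !(cxE, cyE, czE, ctE) /=.
    by congr pt; ring.
  by apply: measurable_funM => //; exact: measurable_fst.
Qed.

Lemma nil3_yt_model : fibred_model oy ot ox oz (@nil3R_mul R) (@proj_yt R)
  (@nil3_frame R) plus_minus_one (- 2).
Proof.
have U := uniq_ytxz.
split=> //.
- by move=> p; rewrite (base_projE U).
- exact: nil3R_mulE.
- exact: nil3_frameM.
- exact: nil3_frameV.
- exact: nil3_frame_smooth.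
- exact: nil3_fibred_yt.
- by left.
- exact: plus_minus_oneM.
- move=> c e _; rewrite twist_ytE /nil3_frame cxE mulmxDl mulmxDr mul1mx mulmx1.
  congr (_ + _); rewrite -scalemxAl -scalemxAr /twist !(mulmxDl, mulmxDr).
  rewrite -!(scalemxAl, scalemxAr).
  rewrite !(mulmxDl, mulmxDr, mul_delta_mx_cond, eqxx, neq4 U, mulr0n, mulr1n,
    scaler0, addr0, add0r) !scalerA.
  by congr (_ *: _); ring.
- move=> X Xanti; rewrite wedge_self /pfaffian (Xanti oy ox) (Xanti ot oz) (Xanti ot ox).
  by ring.
- move=> c e /norm1[e1 e0].
  apply: (@volume_zt _ e 1 e 1 (cx c) (cy c) (fun u => cx c * u.2 + cz c) (ct c));
    rewrite ?oner_eq0 ?e1 ?normr1 ?invr1 ?mulr1//.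
    move=> x y z t; rewrite mulmxA -nil3R_mulE twist_ytE /nil3R_mul !(cxE, cyE, czE, ctE) /=.
    by congr pt; ring.
  by apply: measurable_funD => //; apply: measurable_funM => //; exact: measurable_snd.
- move=> v.
  apply: (@volume_zt _ 1 1 1 1 0 (v 0 0) (fun u => u.1 * v 0 0) (v 0 1));
    rewrite ?oner_eq0 ?normr1 ?invr1 ?mulr1//.
    move=> x y z t; rewrite -nil3R_mulE base_yt_trE /nil3R_mul !(cxE, cyE, czE, ctE) /=.
    by congr pt; ring.
  by apply: measurable_funM => //; exact: measurable_fst.
Qed.

Let measurable_t : measurable_fun setT (fun u : M1 * M2 => u.2.2 : M1).
Proof. exact: (measurableT_comp measurable_snd measurable_snd). Qed.

Let measurable_z : measurable_fun setT (fun u : M1 * M2 => u.2.1 : M1).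
Proof. exact: (measurableT_comp measurable_fst measurable_snd). Qed.

Lemma nil4_zt_model : fibred_model oz ot ox oy (@nil4_mul R) (@proj_zt R)
  (@nil4_frame R) plus_one 2.
Proof.
have U := uniq_ztxy.
split=> //.
- by move=> p; rewrite (base_projE U).
- exact: nil4_mulE.
- exact: nil4_frameM.
- exact: nil4_frameV.
- exact: nil4_frame_smooth.
- exact: nil4_fibred.
- exact: plus_oneM.
- by move=> e ->; left.
- by move=> c e ->; rewrite (twist1 _ U) !mulmx1 mul1mx.
- move=> X Xanti; rewrite wedge_self /pfaffian (Xanti oz ox) (Xanti ot oy)
    (Xanti oz oy) (Xanti ot ox).
  by ring.
- move=> c e ->; rewrite (twist1 _ U) mul1mx.
  apply: (@volume_xy _ 1 1 1 1
    (fun u => ct c * u.1 + (2^-1 * ct c ^+ 2 * u.2.1 + cx c))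
    (fun u => ct c * u.1 + cy c) (cz c) (ct c));
    rewrite ?oner_eq0 ?normr1 ?invr1 ?mulr1//.
  + move=> x y z t; rewrite -nil4_mulE /nil4_mul cxE cyE czE ctE /=.
    by congr pt; ring.
  + apply: measurable_funD; first by apply: measurable_funM => //; exact: measurable_fst.
    by apply: measurable_funD => //; apply: measurable_funM.
  + by apply: measurable_funD => //; apply: measurable_funM => //; exact: measurable_fst.
- move=> v.
  apply: (@volume_xy _ 1 1 1 1
    (fun u => 2^-1 * u.2.2 ^+ 2 * v 0 0)
    (fun u => u.2 * v 0 0) (v 0 0) (v 0 1));
    rewrite ?oner_eq0 ?normr1 ?invr1 ?mulr1//.
  + move=> x y z t; rewrite -nil4_mulE base_zt_trE /nil4_mul !(cxE, cyE, czE, ctE) /=.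
    by congr pt; ring.
  + apply: measurable_funM => //; apply: measurable_funM => //.
    exact: measurable_funX.
  + by apply: measurable_funM => //; exact: measurable_snd.
Qed.

Lemma sol3_zt_model : fibred_model oz ot ox oy (@sol3R_mul R) (@proj_zt R)
  (@sol3_frame R) plus_minus_one 2.
Proof.
have U := uniq_ztxy.
split=> //.
- by move=> p; rewrite (base_projE U).
- exact: sol3R_mulE.
- exact: sol3_frameM.
- exact: sol3_frameV.
- exact: sol3_frame_smooth.
- exact: sol3_fibred.
- by left.
- exact: plus_minus_oneM.
- move=> c e _; rewrite twist_ztE /sol3_frame ctE /twist.
  move: (expR _) (expR _) => a b.
  rewrite !(mulmxDl, mulmxDr) -!(scalemxAl, scalemxAr).
  rewrite !(mulmxDl, mulmxDr, mul_delta_mx_cond, eqxx, neq4 U, mulr0n, mulr1n,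
    scaler0, addr0, add0r) !scalerA.
  by rewrite [a * e]mulrC [b * e]mulrC addrC !mul1r.
- move=> X Xanti; rewrite wedge_self /pfaffian (Xanti oz ox) (Xanti ot oy)
    (Xanti oz oy) (Xanti ot ox).
  by ring.
- move=> c e /norm1[e1 e0].
  apply: (@volume_xy _ (expR (ct c) * e) (expR (- ct c) * e) 1 1
    (fun=> cx c) (fun=> cy c) (cz c) (ct c)) => //;
    rewrite ?oner_eq0 ?(mulf_neq0 _ e0) ?gt_eqF ?expR_gt0//.
  + move=> x y z t; rewrite mulmxA -sol3R_mulE twist_ztE /sol3R_mul !(cxE, cyE, czE, ctE) /=.
    by congr pt; ring.
  + rewrite !normrM e1 !mulr1 normr1 invr1 !mul1r !ger0_norm ?expR_ge0//.
    by rewrite -invfM -expRD subrr expR0 invr1.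
- move=> v.
  apply: (@volume_xy _ 1 1 1 1 (fun=> 0) (fun=> 0) (v 0 0) (v 0 1));
    rewrite ?oner_eq0 ?normr1 ?invr1 ?mulr1//.
  move=> x y z t; rewrite -sol3R_mulE base_zt_trE /sol3R_mul !(cxE, cyE, czE, ctE) /=.
  by congr pt; ring.
Qed.

End Models.

(** * The families of discrete groups *)

Section Families.
Variable R : realType.
Local Notation E := 'rV[R]_4.
Local Notation ox := (inord 0 : 'I_4).
Local Notation oy := (inord 1 : 'I_4).
Local Notation oz := (inord 2 : 'I_4).
Local Notation ot := (inord 3 : 'I_4).

(* Each generator is the multiplication of the fibre coordinates by a sign e
   followed by the left translation by c; c is the image of 0. *)
Let affine_nil3 signs (f : E -> E) c e : signs e ->
  (forall p, f p = pt (cx c + e * cx p) (cy c + cy p)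
     (cz c + e * cz p + cx c * cy p) (ct c + ct p)) ->
  affine_group oy ot ox oz (@nil3_frame R) signs f.
Proof.
move=> se fE; exists c, e; split=> // p.
rewrite mulmxA -nil3R_mulE twist_ytE /nil3R_mul !(cxE, cyE, czE, ctE).
exact: fE.
Qed.

Let affine_nil3_xy (f : E -> E) c :
  (forall p, f p = nil3R_mul c p) ->
  affine_group ox oy oz ot (@nil3_frame R) (@plus_one R) f.
Proof.
move=> fE; exists c, 1; split=> // p.
by rewrite (twist1 _ uniq_xyzt) mul1mx -nil3R_mulE.
Qed.

Let affine_sol3 (f : E -> E) c e : plus_minus_one e ->
  (forall p, f p = pt (cx c + expR (ct c) * (e * cx p))
     (cy c + expR (- ct c) * (e * cy p)) (cz c + cz p) (ct c + ct p)) ->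
  affine_group oz ot ox oy (@sol3_frame R) (@plus_minus_one R) f.
Proof.
move=> se fE; exists c, e; split=> // p.
rewrite mulmxA -sol3R_mulE twist_ztE /sol3R_mul !(cxE, cyE, czE, ctE).
exact: fE.
Qed.

Local Ltac coordinates :=
  let p := fresh "p" in
  move=> p; rewrite /on_coords /nil3R_mul !(cxE, cyE, czE, ctE);
  rewrite ?oppr0 ?expR0; congr pt; ring.

Let plus : plus_minus_one (1 : R). Proof. by left. Qed.
Let minus : plus_minus_one (- 1 : R). Proof. by right. Qed.

Lemma Gamma1a_xy_affine_action (n : int) :
  affine_action ox oy oz ot (@nil3_frame R) (@plus_one R) (@Gamma1a R n).
Proof.
apply: (generated_affine_action (nil3_xy_model R)).
move=> f [[[|]|]|] ->.
- by apply: (@affine_nil3_xy _ (pt 1 0 0 0)); coordinates.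
- by apply: (@affine_nil3_xy _ (pt 0 1 0 0)); coordinates.
- by apply: (@affine_nil3_xy _ (pt 0 0 (1 / n%:~R) 0)); coordinates.
- by apply: (@affine_nil3_xy _ (pt 0 0 0 1)); coordinates.
Qed.

Lemma Gamma1a_yt_affine_action (n : int) :
  affine_action oy ot ox oz (@nil3_frame R) (@plus_minus_one R) (@Gamma1a R n).
Proof.
apply: (generated_affine_action (nil3_yt_model R)).
move=> f [[[|]|]|] ->.
- by apply: (@affine_nil3 _ _ (pt 1 0 0 0) 1 plus); coordinates.
- by apply: (@affine_nil3 _ _ (pt 0 1 0 0) 1 plus); coordinates.
- by apply: (@affine_nil3 _ _ (pt 0 0 (1 / n%:~R) 0) 1 plus); coordinates.
- by apply: (@affine_nil3 _ _ (pt 0 0 0 1) 1 plus); coordinates.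
Qed.

Lemma Gamma1b_affine_action (a1 a2 b1 b2 c3 : R) :
  affine_action oy ot ox oz (@nil3_frame R) (@plus_minus_one R)
    (Gamma1b a1 a2 b1 b2 c3).
Proof.
apply: (generated_affine_action (nil3_yt_model R)).
move=> f [[[|]|]|] ->.
- by apply: (@affine_nil3 _ _ (pt 0 0 b1 0) 1 plus); coordinates.
- by apply: (@affine_nil3 _ _ (pt a1 0 0 0) 1 plus); coordinates.
- by apply: (@affine_nil3 _ _ (pt a2 0 b2 1) 1 plus); coordinates.
- by apply: (@affine_nil3 _ _ (pt 0 1 c3 0) (- 1) minus); coordinates.
Qed.

Lemma Gamma1c_affine_action (a1 a3 b1 b4 : R) :
  affine_action oy ot ox oz (@nil3_frame R) (@plus_minus_one R)
    (Gamma1c a1 a3 b1 b4).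
Proof.
apply: (generated_affine_action (nil3_yt_model R)).
move=> f [[[|]|]|] ->.
- by apply: (@affine_nil3 _ _ (pt 0 0 b1 0) 1 plus); coordinates.
- by apply: (@affine_nil3 _ _ (pt a1 0 0 0) 1 plus); coordinates.
- by apply: (@affine_nil3 _ _ (pt a3 1 b4 0) 1 plus); coordinates.
- by apply: (@affine_nil3 _ _ (pt 0 0 0 1) (- 1) minus); coordinates.
Qed.

Lemma Gamma3a_affine_action (a1 a2 a3 a4 b1 b2 b3 b4 e d : R) : plus_minus_one e ->
  affine_action oz ot ox oy (@sol3_frame R) (@plus_minus_one R)
    (Gamma3a a1 a2 a3 a4 b1 b2 b3 b4 e d).
Proof.
move=> se; apply: (generated_affine_action (sol3_zt_model R)).
move=> f [[[|]|]|] ->.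
- by apply: (@affine_sol3 _ (pt a1 b1 0 0) 1 plus); coordinates.
- by apply: (@affine_sol3 _ (pt a2 b2 0 0) 1 plus); coordinates.
- by apply: (@affine_sol3 _ (pt a3 b3 1 0) 1 plus); coordinates.
- by apply: (@affine_sol3 _ (pt a4 b4 0 d) e se); coordinates.
Qed.

Lemma Gamma3b_affine_action (a1 a2 a3 a4 b1 b2 b3 b4 d : R) :
  affine_action oz ot ox oy (@sol3_frame R) (@plus_minus_one R)
    (Gamma3b a1 a2 a3 a4 b1 b2 b3 b4 d).
Proof.
apply: (generated_affine_action (sol3_zt_model R)).
move=> f [[[|]|]|] ->.
- by apply: (@affine_sol3 _ (pt a1 b1 0 0) 1 plus); coordinates.
- by apply: (@affine_sol3 _ (pt a2 b2 0 0) 1 plus); coordinates.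
- by apply: (@affine_sol3 _ (pt a3 b3 1 0) (- 1) minus); coordinates.
- by apply: (@affine_sol3 _ (pt a4 b4 0 d) 1 plus); coordinates.
Qed.

End Families.

Theorem proposition3p1 (R : realType)
    (mul : 'rV[R]_4 -> 'rV[R]_4 -> 'rV[R]_4)
    (Gamma : set ('rV[R]_4 -> 'rV[R]_4))
    (pr : 'rV[R]_4 -> 'rV[R]_2)
    (Omega : 'rV[R]_4 -> 'M[R]_4) :
  fibration_family mul Gamma pr ->
  acts_freely Gamma ->
  acts_properly_discontinuously Gamma ->
  acts_cocompactly Gamma ->
  torus_bundle Gamma pr ->
  symplectic Omega ->
  invariant_form mul Gamma Omega ->
  nonzero_on_fibres pr Omega ->
  (exists g J : 'rV[R]_4 -> 'M[R]_4,
     invariant_almost_kahler mul Gamma g J Omega /\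
     J_holomorphic Gamma pr J) /\
  (forall g J : 'rV[R]_4 -> 'M[R]_4,
     invariant_almost_kahler mul Gamma g J Omega ->
     J_holomorphic Gamma pr J ->
     forall (F : 'rV[R]_2 -> R) (sigma : 'rV[R]_4 -> R) (D : set 'rV[R]_4),
       smooth F ->
       base_periodic (base_lattice Gamma pr) F ->
       (forall p, sigma p = expR (F (pr p)) * wedge (Omega p) (Omega p)) ->
       fundamental_domain Gamma D ->
       integral_over D sigma
         = integral_over D (fun p => wedge (Omega p) (Omega p)) ->
       exists alpha : 'rV[R]_4 -> 'rV[R]_4,
         [/\ smooth_mx alpha,
             forall f, Gamma f -> preserves_1form f alpha,
             positive_11 J (fun p => Omega p + ext_d alpha p) &
             forall p, wedge (Omega p + ext_d alpha p)
                             (Omega p + ext_d alpha p) = sigma p]).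

Proof.
case.
- move=> n _; exact: model_calabi_yau (nil3_xy_model R) (Gamma1a_xy_affine_action R n).
- move=> n _; exact: model_calabi_yau (nil3_yt_model R) (Gamma1a_yt_affine_action R n).
- move=> a1 a2 b1 b2 c3 _ _.
  exact: model_calabi_yau (nil3_yt_model R) (Gamma1b_affine_action _ _ _ _ _).
- move=> a1 a3 b1 b4 _ _.
  exact: model_calabi_yau (nil3_yt_model R) (Gamma1c_affine_action _ _ _ _).
- move=> H [HH _ _] _.
  exact: model_calabi_yau (nil4_zt_model R)
    (left_translations_affine_action (nil4_zt_model R) HH).
- move=> a1 a2 a3 a4 b1 b2 b3 b4 e d se.
  exact: model_calabi_yau (sol3_zt_model R)
    (Gamma3a_affine_action _ _ _ _ _ _ _ _ _ se).
- move=> a1 a2 a3 a4 b1 b2 b3 b4 d.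
  exact: model_calabi_yau (sol3_zt_model R)
    (Gamma3b_affine_action _ _ _ _ _ _ _ _ _).
Qed.
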